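(* Let $\Omega\subset\mathbb{R}^2$ be a domain, let $f\in L^\infty(\Omega)$, let $u_0$ be the trace of a fixed function in $H^1(\Omega;\mathbb{R}^2)$, and let $u\in H^1_{u_0}(\Omega;\mathbb{R}^2)$ be a weak solution of the Euler-Lagrange equation $$\int_\Omega 2\nabla u\cdot\nabla\varphi+f\,\mathrm{cof}\,\nabla u\cdot\nabla\varphi\,dx=0\qquad\text{for all }\varphi\in W^{1,2}_0(\Omega;\mathbb{R}^2).$$ Assume that the functional $F(\varphi):=\int_\Omega|\nabla\varphi|^2+f\det\nabla\varphi\,dx$ is mean coercive, i.e. there is $\gamma>0$ such that $$F(\varphi)\ge\gamma\int_\Omega|\nabla\varphi|^2\,dx\qquad\text{for all }\varphi\in H^1_0(\Omega;\mathbb{R}^2).$$ Then there is $p>2$ such that $u$ belongs to $W^{1,p}_{\mathrm{loc}}(\Omega;\mathbb{R}^2)$.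
   Context: $H^1_{u_0}(\Omega;\mathbb{R}^2)$ is the set of $v\in H^1(\Omega;\mathbb{R}^2)$ with $v=u_0$ on $\partial\Omega$ in the sense of traces. For matrices, $A\cdot B=\mathrm{tr}(A^TB)$, $|A|^2=A\cdot A$, and for $A\in\mathbb{R}^{2\times2}$ with rows $(a,b)$, $(c,d)$, $\mathrm{cof}\,A$ has rows $(d,-c)$, $(-b,a)$. *)

(* Defs.v *)
From HB Require Import structures.
From mathcomp Require Import all_boot all_order all_algebra.
From mathcomp Require Import all_classical all_reals all_analysis.

Set Implicit Arguments.
Unset Strict Implicit.
Unset Printing Implicit Defensive.
Import Order.TTheory GRing.Theory Num.Theory.
Import numFieldNormedType.Exports.

Local Open Scope classical_set_scope.
Local Open Scope ring_scope.

(* Used for matrices as well as for row vectors, so that [frobmx A A] is the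
   squared Euclidean norm in both cases. *)
Definition frobmx (R : realType) (m n : nat) (A B : 'M[R]_(m, n)) : R :=
  \tr (A^T *m B).

Definition cofmx (R : realType) (n : nat) (A : 'M[R]_n) : 'M[R]_n :=
  \matrix_(i, j) cofactor A i j.

Lemma cofmx2E (R : realType) (A : 'M[R]_2) :
  [/\ cofmx A 0 0 = A 1 1, cofmx A 0 1 = - A 1 0,
      cofmx A 1 0 = - A 0 1 & cofmx A 1 1 = A 0 0].
Proof.
have e0 : lift (0 : 'I_2) (0 : 'I_1) = 1 by apply/val_inj.
have e1 : lift (1 : 'I_2) (0 : 'I_1) = 0 by apply/val_inj.
split; rewrite mxE /cofactor det_mx11 !mxE ?e0 ?e1 //=.
- by rewrite expr0 mul1r.
- by rewrite expr1 mulN1r.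
- by rewrite expr1 mulN1r.
- by rewrite expr2 mulN1r opprK mul1r.
Qed.

Section plane.
Variable R : realType.

(* Two-dimensional Lebesgue measure on the Borel sets: an a.e. class of
   Lebesgue measurable functions always has a Borel representative. *)
Definition leb2 := (@lebesgue_measure R \x @lebesgue_measure R)%E.

Definition domain (Omega : set (R * R)) : Prop :=
  [/\ Omega !=set0, open Omega & connected Omega].

Definition compactly_contained (Omega' Omega : set (R * R)) : Prop :=
  compact (closure Omega') /\ closure Omega' `<=` Omega.

Definition basis2 (j : 'I_2) : R * R := if j == 0 then (1, 0) else (0, 1).

Definition partial (j : 'I_2) (g : R * R -> R) : R * R -> R :=
  fun x => 'D_(basis2 j) g x.

Definition smooth2 (g : R * R -> R) : Prop :=
  forall (s : seq 'I_2) (x : R * R), differentiable (foldr partial g s) x.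

Definition test_fun (Omega : set (R * R)) (g : R * R -> R) : Prop :=
  smooth2 g /\
  exists K : set (R * R), [/\ compact K, K `<=` Omega &
    forall x, ~ K x -> g x = 0].

Definition L1loc (Omega : set (R * R)) (g : R * R -> R) : Prop :=
  measurable_fun Omega g /\
  forall K : set (R * R), compact K -> K `<=` Omega ->
    leb2.-integrable K (EFin \o g).

Definition Lp_on (Omega : set (R * R)) (p : \bar R) (g : R * R -> R) : Prop :=
  (g \_ Omega) \in Lfun leb2 p.

Definition vcomp (v : R * R -> 'rV[R]_2) (i : 'I_2) : R * R -> R :=
  fun x => v x 0 i.

Definition test_map (Omega : set (R * R)) (v : R * R -> 'rV[R]_2) : Prop :=
  forall i, test_fun Omega (vcomp v i).

(* Row [i] of the gradient matrix is the gradient of the component [i]. *)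
Definition is_wgrad (Omega : set (R * R)) (v : R * R -> 'rV[R]_2)
    (G : R * R -> 'M[R]_2) : Prop :=
  forall i j : 'I_2,
    [/\ L1loc Omega (vcomp v i), L1loc Omega (fun x => G x i j) &
      forall g, test_fun Omega g ->
        \int[leb2]_(x in Omega) (vcomp v i x * partial j g x) =
        - \int[leb2]_(x in Omega) (G x i j * g x)].

(* A representative of the weak gradient, which is unique up to a null set. *)
Definition wgrad (Omega : set (R * R)) (v : R * R -> 'rV[R]_2) :
    R * R -> 'M[R]_2 :=
  get [set G | is_wgrad Omega v G].

Definition W1p (Omega : set (R * R)) (p : \bar R) (v : R * R -> 'rV[R]_2) :
    Prop :=
  (forall i, Lp_on Omega p (vcomp v i)) /\
  exists G, is_wgrad Omega v G /\
    forall i j, Lp_on Omega p (fun x => G x i j).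

Definition W1p_loc (Omega : set (R * R)) (p : \bar R)
    (v : R * R -> 'rV[R]_2) : Prop :=
  forall Omega', open Omega' -> compactly_contained Omega' Omega ->
    W1p Omega' p v.

Definition H1 (Omega : set (R * R)) (v : R * R -> 'rV[R]_2) : Prop :=
  W1p Omega 2%:E v.

Definition H1norm (Omega : set (R * R)) (v : R * R -> 'rV[R]_2) : R :=
  Num.sqrt (\int[leb2]_(x in Omega)
    (frobmx (v x) (v x) + frobmx (wgrad Omega v x) (wgrad Omega v x))).

Definition H10 (Omega : set (R * R)) (v : R * R -> 'rV[R]_2) : Prop :=
  H1 Omega v /\
  exists w : nat -> R * R -> 'rV[R]_2,
    (forall n, test_map Omega (w n)) /\
    H1norm Omega (v \- w n) @[n --> \oo] --> (0 : R).

(* No regularity of the boundary is assumed, so having the same trace as [U0]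
   means differing from [U0] by an element of [H10]. *)
Definition H1_bc (Omega : set (R * R)) (U0 v : R * R -> 'rV[R]_2) : Prop :=
  H1 Omega v /\ H10 Omega (v \- U0).

Definition weak_solution (Omega : set (R * R)) (f : R * R -> R)
    (u : R * R -> 'rV[R]_2) : Prop :=
  forall phi, H10 Omega phi ->
    \int[leb2]_(x in Omega)
      (2 * frobmx (wgrad Omega u x) (wgrad Omega phi x) +
       f x * frobmx (cofmx (wgrad Omega u x)) (wgrad Omega phi x)) = 0.

Definition energy (Omega : set (R * R)) (f : R * R -> R)
    (phi : R * R -> 'rV[R]_2) : R :=
  \int[leb2]_(x in Omega)
    (frobmx (wgrad Omega phi x) (wgrad Omega phi x) +
     f x * \det (wgrad Omega phi x)).

Definition mean_coercive (Omega : set (R * R)) (f : R * R -> R) : Prop :=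
  exists2 gamma : R, 0 < gamma & forall phi, H10 Omega phi ->
    energy Omega f phi >= gamma *
      \int[leb2]_(x in Omega) frobmx (wgrad Omega phi x) (wgrad Omega phi x).

End plane.

(* Main.v *)
Require Import Defs.
From HB Require Import structures.
From mathcomp Require Import all_boot all_order all_algebra finmap.
From mathcomp Require Import all_classical all_reals all_analysis.
From mathcomp Require Import measurable_realfun ess_sup_inf ring lra.
Import Order.TTheory GRing.Theory Num.Theory.
Import numFieldNormedType.Exports.
Local Open Scope classical_set_scope.
Local Open Scope ring_scope.

(* Testing the coercivity with psi = eta (u - c) and the equation with
   eta^2 (u - c), the pointwise identity
     |D psi|^2 + f det D psi
       = (2 Du . D(eta^2 w) + f cof Du . D(eta^2 w)) / 2 + |w|^2 |D eta|^2
   (w = u - c) turns mean coercivity into a Caccioppoli inequality, even though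
   the energy density need not be pointwise coercive.  With the W^{1,1}-Poincare
   inequality on squares this gives the reverse Hoelder inequality
     int_{Q_r} |Du|^2 <= K r^-2 (int_{Q_2r} |Du|)^2,
   and Gehring's lemma yields |Du| in L^p for some p > 2 depending on K only.
   Gehring's lemma: a stopping-time covering gives the good-lambda inequality
     int_{F > l} F^2 <= C l int_{F > l/a} F
   for |Du| weighted by the distance to the boundary of a square; along l = l0 a^j
   the quantity S_j - X_j / a, with S_j = int_{F > l} F^2 and X_j = l int_{F > l} F,
   decays geometrically.
   The weak derivatives are reached by mollification; u itself is locally in L^4
   by Poincare's inequality applied to the square of a component. *)

Set Implicit Arguments.
Unset Strict Implicit.
Unset Printing Implicit Defensive.

(** * Lebesgue measure of the plane: squares, translations, continuity of translations in L^1 and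
    L^2 *)

Section plane_measure.
Import HBSimple.
Context {R : realType}.
Local Notation mu := (@leb2 R).
Local Notation leb := (@lebesgue_measure R).

(** The identity holds because the density is a quadratic form in the gradient whose polar form is
    the Euler-Lagrange operator: the part quadratic in D eta is the rank-one matrix w (x) D eta,
    whose determinant vanishes, so f is never differentiated and leaves no term of its own.
    Obstacle: eta (u - c) lies in [H10] only through a limiting argument. The test maps are
    therefore built from a smooth v close to u, while the equation keeps its coefficient G, the weak
    gradient of u; the defect Dv - G becomes an extra error, absorbed by Young's inequality and sent
    to zero at the end. Chosen gradients and a.e. bounds are likewise removed early: f becomes an
    everywhere bounded f0, and the hypotheses are reduced to smooth test maps with classical
    partials. Squares replace balls because they are products of intervals, so that Tonelli leads to
    integrals along lines. The exponent must be fixed before the subdomain, so K is chosen from the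
    bound of f and gamma alone, ahead of the domain and of u. The gain s is kept at most 2 because
    [W1p] also asks for u in L^p, and L^4 is what is shown for u. *)

Definition sq (c : R * R) (r : R) : set (R * R) :=
  [set x | `|x.1 - c.1| < r /\ `|x.2 - c.2| < r].

Definition csq (c : R * R) (r : R) : set (R * R) :=
  [set x | `|x.1 - c.1| <= r /\ `|x.2 - c.2| <= r].

Lemma sqE c r : sq c r = `]c.1 - r, c.1 + r[ `*` `]c.2 - r, c.2 + r[.
Proof.
by apply/seteqP; split=> x /=; rewrite /sq /= !in_itv/= !ltr_distl.
Qed.

Lemma csqE c r : csq c r = `[c.1 - r, c.1 + r] `*` `[c.2 - r, c.2 + r].
Proof.
by apply/seteqP; split=> x /=; rewrite /csq /= !in_itv/= !ler_distl.
Qed.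

Lemma measurable_sq c r : measurable (sq c r).
Proof. by rewrite sqE; apply: measurableX; exact: measurable_itv. Qed.

Lemma measurable_csq c r : measurable (csq c r).
Proof. by rewrite csqE; apply: measurableX; exact: measurable_itv. Qed.

Lemma leb2X (A B : set R) : measurable A -> measurable B ->
  mu (A `*` B) = (leb A * leb B)%E.
Proof. exact: (@product_measure1E _ _ (measurableTypeR R) (measurableTypeR R) R leb leb). Qed.

Lemma leb2U (A B : set (R * R)) : measurable A -> measurable B ->
  (mu (A `|` B) <= mu A + mu B)%E.
Proof. exact: (@measureU2 _ _ _ mu). Qed.

Lemma leb2_csq c r : 0 <= r -> mu (csq c r) = (4 * r ^+ 2)%:E.
Proof.
move=> r0; rewrite csqE leb2X; [|exact: measurable_itv..].
rewrite !lebesgue_measure_itv/= !lte_fin.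
have E (a : R) : (if a - r < a + r then ((a + r)%:E - (a - r)%:E)%E else 0%E) = (2 * r)%:E.
  case: ifPn; first by move=> _; rewrite -EFinB; congr EFin; ring.
  rewrite -leNgt => h; have -> : r = 0 by lra.
  by rewrite mulr0.
by rewrite !E -EFinM; congr EFin; ring.
Qed.

Lemma leb_shift (a : R) (A : set R) : measurable A ->
  leb [set x | A (x + a)] = leb A.
Proof.
move=> mA; symmetry.
have mf : measurable_fun [set: measurableTypeR R] ((fun x => x + a) : measurableTypeR R -> measurableTypeR R).
  exact: (@measurable_funD _ _ _ _ id (cst a)).
apply: (@lebesgue_measure_unique _ (pushforward leb (fun x : measurableTypeR R => x + a : measurableTypeR R))) => //.
move=> X [[c d]] /= _ <-; rewrite /pushforward.
rewrite (_ : _ @^-1` _ = `]c - a, d - a]%classic); last first.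
  by apply/seteqP; split=> x /=; rewrite !in_itv/= ltrBlDr lerBrDr.
rewrite [LHS]lebesgue_measure_itv/= [RHS]lebesgue_measure_itv/= !lte_fin ltrD2r.
by case: ifP => // _; rewrite -!EFinB; congr EFin; ring.
Qed.

Definition tr (a x : R * R) : R * R := (x.1 + a.1, x.2 + a.2).

Lemma measurable_tr (a : R * R) : measurable_fun setT (tr a).
Proof.
apply: measurable_fun_pair.
- exact: (measurable_funD measurable_fst (measurable_cst _)).
- exact: (measurable_funD measurable_snd (measurable_cst _)).
Qed.

(** Uniqueness of the product measure: the pushforward under a translation has the right value on
    measurable rectangles by [leb_shift]. *)
Lemma leb2_tr (a : R * R) (A : set (R * R)) : measurable A ->
  mu (tr a @^-1` A) = mu A.
Proof.
move=> mA; symmetry.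
have mf := measurable_tr a.
apply: (@product_measure_unique _ _ (measurableTypeR R) (measurableTypeR R) R leb leb (pushforward mu (tr a : measurableTypeR R * measurableTypeR R -> measurableTypeR R * measurableTypeR R))) => // X Y mX mY.
transitivity (leb [set x : R | X (x + a.1)%R] * leb [set x : R | Y (x + a.2)%R])%E; last first.
  by congr (_ * _)%E; exact: leb_shift.
have mS (b : R) (Z : set R) : measurable Z -> measurable [set x | Z (x + b)].
  move=> mZ; rewrite -[X in measurable X]setTI.
  exact: (@measurable_funD _ _ _ _ id (cst b)).
by rewrite -leb2X; [|exact: mS..].
Qed.

Lemma ge0_integral_tr (a : R * R) (f : R * R -> \bar R) :
  measurable_fun setT f -> (forall x, 0 <= f x)%E ->
  (\int[mu]_x f (tr a x) = \int[mu]_x f x)%E.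
Proof.
move=> mf f0; symmetry.
have mphi := measurable_tr a.
transitivity (\int[pushforward mu (tr a : measurableTypeR R * measurableTypeR R -> measurableTypeR R * measurableTypeR R)]_x f x)%E.
  apply: eq_measure_integral => A mA _; rewrite /pushforward.
  exact/esym/leb2_tr.
by rewrite ge0_integral_pushforward.
Qed.

Lemma integrable_tr (a : R * R) (f : R * R -> \bar R) :
  mu.-integrable setT f -> mu.-integrable setT (f \o tr a).
Proof.
move=> /integrableP[mf lf]; apply/integrableP; split.
  exact: (measurableT_comp mf (measurable_tr a)).
rewrite (@ge0_integral_tr a (fun x => `|f x|%E)) //.
exact: measurableT_comp.
Qed.

Lemma integral_tr (a : R * R) (f : R * R -> \bar R) :
  mu.-integrable setT f ->
  (\int[mu]_x f (tr a x) = \int[mu]_x f x)%E.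
Proof.
move=> fi; have mf := measurable_int _ fi.
have E1 := @ge0_integral_tr a f^\+%E (measurable_funepos mf) (funepos_ge0 f).
have E2 := @ge0_integral_tr a f^\-%E (measurable_funeneg mf) (funeneg_ge0 f).
transitivity (\int[mu]_x f^\+ (tr a x) - \int[mu]_x f^\- (tr a x))%E.
  have := integralE mu setT (f \o tr a : measurableTypeR R * measurableTypeR R -> \bar R).
  by rewrite funepos_comp funeneg_comp.
by rewrite E1 E2 -integralE.
Qed.

Lemma exp2_lt (e : R) : 0 < e -> \forall n \near \oo, 2^-1 ^+ n < e.
Proof.
move=> e0; have /cvgr0Pnorm_lt : (GRing.exp (2^-1 : R) : R^nat) @ \oo --> (0:R).
  by apply: cvg_expr; rewrite ger0_norm; lra.
move=> /(_ e e0); apply: filterS => n; rewrite ger0_norm// exprn_ge0//; lra.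
Qed.

(** The index encodes a rational centre and an exponent; indices that encode nothing get a default
    square. Wherever squares centred at arbitrary points must be reduced to countably many, this
    family is used. *)
Lemma dyadic_squares : exists (c : nat -> R * R) (k : nat -> nat),
  forall x n, exists i, k i = n /\ sq (c i) (2^-1 ^+ n) x.
Proof.
exists (fun i => if @choice.unpickle ((rat * rat) * nat)%type i is Some (q, _) then (ratr (q : rat * rat).1, ratr q.2) else (0, 0)).
exists (fun i => if @choice.unpickle ((rat * rat) * nat)%type i is Some (_, n) then n else 0%N).
move=> x n.
have e0 : 0 < (2^-1 : R) ^+ n by rewrite exprn_gt0.
have /rat_in_itvoo[q1] : x.1 - 2^-1 ^+ n < x.1 + 2^-1 ^+ n by lra.
have /rat_in_itvoo[q2] : x.2 - 2^-1 ^+ n < x.2 + 2^-1 ^+ n by lra.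
rewrite !in_itv/= => h2 h1.
exists (choice.pickle ((q1, q2), n)); rewrite choice.pickleK; split => //=.
by rewrite /sq/= distrC [X in _ /\ X < _]distrC !ltr_distl.
Qed.

Lemma open_csq (O : set (R * R)) x : open O -> O x ->
  exists2 r : R, 0 < r & csq x r `<=` O.
Proof.
move=> oO Ox.
have /nbhs_ballP[e /= e0 h] : nbhs x O by exact: open_nbhs_nbhs.
exists (e / 2); first by rewrite divr_gt0.
move=> y [h1 h2]; apply: h; rewrite /ball/= /prod_ball /ball/=.
by split; rewrite /ball/= distrC; lra.
Qed.

(** Measurability in the plane refers to the product sigma-algebra, so an open set has to be written
    as a countable union of squares. *)
Lemma open_measurable2 (O : set (R * R)) : open O -> measurable O.
Proof.
move=> oO; have [c [k ck]] := dyadic_squares.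
rewrite (_ : O = \bigcup_(i in [set i | sq (c i) (2^-1 ^+ k i) `<=` O]) sq (c i) (2^-1 ^+ k i)).
  by apply: bigcup_measurable => i _; exact: measurable_sq.
apply/seteqP; split => [x Ox|x [i /= iO]]; last exact: iO.
have [r r0 rO] := open_csq oO Ox.
have [n _ /(_ n (leqnn n)) /= nr] := @exp2_lt (r / 2) ltac:(lra).
have [i [ki xi]] := ck x n; exists i; rewrite /= ki //.
move=> y [y1 y2]; case: xi => x1 x2; apply: rO; split.
  by have := ler_distD (c i).1 y.1 x.1; rewrite [X in _ <= _ + X]distrC; lra.
by have := ler_distD (c i).2 y.2 x.2; rewrite [X in _ <= _ + X]distrC; lra.
Qed.

Lemma continuous_measurable2 (f : R * R -> R) : continuous f ->
  measurable_fun setT f.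
Proof.
move=> /continuousP cf.
apply: (measurability _ (RGenOpens.measurableE R)) => //.
move=> _ [_ [a [b ->] <-]]; rewrite setTI; apply: open_measurable2.
by apply: cf; exact: interval_open.
Qed.

Definition tdiff (w : R * R -> R) (a : R * R) : \bar R :=
  (\int[mu]_x (`|w (tr a x) - w x|)%:E)%E.

(** Continuity of translations in L^1 at the origin. Since [tdiff] takes extended values, no
    integrability of [w] is presupposed. *)
Definition tcont (w : R * R -> R) := forall e, 0 < e ->
  exists2 d, 0 < d & forall a : R * R, `|a.1| < d -> `|a.2| < d ->
    (tdiff w a <= e%:E)%E.

Lemma measurable_fun_tr (w : R * R -> R) a : measurable_fun setT w ->
  measurable_fun setT (fun x => w (tr a x)).
Proof. by move=> mw; exact: (measurableT_comp mw (measurable_tr a)). Qed.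

Lemma tcontD (w1 w2 : R * R -> R) : measurable_fun setT w1 ->
  measurable_fun setT w2 -> tcont w1 -> tcont w2 -> tcont (w1 \+ w2).
Proof.
move=> m1 m2 c1 c2 e e0; have e20 : 0 < e / 2 by lra.
have [d1 d10 h1] := c1 _ e20; have [d2 d20 h2] := c2 _ e20.
exists (Num.min d1 d2); first by rewrite lt_min d10.
move=> a; rewrite !lt_min => /andP[a1 a2] /andP[a3 a4].
have M (w : R * R -> R) : measurable_fun setT w ->
    measurable_fun setT (fun x : R * R => `|w (tr a x) - w x|).
  by move=> mw; apply: measurableT_comp => //; apply: measurable_funB => //; exact: measurable_fun_tr.
apply: (@le_trans _ _ (tdiff w1 a + tdiff w2 a)%E); last first.
  by rewrite (splitr e) EFinD leeD// ?h1 ?h2.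
rewrite /tdiff -ge0_integralD//; last 2 first.
- by apply/measurable_EFinP; exact: M.
- by apply/measurable_EFinP; exact: M.
apply: ge0_le_integral => //.
- by apply/measurable_EFinP; apply: M; exact: measurable_funD.
- by apply: emeasurable_funD; apply/measurable_EFinP; exact: M.
- move=> x _; rewrite -EFinD lee_fin /=.
  apply: le_trans (ler_normD _ _); rewrite le_eqVlt; apply/orP; left; apply/eqP; congr (`| _ |); ring.
Qed.

Lemma tcontZ (c : R) (w : R * R -> R) : measurable_fun setT w ->
  tcont w -> tcont (fun x => c * w x).
Proof.
move=> mw cw e e0; have e1 : 0 < e / (`|c| + 1) by rewrite divr_gt0// ltr_wpDl.
have [d d0 h] := cw _ e1; exists d => // a a1 a2.
have -> : tdiff (fun x => c * w x) a = (`|c|%:E * tdiff w a)%E.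
  rewrite /tdiff -ge0_integralZl//; last first.
    by apply/measurable_EFinP; apply: measurableT_comp => //; apply: measurable_funB => //; exact: measurable_fun_tr.
  by apply: eq_integral => x _; rewrite -mulrBr normrM EFinM.
apply: (@le_trans _ _ (`|c|%:E * (e / (`|c| + 1))%:E)%E).
  by rewrite lee_wpmul2l ?lee_fin ?h.
rewrite -EFinM lee_fin mulrCA ger_pMr// ler_pdivrMr ?ltr_wpDl// mul1r; lra.
Qed.

(** Three-epsilon argument; by translation invariance the translated error between [w] and [w']
    equals the untranslated one. *)
Lemma tcont_lim (w : R * R -> R) : measurable_fun setT w ->
  (forall e, 0 < e -> exists w', [/\ measurable_fun setT w', tcont w' &
    (\int[mu]_x (`|w x - w' x|)%:E <= e%:E)%E]) -> tcont w.
Proof.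
move=> mw H e e0; have e30 : 0 < e / 3 by lra.
have [w' [mw' cw' ww']] := H _ e30; have [d d0 h] := cw' _ e30.
exists d => // a a1 a2.
have mD : measurable_fun setT (fun x : R * R => `|w x - w' x|).
  by apply: measurableT_comp => //; exact: measurable_funB.
have mD' : measurable_fun setT (fun x : R * R => `|w' (tr a x) - w' x|).
  by apply: measurableT_comp => //; apply: measurable_funB => //; exact: measurable_fun_tr.
have mDa : measurable_fun setT (fun x : R * R => `|w (tr a x) - w' (tr a x)|).
  exact: (measurable_fun_tr a mD).
pose D := (\int[mu]_x (`|w x - w' x|)%:E)%E.
apply: (@le_trans _ _ (D + tdiff w' a + D)%E); last first.
  have -> : e = e / 3 + e / 3 + e / 3 by lra.
  by rewrite !EFinD leeD// leeD// h.
rewrite {1}/D -(@ge0_integral_tr a (fun x => (`|w x - w' x|)%:E))//; last exact/measurable_EFinP.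
rewrite /tdiff -ge0_integralD//; [|exact/measurable_EFinP..].
rewrite /D -ge0_integralD//; last 3 first.
- by move=> x _; rewrite adde_ge0.
- by apply: emeasurable_funD; exact/measurable_EFinP.
- exact/measurable_EFinP.
apply: ge0_le_integral => //.
- by apply/measurable_EFinP; apply: measurableT_comp => //; apply: measurable_funB => //; exact: measurable_fun_tr.
- by apply: emeasurable_funD; [apply: emeasurable_funD|]; exact/measurable_EFinP.
- move=> x _; rewrite -!EFinD lee_fin.
  rewrite [X in _ <= _ + X]distrC.
  apply: (le_trans _ (lerD (ler_normD _ _) (lexx _))); apply: (le_trans _ (ler_normD _ _)).
  by rewrite le_eqVlt; apply/orP; left; apply/eqP; congr (`| _ |); ring.
Qed.

Lemma itv_shift_near (a b u z t : R) : `|z| < t ->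
  ~ (a - t <= u <= a + t) -> ~ (b - t <= u <= b + t) ->
  (a < u + z <= b) = (a < u <= b).
Proof.
rewrite ltr_norml => /andP[z1 z2] na nb.
apply/idP/idP => /andP[h1 h2]; apply/andP; split.
- by rewrite ltNge; apply/negP => k; apply: na; lra.
- by rewrite leNgt; apply/negP => k; apply: nb; lra.
- by rewrite ltNge; apply/negP => k; apply: na; lra.
- by rewrite leNgt; apply/negP => k; apply: nb; lra.
Qed.

(** The minimum and maximum are there because the endpoints may come in the wrong order, in which
    case the interval is empty. *)
Lemma itv_shift_far (a b u z t : R) : `|z| < t -> t <= 1 ->
  ~ (Num.min a b - 1 <= u <= Num.max a b + 1) ->
  (a < u + z <= b) = false /\ (a < u <= b) = false.
Proof.
rewrite ltr_norml => /andP[z1 z2] t1 nJ.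
have m1 : Num.min a b <= a by rewrite ge_min lexx.
have m2 : b <= Num.max a b by rewrite le_max lexx orbT.
by split; apply/negP => /andP[h1 h2]; apply: nJ; lra.
Qed.

Lemma tcont_box (a b c d : R) : tcont \1_(`]a, b] `*` `]c, d]).
Proof.
move=> e e0.
pose L1 := `|b - a| + 2; pose L2 := `|d - c| + 2.
have L10 : 0 < L1 by rewrite ltr_wpDl.
have L20 : 0 < L2 by rewrite ltr_wpDl.
pose X : set (R * R) := `]a, b] `*` `]c, d].
pose t := Num.min 1 (e / (4 * (L1 + L2))).
have t0 : 0 < t by rewrite lt_min ltr01/= divr_gt0//; lra.
have t1 : t <= 1 by rewrite ge_min lexx.
have te : t * (4 * (L1 + L2)) <= e.
  by rewrite -ler_pdivlMr ?ge_min ?lexx ?orbT//; lra.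
exists t => // z z1 z2.
pose I (u : R) := [set` `[u - t, u + t]] : set R.
pose J1 := [set` `[Num.min a b - 1, Num.max a b + 1]] : set R.
pose J2 := [set` `[Num.min c d - 1, Num.max c d + 1]] : set R.
have mI u : measurable (I u) by exact: measurable_itv.
have mJ1 : measurable J1 by exact: measurable_itv.
have mJ2 : measurable J2 by exact: measurable_itv.
have lI u : leb (I u) = (2 * t)%:E.
  rewrite /I lebesgue_measure_itv/= lte_fin ifT; last lra.
  by rewrite -EFinB; congr EFin; ring.
have lJ (u v : R) : leb [set` `[Num.min u v - 1, Num.max u v + 1]] = (`|v - u| + 2)%:E.
  rewrite lebesgue_measure_itv/= lte_fin.
  have [uv|uv] := leP u v.
    by rewrite ifT; [rewrite -EFinB ger0_norm; [congr EFin; ring|lra]|lra].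
  by rewrite ifT; [rewrite -EFinB ltr0_norm; [congr EFin; ring|lra]|lra].
(* Four strips of width [2 * t] around the sides. Their lengths [L1], [L2] are those of the sides
   enlarged by one at each end, enough since [t <= 1]. Off [U] the indicator does not see the
   translation, so the error is at most the area of [U]. *)
pose U : set (R * R) := I a `*` J2 `|` I b `*` J2 `|` (J1 `*` I c `|` J1 `*` I d).
have mIJ u : measurable (I u `*` J2 : set (R * R)) by exact: measurableX.
have mJI u : measurable (J1 `*` I u : set (R * R)) by exact: measurableX.
have mU1 : measurable (I a `*` J2 `|` I b `*` J2 : set (R * R)) by exact: measurableU.
have mU2 : measurable (J1 `*` I c `|` J1 `*` I d : set (R * R)) by exact: measurableU.
have mU : measurable U by exact: measurableU.
have UE : (mu U <= (t * (4 * (L1 + L2)))%:E)%E.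
  apply: (le_trans (leb2U mU1 mU2)).
  have -> : t * (4 * (L1 + L2)) = (2 * t * L2 + 2 * t * L2) + (L1 * (2 * t) + L1 * (2 * t)) by ring.
  rewrite EFinD leeD//.
    apply: (le_trans (leb2U (mIJ a) (mIJ b))).
    by rewrite !leb2X// !lI /J2 lJ -!EFinM -EFinD.
  apply: (le_trans (leb2U (mJI c) (mJI d))).
  by rewrite !leb2X// !lI /J1 lJ -!EFinM -EFinD.
have mX : measurable X by apply: measurableX; exact: measurable_itv.
apply: (@le_trans _ _ (\int[mu]_x (\1_U x)%:E)%E); last first.
  by rewrite integral_indic// setIT (le_trans UE).
apply: ge0_le_integral => //.
- apply/measurable_EFinP; apply: measurableT_comp => //.
  have mi : measurable_fun setT (\1_X : R * R -> R) by exact: measurable_indic.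
  by apply: measurable_funB => //; exact: measurable_fun_tr.
- by apply/measurable_EFinP; exact: measurable_indic.
move=> x _; rewrite lee_fin.
have [Ux|nUx] := pselect (U x).
  rewrite [\1_U x]indicE mem_set// !indicE.
  by do 2 case: (_ \in _); rewrite /= ?subrr ?subr0 ?sub0r ?normrN ?normr1 ?normr0.
rewrite [\1_U x]indicE memNset//=.
suff -> : \1_(`]a, b] `*` `]c, d]) (tr z x) = (\1_(`]a, b] `*` `]c, d]) x : R) by rewrite subrr normr0.
rewrite !indicE; congr (_%:R); congr nat_of_bool.
have nU : ~ (I a x.1 /\ J2 x.2) /\ ~ (I b x.1 /\ J2 x.2) /\ ~ (J1 x.1 /\ I c x.2) /\ ~ (J1 x.1 /\ I d x.2).
  by split; [|split; [|split]] => h; apply: nUx; [left; left|left; right|right; left|right; right].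
move: nU; rewrite /I /J1 /J2 /= !in_itv/= => -[n1 [n2 [n3 n4]]].
have P (y : R * R) : (y \in `]a, b] `*` `]c, d])%classic = (a < y.1 <= b) && (c < y.2 <= d).
  by apply/idP/andP => [/set_mem[] /=|[? ?]]; rewrite ?in_itv//; apply/mem_set; split; rewrite /= in_itv.
rewrite !P /=.
have [x2|x2] := pselect (Num.min c d - 1 <= x.2 <= Num.max c d + 1); last first.
  by have [-> ->] := itv_shift_far z2 t1 x2; rewrite !andbF.
rewrite (itv_shift_near z1); [|by move=> h; exact: n1|by move=> h; exact: n2].
have [x1|x1] := pselect (Num.min a b - 1 <= x.1 <= Num.max a b + 1); last first.
  by have [_ ->] := itv_shift_far z1 t1 x1.
by rewrite (itv_shift_near z2); [|by move=> h; exact: n3|by move=> h; exact: n4].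
Qed.

(** Pi-lambda argument. Inside a set [D] of finite measure complements become differences and
    countable disjoint unions become L^1 limits of finite ones. The map [h] allows the argument to
    run on one coordinate at a time. *)
Lemma tcont_dynkin d (T : measurableType d) (h : R * R -> T) (D : set (R * R))
    (G : set (set T)) :
  measurable_fun setT h -> measurable D -> (mu D < +oo)%E ->
  @measurable _ T = <<s G >> -> setI_closed G ->
  tcont \1_D -> (forall A, G A -> tcont \1_(h @^-1` A `&` D)) ->
  forall A, measurable A -> tcont \1_(h @^-1` A `&` D).
Proof.
move=> mh mD fD GE GI tD tG A mA.
have mhA (B : set T) : measurable B -> measurable (h @^-1` B `&` D).
  by move=> mB; apply: measurableI => //; rewrite -[X in measurable X]setTI; exact: mh.
have miA (B : set T) : measurable B -> measurable_fun setT (\1_(h @^-1` B `&` D) : R * R -> R).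
  by move=> mB; apply: measurable_indic; exact: mhA.
apply: (@dynkin_induction _ T G (fun A => tcont \1_(h @^-1` A `&` D))) => //.
- by rewrite preimage_setT setTI.
- move=> S mS tS.
  have -> : \1_(h @^-1` (~` S) `&` D) = (\1_D \+ (fun x => -1 * \1_(h @^-1` S `&` D) x)) :> (R * R -> R).
    apply/funext => x /=; rewrite !indicE !in_setI preimage_setC in_setC.
    by case: (x \in D); case: (x \in _) => /=; lra.
  apply: tcontD => //.
    by apply: measurable_funM => //; exact: miA.
  by apply: tcontZ => //; exact: miA.
- move=> F mF tF tFn.
  apply: tcont_lim; first by apply: miA; exact: bigcup_measurable.
  move=> e e0.
  pose W n := \bigcup_(i < n) F i.
  have mW n : measurable (W n) by exact: bigcup_measurable.
  have tW n : tcont \1_(h @^-1` (W n) `&` D).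
    elim: n => [|n IH].
      rewrite /W bigcup_mkord big_ord0 preimage_set0 set0I.
      move=> e' e'0; exists 1 => // a _ _; rewrite /tdiff.
      by under eq_integral do rewrite !indicE !in_set0 subrr normr0; rewrite integral0 lee_fin ltW.
    have -> : \1_(h @^-1` (W n.+1) `&` D) = (\1_(h @^-1` (W n) `&` D) \+ \1_(h @^-1` (F n) `&` D)) :> (R * R -> R).
      have dj : W n `&` F n = set0.
        apply/seteqP; split => // y [[i /= ni Fi] Fn]; exfalso.
        move/trivIsetP : tF => /(_ i n I I).
        have -> : i != n by rewrite neq_ltn ni.
        by move=> /(_ isT) /seteqP[/(_ y)] /(_ (conj Fi Fn)).
      apply/funext => x /=; rewrite !indicE !in_setI.
      have -> : h @^-1` (W n.+1) = h @^-1` W n `|` h @^-1` F n.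
        by rewrite -preimage_setU /W !bigcup_mkord big_ord_recr.
      rewrite in_setU.
      have : (x \in h @^-1` W n) && (x \in h @^-1` F n) = false.
        by rewrite -in_setI -preimage_setI dj preimage_set0 in_set0.
      by case: (x \in D); case: (x \in h @^-1` W n); case: (x \in h @^-1` F n) => //=; rewrite ?addr0 ?add0r.
    by apply: tcontD => //; exact: miA.
  have cW : mu (h @^-1` (W n) `&` D) @[n --> \oo] --> mu (h @^-1` (\bigcup_k F k) `&` D).
    have -> : h @^-1` (\bigcup_k F k) `&` D = \bigcup_n (h @^-1` (W n) `&` D).
      rewrite -setI_bigcupl; congr (_ `&` _); rewrite !preimage_bigcup.
      apply/seteqP; split => [x [i _ Fi]|x [n _ [i /= _ Fi]]]; last by exists i.
      by exists i.+1 => //; exists i => /=.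
    apply: nondecreasing_cvg_mu.
    - by move=> n; exact: mhA.
    - by apply: bigcup_measurable => n _; exact: mhA.
    - move=> m n mn; apply/subsetPset; apply: setSI; apply: preimage_subset.
      by move=> y [i /= im Fi]; exists i => //=; exact: leq_trans im mn.
  have fin B : measurable B -> mu (h @^-1` B `&` D) \is a fin_num.
    move=> mB; rewrite ge0_fin_numE//; apply: le_lt_trans fD; apply: le_measure; rewrite ?inE//.
    exact: mhA.
  have mUF : measurable (\bigcup_k F k) by exact: bigcup_measurable.
  have [n hn] : exists n, (mu (h @^-1` (\bigcup_k F k) `&` D) - mu (h @^-1` (W n) `&` D) <= e%:E)%E.
    move: cW; rewrite -(fineK (fin _ mUF)) => /fine_cvgP[_ /cvgrPdist_lt/(_ e e0)[N _ /(_ N (leqnn N)) /= hN]].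
    exists N; rewrite -(fineK (fin _ mUF)) -(fineK (fin _ (mW N))) -EFinB lee_fin.
    exact/ltW/(le_lt_trans (ler_norm _) hN).
  exists \1_(h @^-1` (W n) `&` D); split => //; first exact: miA.
  have sub : h @^-1` (W n) `&` D `<=` h @^-1` (\bigcup_k F k) `&` D.
    by move=> x [[i /= _ Fi] Dx]; split => //; exists i.
  apply: le_trans hn.
  have -> : (mu (h @^-1` (\bigcup_k F k) `&` D) - mu (h @^-1` (W n) `&` D) = mu ((h @^-1` (\bigcup_k F k) `&` D) `\` (h @^-1` (W n) `&` D)))%E.
    rewrite [RHS](@measureD _ _ _ mu); [|exact: mhA|exact: mhA|by rewrite -ge0_fin_numE//; exact: fin].
    by congr (_ - mu _)%E; apply/esym/setIidPr.
  have <- : (\int[mu]_x (\1_((h @^-1` (\bigcup_k F k) `&` D) `\` (h @^-1` (W n) `&` D)) x)%:E = mu ((h @^-1` (\bigcup_k F k) `&` D) `\` (h @^-1` (W n) `&` D)))%E.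
    by rewrite integral_indic// ?setIT//; apply: measurableD; exact: mhA.
  rewrite le_eqVlt; apply/orP; left; apply/eqP; apply: eq_integral => x _.
  congr EFin; rewrite [RHS]indicE in_setD !indicE.
  have : (x \in h @^-1` (W n) `&` D) -> (x \in h @^-1` (\bigcup_k F k) `&` D).
    by move=> /set_mem /sub /mem_set.
  case: (x \in h @^-1` (W n) `&` D) => [/(_ isT) ->|_] /=; first by rewrite subrr normr0.
  by case: (_ \in _); rewrite subr0 ?normr1 ?normr0.
- by rewrite -GE.
Qed.

Lemma measurable2E :
  @measurable _ (R * R)%type = <<s [set A `*` B | A in measurable & B in measurable] >>.
Proof. exact: measurable_prod_measurableType. Qed.

Lemma ocitv0 (K : set R) : ocitv K -> exists a b : R, K = `]a, b]%classic.
Proof. by move=> [[a b] _ <-]; exists a, b. Qed.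

(** Three uses of [tcont_dynkin]: with [fst] the first side becomes an arbitrary Borel set, with
    [snd] the second side does, and with [id] rectangles give all measurable sets. *)
Lemma tcont_indic_box (k : R) (A : set (R * R)) : measurable A ->
  tcont \1_(A `&` (`]-k, k] `*` `]-k, k])).
Proof.
pose K : set R := `]-k, k]%classic.
have mK : measurable K by exact: measurable_itv.
have mR : @measurable _ R = <<s @ocitv R >>.
  by [].
have bX (I J : set R) : ocitv I -> ocitv J -> (mu (I `*` J) < +oo)%E.
  move=> /ocitv0[a [b ->]] /ocitv0[c [d ->]]; rewrite leb2X; [|exact: measurable_itv..].
  by rewrite !lebesgue_measure_itv/=; case: ifP => _; case: ifP => _; rewrite ?mule0 ?mul0e ?ltry// -!EFinB -EFinM ltry.
have oK : ocitv K by exists (-k, k).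
have mo (J : set R) : ocitv J -> measurable J by move=> /ocitv0[a [b ->]]; exact: measurable_itv.
have S0 (A' J : set R) : measurable A' -> ocitv J -> tcont \1_((A' `&` K) `*` J).
  move=> mA' oJ.
  have -> : (A' `&` K) `*` J = fst @^-1` A' `&` (K `*` J).
    by apply/seteqP; split => [x [[? ?] ?]|x [? [? ?]]].
  apply: (@tcont_dynkin _ R fst _ (@ocitv R)) => //.
  - by apply: measurableX => //; exact: mo.
  - exact: bX.
  - exact: ocitvI.
  - by case: oJ => -[c d] _ <-; exact: tcont_box.
  - move=> B oB.
    have -> : fst @^-1` B `&` (K `*` J) = (B `&` K) `*` J.
      by apply/seteqP; split => [x [? [? ?]]|x [[? ?] ?]].
    have [a [b ->]] := ocitv0 (ocitvI oB oK).
    by have [c [d ->]] := ocitv0 oJ; exact: tcont_box.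
have S1 (A' B' : set R) : measurable A' -> measurable B' -> tcont \1_((A' `&` K) `*` (B' `&` K)).
  move=> mA' mB'.
  have -> : (A' `&` K) `*` (B' `&` K) = snd @^-1` B' `&` ((A' `&` K) `*` K).
    by apply/seteqP; split => [x [[? ?] [? ?]]|x [? [[? ?] ?]]].
  apply: (@tcont_dynkin _ R snd _ (@ocitv R)) => //.
  - by apply: measurableX => //; exact: measurableI.
  - apply: le_lt_trans (bX _ _ oK oK); apply: le_measure; rewrite ?inE.
    + by apply: measurableX => //; exact: measurableI.
    + exact: measurableX.
    + by move=> x [[? ?] ?].
  - exact: ocitvI.
  - exact: S0.
  - move=> B oB.
    have -> : snd @^-1` B `&` ((A' `&` K) `*` K) = (A' `&` K) `*` (B `&` K).
      by apply/seteqP; split => [x [? [[? ?] ?]]|x [[? ?] [? ?]]].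
    by apply: S0 => //; exact: ocitvI.
move=> mA.
apply: (@tcont_dynkin _ _ id _ [set A `*` B | A in measurable & B in measurable]) => //.
- exact: measurableX.
- exact: bX.
- exact: measurable2E.
- move=> _ _ [A1 mA1 [B1 mB1 <-]] [A2 mA2 [B2 mB2 <-]].
  rewrite -setXI; exists (A1 `&` A2); first exact: measurableI.
  by exists (B1 `&` B2) => //; exact: measurableI.
- exact: tcont_box.
- move=> _ [A1 mA1 [B1 mB1 <-]].
  have -> : id @^-1` (A1 `*` B1) `&` (K `*` K) = (A1 `&` K) `*` (B1 `&` K).
    by apply/seteqP; split => [x [[? ?] [? ?]]|x [[? ?] [? ?]]].
  exact: S1.
Qed.

Lemma tcont_sum (I : Type) (s : seq I) (c : I -> R) (h : I -> R * R -> R) :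
  (forall i, measurable_fun setT (h i)) -> (forall i, tcont (h i)) ->
  tcont (fun x => \sum_(i <- s) c i * h i x).
Proof.
move=> mh th; elim: s => [|i s IH].
  move=> e e0; exists 1 => // a _ _; rewrite /tdiff.
  by under eq_integral do rewrite !big_nil subrr normr0; rewrite integral0 lee_fin ltW.
have -> : (fun x => \sum_(j <- i :: s) c j * h j x) = (fun x => c i * h i x) \+ (fun x => \sum_(j <- s) c j * h j x).
  by apply/funext => x; rewrite big_cons.
apply: tcontD => //.
- exact: measurable_funM.
- by apply: measurable_sum => j; exact: measurable_funM.
- exact: tcontZ.
Qed.

Lemma csq0_sub k x : csq 0 k x -> (`]-(k+1), k+1] `*` `]-(k+1), k+1])%classic x.
Proof.
by case; rewrite /= !subr0 !ler_norml => /andP[? ?] /andP[? ?]; split; rewrite /= in_itv/=; lra.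
Qed.

(** The approximating simple functions may have unbounded support. Multiplying them by the indicator
    of a box around the support of [w] does not increase their distance to [w] and brings
    [tcont_indic_box] into play. *)
Lemma tcont_L1 (w : R * R -> R) (k : R) :
  mu.-integrable setT (EFin \o w) -> (forall x, ~ csq 0 k x -> w x = 0) -> tcont w.
Proof.
move=> iw w0; have mw : measurable_fun setT w by apply/measurable_EFinP; exact: (measurable_int _ iw).
apply: tcont_lim => // e e0.
have [g [ig _ cg]] := approximation_sfun_integrable measurableT iw.
pose Q : set (R * R) := `]-(k+1), k+1] `*` `]-(k+1), k+1].
have mQ : measurable Q by apply: measurableX; exact: measurable_itv.
have [n hn] : exists n, (\int[mu]_x `|(w x)%:E - (g n x)%:E| <= e%:E)%E.
  move/fine_cvgP : cg => [[N1 _ h1] /cvgrPdist_lt/(_ e e0)[N _ h2]].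
  exists (maxn N1 N); have /fineK <- := h1 (maxn N1 N) (leq_maxl _ _).
  rewrite lee_fin.
  have := h2 (maxn N1 N) (leq_maxr _ _); rewrite /= sub0r normrN => h.
  exact/ltW/(le_lt_trans (ler_norm _) h).
have mg := @measurable_funPT _ _ _ _ (g n).
have gQE : (fun x => g n x * \1_Q x) = (fun x => \sum_(r <- fset_set (range (g n))) r * \1_(g n @^-1` [set r] `&` Q) x) :> (R * R -> R).
  apply/funext => x; rewrite {1}fimfunE fsbig_finite//=.
  rewrite mulr_suml; apply: eq_bigr => r _; rewrite -mulrA; congr (_ * _).
  by rewrite !indicE in_setI; case: (_ \in _); case: (_ \in _); rewrite /= ?mulr0 ?mulr1.
exists (fun x => g n x * \1_Q x); split.
- by apply: measurable_funM => //; exact: measurable_indic.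
- rewrite gQE; apply: tcont_sum => r.
    by apply: measurable_indic; apply: measurableI => //; rewrite -[X in measurable X]setTI; exact: mg.
  by apply: tcont_indic_box; rewrite -[X in measurable X]setTI; exact: mg.
- apply: le_trans hn; apply: ge0_le_integral => //.
  + apply/measurable_EFinP; apply: measurableT_comp => //; apply: measurable_funB => //.
    by apply: measurable_funM => //; exact: measurable_indic.
  + by apply: measurableT_comp => //; apply: emeasurable_funB; exact/measurable_EFinP.
  + move=> x _; rewrite -EFinB /abse lee_fin indicE.
    have [/set_mem xQ|/negP xQ] := boolP (x \in Q); first by rewrite mulr1.
    by rewrite mulr0 subr0 w0 ?normr0// => /csq0_sub/mem_set.
Qed.

Lemma csq_sub0 (c : R * R) r : csq c r `<=` csq 0 (`|c.1| + `|c.2| + r).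
Proof.
move=> x [h1 h2]; rewrite /csq /= !subr0.
have g1 := ler_distD c.1 x.1 0; have g2 := ler_distD c.2 x.2 0; rewrite !subr0 in g1 g2.
have ? := normr_ge0 c.1; have ? := normr_ge0 c.2.
by split; lra.
Qed.

(** For nonnegative p and q one has (p - q)^2 <= |p^2 - q^2|. Splitting into positive and negative
    parts reduces continuity of translations in L^2 to that in L^1, applied to the squares of the
    two parts. *)
Lemma sqr_maxB (a b : R) : (a - b) ^+ 2 <=
  2 * `|(Num.max a 0) ^+ 2 - (Num.max b 0) ^+ 2| +
  2 * `|(Num.max (- a) 0) ^+ 2 - (Num.max (- b) 0) ^+ 2|.
Proof.
have K (p q : R) : 0 <= p -> 0 <= q -> (p - q) ^+ 2 <= `|p ^+ 2 - q ^+ 2|.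
  move=> p0 q0; rewrite subr_sqr normrM (ger0_norm (addr_ge0 p0 q0)).
  rewrite -real_normK ?num_real// expr2 ler_wpM2l//.
  by rewrite (le_trans (ler_normB _ _))// !ger0_norm.
have E (p : R) : p = Num.max p 0 - Num.max (- p) 0.
  by have [h|h] := leP p 0; have [h'|h'] := leP (- p) 0; lra.
have m0 (p : R) : 0 <= Num.max p 0 by rewrite le_max lexx orbT.
rewrite {1}(E a) {1}(E b).
have h1 := K _ _ (m0 a) (m0 b); have h2 := K _ _ (m0 (- a)) (m0 (- b)).
apply: (@le_trans _ _ (2 * (Num.max a 0 - Num.max b 0) ^+ 2 + 2 * (Num.max (- a) 0 - Num.max (- b) 0) ^+ 2)); last lra.
set p := Num.max a 0; set q := Num.max b 0; set p' := Num.max _ 0; set q' := Num.max _ 0.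
rewrite -subr_ge0 (_ : _ - _ = (p - q + (p' - q')) ^+ 2); first exact: sqr_ge0.
ring.
Qed.

Lemma tcont_sqr (w : R * R -> R) (k : R) : measurable_fun setT w ->
  mu.-integrable setT (EFin \o (fun x => w x ^+ 2)) ->
  (forall x, ~ csq 0 k x -> w x = 0) ->
  forall e, 0 < e -> exists2 d, 0 < d & forall a : R * R, `|a.1| < d -> `|a.2| < d ->
    (\int[mu]_x ((w (tr a x) - w x) ^+ 2)%:E <= e%:E)%E.
Proof.
move=> mw iw w0 e e0.
have H (p : R -> R) : measurable_fun setT p -> p 0 = 0 -> (forall t, `|p t| <= `|t|) ->
    tcont (fun x => p (w x) ^+ 2).
  move=> mp p0 pt; apply: (@tcont_L1 _ k).
    apply: le_integrable iw => //.
      by apply/measurable_EFinP; apply: measurable_funX; exact: measurableT_comp.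
    by move=> x _ /=; rewrite lee_fin !normrX ler_sqr ?nnegrE.
  by move=> x xk; rewrite w0// p0 expr0n.
pose p1 (t : R) := Num.max t 0; pose p2 (t : R) := Num.max (- t) 0.
have mp1 : measurable_fun setT p1 by exact: (@measurable_maxr _ _ _ _ id (cst 0)).
have mp2 : measurable_fun setT p2.
  by apply: (@measurable_maxr _ _ _ _ (fun t : R => - t) (cst 0)) => //; exact: measurable_funN.
have p1t t : `|p1 t| <= `|t|.
  by rewrite /p1; have [h|h] := leP t 0; rewrite ?normr0.
have p2t t : `|p2 t| <= `|t|.
  by rewrite /p2; have [h|h] := leP (- t) 0; rewrite ?normr0 ?normrN.
have e40 : 0 < e / 4 by lra.
have p20 : p2 0 = 0 by rewrite /p2 oppr0 maxxx.
have [d1 d10 h1] := H p1 mp1 (maxxx 0) p1t _ e40.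
have [d2 d20 h2] := H p2 mp2 p20 p2t _ e40.
exists (Num.min d1 d2); first by rewrite lt_min d10.
move=> a; rewrite !lt_min => /andP[a1 a2] /andP[a3 a4].
have M (p : R -> R) : measurable_fun setT p -> measurable_fun setT (fun x : R * R => `|p (w (tr a x)) ^+ 2 - p (w x) ^+ 2|).
  move=> mp; apply: measurableT_comp => //.
  have mpw : measurable_fun setT (fun x : R * R => p (w x) ^+ 2).
    by apply: measurable_funX; exact: measurableT_comp.
  by apply: measurable_funB => //; exact: (measurable_fun_tr a mpw).
pose A : \bar R := tdiff (fun x => p1 (w x) ^+ 2) a.
pose B : \bar R := tdiff (fun x => p2 (w x) ^+ 2) a.
apply: (@le_trans _ _ (2%:E * A + 2%:E * B)%E); last first.
  have eE : e%:E = (2%:E * (e / 4)%:E + 2%:E * (e / 4)%:E)%E.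
    by rewrite -!EFinM -EFinD; congr EFin; lra.
  rewrite eE; apply: leeD; apply: lee_wpmul2l; rewrite ?lee_fin//; [exact: h1|exact: h2].
have MA : measurable_fun setT (fun x : R * R => (`|p1 (w (tr a x)) ^+ 2 - p1 (w x) ^+ 2|)%:E).
  by apply/measurable_EFinP; exact: M.
have MB : measurable_fun setT (fun x : R * R => (`|p2 (w (tr a x)) ^+ 2 - p2 (w x) ^+ 2|)%:E).
  by apply/measurable_EFinP; exact: M.
have n2 : (0 <= 2%:E :> \bar R)%E by rewrite lee_fin.
rewrite /A /B /tdiff -(ge0_integralZl mu measurableT MA)// -(ge0_integralZl mu measurableT MB)//.
rewrite -ge0_integralD//; try by apply: measurable_funeM.
apply: ge0_le_integral => //.
- by move=> x _; rewrite lee_fin sqr_ge0.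
- apply/measurable_EFinP; apply: measurable_funX; apply: measurable_funB => //.
  exact: (measurable_fun_tr a mw).
- by apply: emeasurable_funD; exact: measurable_funeM.
- by move=> x _; rewrite -!EFinM -EFinD lee_fin; exact: sqr_maxB.
Qed.

End plane_measure.

(** * Functions of one variable with all derivatives bounded; bumps and smooth steps *)

Section smooth_line.
Context {R : realType}.
Implicit Types f g : R -> R.

Lemma is_derive_quad f (t a C d : R) : 0 < d ->
  (forall h, `|h| < d -> `|f (t + h) - f t - a * h| <= C * h ^+ 2) ->
  is_derive t 1 f a.
Proof.
move=> d0 H.
suff cv : (fun h => h^-1 *: ((f \o shift t) (h *: 1) - f t)) @ 0^' --> a.
  by split; [apply/cvg_ex; exists a|exact: cvg_lim].
apply/cvgrPdist_le => e e0.
have C0 : 0 <= C.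
  have /H : `|d / 2| < d by rewrite ger0_norm; lra.
  move=> /(le_trans (normr_ge0 _)); rewrite pmulr_lge0// exprn_gt0//; lra.
near=> h.
have h0 : h != 0 by near: h; exact: nbhs_dnbhs_neq.
have hd : `|h| < d.
  by near: h; exact: dnbhs0_lt.
have he : `|h| < e / (C + 1).
  by near: h; apply: dnbhs0_lt; rewrite divr_gt0//; lra.
rewrite /= scaler1 (addrC h) distrC.
have -> : h^-1 *: (f (t + h) - f t) - a = h^-1 * (f (t + h) - f t - a * h).
  rewrite /GRing.scale/= [in RHS]mulrBr; congr (_ - _).
  by rewrite mulrCA mulVf ?mulr1.
rewrite normrM normfV ler_pdivrMl ?normr_gt0//.
apply: (le_trans (H _ hd)).
rewrite -real_normK ?num_real// expr2 mulrCA ler_wpM2l//.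
move: he; rewrite ltr_pdivlMr; last lra.
have := normr_ge0 h; nra.
Unshelve. all: by end_near. Qed.

(** A coinductive encoding: a family of bounded functions stable under derivation witnesses that all
    derivatives exist and are bounded. No iterated derivative is ever written; a proof consists in
    exhibiting the stable family. *)
Definition bsmooth f := exists P : set (R -> R), P f /\
  forall g, P g -> (exists M, forall t, `|g t| <= M) /\
    exists g', P g' /\ forall t : R, is_derive t 1 g (g' t).

Lemma bsmoothP f : bsmooth f ->
  (exists M, forall t, `|f t| <= M) /\
  exists f', bsmooth f' /\ forall t : R, is_derive t 1 f (f' t).
Proof.
move=> [P [Pf H]]; have [bf [f' [Pf' df]]] := H f Pf; split=> //.
by exists f'; split=> //; exists P.
Qed.

Lemma bsmooth_cst (c : R) : bsmooth (cst c).
Proof.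
exists (range (fun c : R => cst c)); split; first by exists c.
move=> _ [k _ <-]; split; first by exists `|k|.
by exists (cst 0); split; [exists 0|move=> t; exact: is_derive_cst].
Qed.

Lemma bsmooth_affine f (a b : R) : bsmooth f -> bsmooth (fun t => f (a * t + b)).
Proof.
move=> [P [Pf H]].
exists [set h | exists g k, P g /\ h = (fun t => k * g (a * t + b))]; split.
  by exists f, 1; split=> //; apply/funext => t; rewrite mul1r.
move=> _ [g [k [Pg ->]]]; have [[M gM] [g' [Pg' dg]]] := H g Pg; split.
  by exists (`|k| * M) => t; rewrite normrM ler_wpM2l.
exists (fun t => k * a * g' (a * t + b)); split; first by exists g', (k * a).
move=> t.
have da : is_derive t 1 (fun t => a * t + b) a.
  by apply: is_derive_eq; rewrite addr0 /GRing.scale/= mulr1.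
have dc : is_derive t 1 (g \o (fun t => a * t + b)) (g' (a * t + b) * a).
  have := @is_derive1_comp R g (fun t => a * t + b) t _ _ (dg _) da.
  by [].
have := is_deriveZ k dc; rewrite /GRing.scale/= [X in is_derive _ _ _ X](_ : _ = k * a * g' (a * t + b)); last by ring.
by [].
Qed.

(** The stable family for a product: by Leibniz' rule the derivatives stay among finite sums of
    products. *)
Inductive sum_prod (P Q : set (R -> R)) : set (R -> R) :=
| sum_prod_mul f g : P f -> Q g -> sum_prod P Q (fun t => f t * g t)
| sum_prod_add f g : sum_prod P Q f -> sum_prod P Q g -> sum_prod P Q (fun t => f t + g t).

Lemma bsmoothM f g : bsmooth f -> bsmooth g -> bsmooth (fun t => f t * g t).
Proof.
move=> [P [Pf HP]] [Q [Qg HQ]]; exists (sum_prod P Q); split.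
  exact: sum_prod_mul.
move=> h; elim=> {h}[p q Pp Qq|p q _ [[M pM] [p' [Pp' dp]]] _ [[N qN] [q' [Qq' dq]]]].
- have [[M pM] [p' [Pp' dp]]] := HP p Pp; have [[N qN] [q' [Qq' dq]]] := HQ q Qq.
  split; first by exists (M * N) => t; rewrite normrM ler_pM.
  exists (fun t => p t * q' t + p' t * q t); split.
    by apply: sum_prod_add; exact: sum_prod_mul.
  move=> t; have := @is_deriveM _ _ p q t 1 _ _ (dp t) (dq t).
  by rewrite /GRing.scale/= (mulrC (q t)).
- split; first by exists (M + N) => t; rewrite (le_trans (ler_normD _ _))// lerD.
  exists (fun t => p' t + q' t); split; first exact: sum_prod_add.
  by move=> t; exact: is_deriveD.
Qed.

(** Raise s/(n+1) <= exp(s/(n+1)) to the power n. *)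
Lemma expr_le_expR n : exists C : R, forall s, 0 <= s -> s ^+ n <= C * expR s.
Proof.
exists (n.+1%:R ^+ n) => s s0.
have n0 : 0 < n.+1%:R :> R by rewrite ltr0n.
have : s / n.+1%:R <= expR (s / n.+1%:R).
  by apply: le_trans (expR_ge1Dx _); rewrite lerDr.
rewrite ler_pdivrMr// => h.
have h2 : s ^+ n <= (expR (s / n.+1%:R) * n.+1%:R) ^+ n.
  by apply: lerXn2r => //; rewrite nnegrE// mulr_ge0// expR_ge0.
apply: (le_trans h2); rewrite exprMn mulrC ler_wpM2l ?exprn_ge0//.
rewrite -expRM_natl ler_expR mulrA ler_pdivrMr// mulrC ler_wpM2l// ler_nat.
exact: leqnSn.
Qed.

Lemma horner_expR_bounded (p : {poly R}) :
  exists C : R, forall s, 0 <= s -> `|p.[s] * expR (- s)| <= C.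
Proof.
have /choice[K hK] n := expr_le_expR n.
exists (\sum_(i < size p) `|p`_i| * K i) => s s0.
rewrite horner_coef mulr_suml (le_trans (ler_norm_sum _ _ _))//; apply: ler_sum => i _.
rewrite !normrM -mulrA ler_wpM2l// (ger0_norm (expR_ge0 _)) ger0_norm ?exprn_ge0//.
by rewrite expRN ler_pdivrMr ?expR_gt0// hK.
Qed.

(** The classical flat function exp(-1/t) with a polynomial factor in 1/t, so that the family is
    stable under derivation: p is replaced by X^2 (p - p'). *)
Definition flat (p : {poly R}) (t : R) : R :=
  if 0 < t then p.[t^-1] * expR (- t^-1) else 0.

Lemma flat_bounded p : exists M, forall t, `|flat p t| <= M.
Proof.
have [C hC] := horner_expR_bounded p; exists `|C| => t; rewrite /flat.
case: ifPn => [t0|_]; last by rewrite normr0.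
by apply: (le_trans (hC _ _)); rewrite ?ler_norm// invr_ge0 ltW.
Qed.

Lemma is_derive_flat p (t : R) :
  is_derive t 1 (flat p) (flat ('X^2 * (p - p^`())) t).
Proof.
have [t0|t0|t0] := ltgtP t 0.
- rewrite {2}/flat ltNge (ltW t0)/=.
  apply: (@is_derive_quad _ _ _ 0 (- t)); first by rewrite oppr_gt0.
  move=> h; rewrite ltr_norml opprK => /andP[h1 h2].
  by rewrite /flat !ltNge (ltW t0) (_ : t + h <= 0)/=; [rewrite mul0r mul0r subrr subr0 normr0|lra].
- have tn0 : t != 0 by rewrite gt_eqF.
  rewrite {2}/flat t0.
  have dV : is_derive t 1 (fun t : R => t^-1) (- t ^- 2).
    have := @is_deriveV _ (@id R) t 1 1 tn0 (is_derive_id _ _).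
    by rewrite /GRing.scale/= mulr1.
  have dp : is_derive t 1 ((fun t : R => p.[t]) \o (fun t => t^-1)) (p^`().[t^-1] * (- t ^- 2)).
    exact: (@is_derive1_comp R (horner p) (fun t => t^-1) t _ _ (is_derive_poly p t^-1) dV).
  have de : is_derive t 1 (expR \o (fun t => - t^-1)) (expR (- t^-1) * (- (- t ^- 2))).
    by apply: is_derive1_comp; exact: is_deriveN.
  have := is_deriveM dp de.
  rewrite /GRing.scale/= (_ : _ + _ = ('X^2 * (p - p^`())).[t^-1] * expR (- t^-1)); last first.
    by rewrite hornerM hornerD hornerN hornerXn exprVn; ring.
  move=> H; apply: near_eq_is_derive H.
  near=> s; rewrite /flat ifT//; near: s; exact: lt_nbhsr.
- rewrite t0 {2}/flat ltxx.
  (* At the origin, [flat p h] is h^2 times [flat ('X^2 * p) h] for h > 0, so boundedness of the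
     latter yields a quadratic remainder and derivative 0. *)
  have [M hM] := flat_bounded ('X^2 * p).
  apply: (@is_derive_quad _ _ _ `|M| 1) => //.
  move=> h _; rewrite mul0r subr0 add0r {2}/flat ltxx subr0.
  have [h0|h0] := ltP 0 h; last by rewrite /flat ltNge h0/= normr0 mulr_ge0 ?sqr_ge0.
  have := hM h; rewrite /flat h0 hornerM hornerXn -mulrA normrM => H.
  rewrite -ler_pdivrMr ?exprn_gt0// mulrC.
  by apply: (le_trans _ (ler_norm _)); apply: le_trans H; rewrite exprVn ger0_norm// invr_ge0 sqr_ge0.
Unshelve. all: by end_near. Qed.

Lemma bsmooth_flat p : bsmooth (flat p).
Proof.
exists (range flat); split; first by exists p.
move=> _ [q _ <-]; split; first exact: flat_bounded.
exists (flat ('X^2 * (q - q^`()))); split; first by exists ('X^2 * (q - q^`())).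
exact: is_derive_flat.
Qed.

Lemma bsmooth_continuous f : bsmooth f -> continuous f.
Proof.
move=> /bsmoothP[_ [f' [_ df]]] t; apply: differentiable_continuous.
by apply/derivable1_diffP; exact: (@ex_derive _ _ _ _ _ _ _ (df t)).
Qed.

Local Notation leb := (@lebesgue_measure R).

Lemma integral_indic_itvcc (a b : R) : a <= b ->
  (\int[leb]_t (\1_(`[a, b]%classic) t)%:E = (b - a)%:E)%E.
Proof.
move=> ab; have E : leb `[a, b]%classic = (b - a)%:E.
  rewrite lebesgue_measure_itv/= lte_fin; case: ltP => // ba.
  by have -> : b - a = 0 by lra.
by rewrite -E integral_indic// setIT.
Qed.

Lemma bump_exists (e : R) : 0 < e -> exists b : R -> R,
  [/\ bsmooth b, forall t, 0 <= b t, forall t, e <= `|t| -> b t = 0 &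
     (\int[leb]_t (b t)%:E = 1)%E].
Proof.
move=> e0; pose b0 t : R := flat 1 (1 * t + e) * flat 1 (-1 * t + e).
have sb0 : bsmooth b0 by apply: bsmoothM; apply: bsmooth_affine; exact: bsmooth_flat.
have f0 t : 0 <= flat 1 t by rewrite /flat; case: ifP => // _; rewrite hornerC mul1r expR_ge0.
have b00 t : 0 <= b0 t by rewrite mulr_ge0.
have bs t : e <= `|t| -> b0 t = 0.
  rewrite ler_normr /b0 /flat => /orP[h|h].
    by rewrite [X in _ * X]ifF ?mulr0//; apply/negP; lra.
  by rewrite [X in X * _]ifF ?mul0r//; apply/negP; lra.
have [M hM] : exists M, forall t, `|b0 t| <= M by have [] := bsmoothP sb0.
have M0 : 0 <= M := le_trans (normr_ge0 _) (hM 0).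
have mb : measurable_fun setT b0.
  by apply: continuous_measurable_fun; exact: bsmooth_continuous.
(* A lower bound of [b0] on the middle half of its support; it serves only to see that the integral
   is positive, so that [b0] can be normalised. *)
pose c := expR (- (e / 2)^-1) ^+ 2.
have c0 : 0 < c by rewrite exprn_gt0// expR_gt0.
have fc t : e / 2 <= t -> expR (- (e / 2)^-1) <= flat 1 t.
  move=> h; rewrite /flat ifT; last lra.
  by rewrite hornerC mul1r ler_expR lerN2 lef_pV2// posrE; lra.
have bc t : t \in `[- (e / 2), e / 2] -> c <= b0 t.
  by rewrite in_itv/= => /andP[h1 h2]; rewrite /c expr2 ler_pM ?expR_ge0// fc//; lra.
have lb : ((c * e)%:E <= \int[leb]_t (b0 t)%:E)%E.
  apply: (@le_trans _ _ (\int[leb]_t (c * \1_(`[- (e / 2), e / 2]%classic) t)%:E)%E).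
    rewrite (_ : \int[leb]_t _ = \int[leb]_t (c%:E * (\1_(`[- (e / 2), e / 2]%classic) t)%:E))%E; last by apply: eq_integral.
    rewrite ge0_integralZl//; last 2 first.
    - by apply/measurable_EFinP; exact: measurable_indic.
    - by rewrite lee_fin ltW.
    rewrite integral_indic_itvcc; last lra.
    by rewrite -EFinM lee_fin; lra.
  apply: ge0_le_integral => //.
  - by move=> t _; rewrite lee_fin indicE; apply: mulr_ge0; [exact: ltW|exact: ler0n].
  - by apply/measurable_EFinP; apply: measurable_funM => //; exact: measurable_indic.
  - exact/measurable_EFinP.
  - move=> t _; rewrite lee_fin indicE; case: (boolP (t \in _)) => [/set_mem/= h|_]; last by rewrite mulr0.
    by rewrite mulr1 bc.
have ub : (\int[leb]_t (b0 t)%:E < +oo)%E.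
  apply: (@le_lt_trans _ _ (\int[leb]_t (M%:E * (\1_(`[- e, e]%classic) t)%:E))%E).
    apply: ge0_le_integral => //.
    - by move=> t _; rewrite lee_fin.
    - exact/measurable_EFinP.
    - by apply: measurable_funeM; apply/measurable_EFinP; exact: measurable_indic.
    - move=> t _; rewrite -EFinM lee_fin indicE; case: (boolP (t \in _)) => [_|/negP h].
        by rewrite mulr1 (le_trans (ler_norm _)).
      rewrite mulr0 bs// leNgt; apply/negP; rewrite ltr_norml => /andP[h1 h2]; apply: h.
      by apply/mem_set; rewrite /= in_itv/=; lra.
  rewrite ge0_integralZl//; last by apply/measurable_EFinP; exact: measurable_indic.
  rewrite integral_indic_itvcc; last lra.
  by rewrite -EFinM ltry.
have bfin : (\int[leb]_t (b0 t)%:E)%E \is a fin_num by rewrite ge0_fin_numE// integral_ge0// => t _; rewrite lee_fin.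
pose Z := fine (\int[leb]_t (b0 t)%:E)%E.
have Z0 : 0 < Z by rewrite -lte_fin /Z fineK//; apply: lt_le_trans lb; rewrite lte_fin mulr_gt0.
exists (fun t => Z^-1 * b0 t); split.
- exact: (bsmoothM (bsmooth_cst Z^-1) sb0).
- by move=> t; rewrite mulr_ge0// invr_ge0 ltW.
- by move=> t /bs ->; rewrite mulr0.
- under eq_integral do rewrite EFinM.
  have EZ : (\int[leb]_t ((Z^-1)%:E * (b0 t)%:E) = (Z^-1)%:E * \int[leb]_t (b0 t)%:E)%E.
    apply: ge0_integralZl => //.
    - exact/measurable_EFinP.
    - by move=> t _; rewrite lee_fin.
    - by rewrite lee_fin invr_ge0 ltW.
  by rewrite EZ -(fineK bfin) -EFinM mulVf// gt_eqF.
Qed.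

(* The step function is the primitive of a bump, so that it is smooth and its
   derivative is bounded without any further computation. *)
Lemma step_exists : exists H : R -> R,
  [/\ bsmooth H, forall t, 0 <= H t <= 1, forall t, t <= 0 -> H t = 0 &
     forall t, 1 <= t -> H t = 1].
Proof.
have [b [sb b0 bs ib]] := @bump_exists (2^-1) ltac:(lra).
have mb : measurable_fun setT b.
  by apply: continuous_measurable_fun; exact: bsmooth_continuous.
have ib' : leb.-integrable setT (EFin \o b).
  apply/integrableP; split; first exact/measurable_EFinP.
  under eq_integral do rewrite /= ger0_norm//.
  by rewrite ib ltry.
pose H0 t := (\int[leb]_(s in `]-oo, t]) b s).
have iI t : leb.-integrable `]-oo, t] (EFin \o b) by apply: integrableS ib'.
have dH (t : R) : is_derive t 1 H0 (b t).
  have t1 : t < t + 1 by rewrite ltrDl.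
  have [dF FE] := continuous_FTC1 t1 (iI (t + 1)) (ltNyr _) (bsmooth_continuous sb (x:=t)).
  by split => //; rewrite -derive1E.
have H01 t : 0 <= H0 t <= 1.
  apply/andP; split; first exact: Rintegral_ge0.
  have -> : 1 = fine (\int[leb]_t (b t)%:E)%E by rewrite ib.
  apply: fine_le.
  - exact: (@integrable_fin_num _ _ _ leb).
  - by rewrite ib.
  - apply: ge0_subset_integral => //; first exact/measurable_EFinP.
    by move=> s _; rewrite lee_fin.
have sH0 : bsmooth H0.
  have [P [Pb HP]] := sb.
  exists (P `|` [set H0]); split; first by right.
  move=> g [Pg|->].
    by have [h1 [g' [Pg' dg]]] := HP g Pg; split => //; exists g'; split => //; left.
  split; last by exists b; split => //; left.
  by exists 1 => t; have /andP[h1 h2] := H01 t; rewrite ger0_norm.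
have H0l t : t <= - 2^-1 -> H0 t = 0.
  move=> t0; rewrite /H0 /Rintegral (eq_integral (cst 0%E)) ?integral0//.
  move=> s; rewrite inE/= in_itv/= => st; rewrite bs// ler_normr; apply/orP; right; lra.
have H0r t : 2^-1 <= t -> H0 t = 1.
  move=> t0; transitivity (fine (\int[leb]_t (b t)%:E)%E); last by rewrite ib.
  rewrite /H0 /Rintegral integral_mkcond; congr fine; apply: eq_integral.
  move=> s _; rewrite patchE; case: ifPn => // /negP st; rewrite /= bs//.
  rewrite leNgt; apply/negP; rewrite ltr_norml => /andP[h1 h2]; apply: st.
  by apply/mem_set; rewrite /= in_itv/=; lra.
exists (fun t => H0 (1 * t + - 2^-1)); split.
- exact: bsmooth_affine.
- by move=> t; exact: H01.
- by move=> t t0; rewrite H0l//; lra.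
- by move=> t t0; rewrite H0r//; lra.
Qed.

End smooth_line.

(** * Integrability of real-valued functions under algebraic operations *)

Section real_integrable.
Context d (T : measurableType d) (R : realType) (mu : {measure set T -> \bar R}).
Variables (D : set T) (mD : measurable D).
Implicit Types f g : T -> R.

Lemma integrable_addr f g : mu.-integrable D (EFin \o f) ->
  mu.-integrable D (EFin \o g) -> mu.-integrable D (EFin \o (fun x => f x + g x)).
Proof. by move=> f1 g1; exact: (integrableD mD f1 g1). Qed.

Lemma integrable_subr f g : mu.-integrable D (EFin \o f) ->
  mu.-integrable D (EFin \o g) -> mu.-integrable D (EFin \o (fun x => f x - g x)).
Proof. by move=> f1 g1; exact: (integrableB mD f1 g1). Qed.

Lemma integrable_mulrl (k : R) f : mu.-integrable D (EFin \o f) ->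
  mu.-integrable D (EFin \o (fun x => k * f x)).
Proof. by move=> f1; exact: (integrableZl mD k f1). Qed.

Lemma integrable_mulrr (k : R) f : mu.-integrable D (EFin \o f) ->
  mu.-integrable D (EFin \o (fun x => f x * k)).
Proof. by move=> f1; exact: (integrableZr mD k f1). Qed.

Lemma integrable_normr f : mu.-integrable D (EFin \o f) ->
  mu.-integrable D (EFin \o (fun x => `|f x|)).
Proof. exact: integrable_norm. Qed.

Lemma ae_eq_Rintegral f g : mu.-integrable D (EFin \o f) ->
  measurable_fun D g -> ae_eq mu D f g ->
  \int[mu]_(x in D) f x = \int[mu]_(x in D) g x.
Proof.
move=> f1 mg fg; congr fine; apply: ae_eq_integral => //.
- exact: (measurable_int _ f1).
- exact/measurable_EFinP.
- by apply: filterS fg => x /= h Dx; rewrite h.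
Qed.

End real_integrable.

(** * Smooth functions of two variables and regularisation by tensor kernels *)

Section smooth_plane.
Context {R : realType}.
Local Notation mu := (@leb2 R).
Implicit Types f g : R * R -> R.

Definition lin2 (a b : R) (h : R * R) : R := a * h.1 + b * h.2.

Lemma lin2_linear a b : linear (lin2 a b).
Proof.
move=> k [x1 x2] [y1 y2]; rewrite /lin2 /= /GRing.scale/=.
ring.
Qed.

HB.instance Definition _ a b :=
  GRing.isLinear.Build R (R * R)%type R _ (lin2 a b) (@lin2_linear a b).

Lemma lin2_continuous a b : continuous (lin2 a b).
Proof.
move=> x; apply: cvgD; apply: cvgM; try exact: cvg_cst; [exact: cvg_fst|exact: cvg_snd].
Qed.

Lemma diff2_quad f x (a b C : R) :
  (forall h, `|f (h + x) - f x - lin2 a b h| <= C * (h.1 ^+ 2 + h.2 ^+ 2)) ->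
  [/\ differentiable f x, partial 0 f x = a & partial 1 f x = b].
Proof.
move=> H.
have C0 : 0 <= C.
  have := H (1, 0); move=> /(le_trans (normr_ge0 _)) /=.
  by rewrite expr0n addr0 expr1n mulr1.
pose g : R * R -> R := f \o shift x.
have E : g = cst (f x) + (lin2 a b : R * R -> R) +o_ (0 : R * R) id.
  apply/eqaddoP => _/posnumP[e]; near=> h.
  rewrite /= -[_ h]/(f (h + x) - (f x + lin2 a b h)) opprD addrA.
  apply: (le_trans (H h)).
  have h1 : `|h.1| <= `|h| by rewrite prod_normE le_max lexx.
  have h2 : `|h.2| <= `|h| by rewrite prod_normE le_max lexx orbT.
  have he : `|h| < e%:num / (2 * C + 1).
    by near: h; apply: (@nbhs0_lt _ (R * R)%type); rewrite divr_gt0//; lra.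
  have k1 : h.1 ^+ 2 <= `|h| ^+ 2 by rewrite -(real_normK (num_real h.1)) lerXn2r// nnegrE.
  have k2 : h.2 ^+ 2 <= `|h| ^+ 2 by rewrite -(real_normK (num_real h.2)) lerXn2r// nnegrE.
  apply: (@le_trans _ _ (C * (2 * `|h| ^+ 2))); first by rewrite ler_wpM2l//; lra.
  rewrite expr2 !mulrA ler_wpM2r//.
  move: he; rewrite ltr_pdivlMr; last lra.
  have := normr_ge0 h; nra.
have dE : 'd f x = lin2 a b :> (R * R -> R) by apply: diff_unique => //; exact: lin2_continuous.
have df : differentiable f x.
  by apply/diff_locallyP; rewrite dE; split => //; exact: lin2_continuous.
by split => //; rewrite /partial deriveE// dE /lin2 /basis2/= ?mulr1 ?mulr0 ?addr0 ?add0r.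
Unshelve. all: by end_near. Qed.

(** The two-variable counterpart of the [bsmooth] device: smoothness follows from a family of
    differentiable functions stable under both partial derivatives. *)
Lemma smooth2_family (F : set (R * R -> R)) :
  (forall g, F g -> forall x, differentiable g x) ->
  (forall g j, F g -> F (partial j g)) ->
  forall g, F g -> smooth2 g.
Proof.
move=> Fd Fp g Fg s; apply: Fd; elim: s => [//|j s IH] /=; exact: Fp.
Qed.

Lemma smooth2_partial g j : smooth2 g -> smooth2 (partial j g).
Proof. by move=> sg s x; rewrite -foldr_rcons; exact: sg. Qed.

Lemma smooth2_diff g x : smooth2 g -> differentiable g x.
Proof. by move=> /(_ [::]). Qed.

Lemma smooth2_cts g : smooth2 g -> continuous g.
Proof. by move=> sg x; apply: differentiable_continuous; exact: smooth2_diff. Qed.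

Lemma partialD j f g x : differentiable f x -> differentiable g x ->
  partial j (fun x => f x + g x) x = partial j f x + partial j g x.
Proof. by move=> df dg; rewrite /partial deriveD//; exact: diff_derivable. Qed.

Lemma partialM j f g x : differentiable f x -> differentiable g x ->
  partial j (fun x => f x * g x) x = f x * partial j g x + g x * partial j f x.
Proof. by move=> df dg; rewrite /partial deriveM//; exact: diff_derivable. Qed.

Lemma partial_cst j (c : R) x : partial j (cst c) x = 0.
Proof. exact: derive_cst. Qed.

(** The algebra generated by smooth functions, which Leibniz' rule makes stable under partial
    derivatives. *)
Inductive smooth_alg : set (R * R -> R) :=
| smooth_alg_base g : smooth2 g -> smooth_alg g
| smooth_alg_add f g : smooth_alg f -> smooth_alg g -> smooth_alg (fun x => f x + g x)
| smooth_alg_mul f g : smooth_alg f -> smooth_alg g -> smooth_alg (fun x => f x * g x).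

Lemma smooth_alg_diff g : smooth_alg g -> forall x, differentiable g x.
Proof.
elim=> {g} [g sg|f g _ df _ dg|f g _ df _ dg] x; first exact: smooth2_diff.
  exact: differentiableD.
exact: differentiableM.
Qed.

Lemma smooth_alg_smooth g : smooth_alg g -> smooth2 g.
Proof.
apply: (@smooth2_family smooth_alg) => //; first exact: smooth_alg_diff.
move=> {}g j; elim=> {g} [g sg|f g sf pf sg pg|f g sf pf sg pg].
- by apply: smooth_alg_base; exact: smooth2_partial.
- rewrite (_ : partial j _ = fun x => partial j f x + partial j g x).
    exact: smooth_alg_add.
  by apply/funext => x; rewrite partialD//; exact: smooth_alg_diff.
- rewrite (_ : partial j _ = fun x => f x * partial j g x + g x * partial j f x).
    by apply: smooth_alg_add; exact: smooth_alg_mul.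
  by apply/funext => x; rewrite partialM//; exact: smooth_alg_diff.
Qed.

Lemma smooth2D f g : smooth2 f -> smooth2 g -> smooth2 (fun x => f x + g x).
Proof. by move=> sf sg; apply: smooth_alg_smooth; apply: smooth_alg_add; exact: smooth_alg_base. Qed.

Lemma smooth2M f g : smooth2 f -> smooth2 g -> smooth2 (fun x => f x * g x).
Proof. by move=> sf sg; apply: smooth_alg_smooth; apply: smooth_alg_mul; exact: smooth_alg_base. Qed.

Lemma smooth2_cst (c : R) : smooth2 (cst c).
Proof.
apply: (@smooth2_family (range (fun c : R => cst c))); last by exists c.
- by move=> _ [k _ <-] x; exact: differentiable_cst.
- by move=> _ j [k _ <-]; exists 0 => //; apply/funext => x; rewrite partial_cst.
Qed.

Lemma bounded_deriv_lipschitz (a a' : R -> R) (M : R) :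
  (forall t : R, is_derive t 1 a (a' t)) -> (forall t, `|a' t| <= M) ->
  forall s t, `|a s - a t| <= M * `|s - t|.
Proof.
move=> da aM s t; wlog st : s t / t <= s.
  move=> H; have [|/ltW] := leP t s; first exact: H.
  by move=> /H; rewrite distrC (distrC t).
have cta : {within `[t, s], continuous a}.
  apply: continuous_subspaceT => x; apply: differentiable_continuous.
  by apply/derivable1_diffP; exact: (@ex_derive _ _ _ _ _ _ _ (da x)).
have [c _ ->] := MVT_segment st (fun x _ => da x) cta.
by rewrite normrM ler_wpM2r.
Qed.

Lemma bsmooth_taylor (a : R -> R) : bsmooth a -> exists a' : R -> R,
  bsmooth a' /\ exists M, [/\ 0 <= M, forall t, `|a t| <= M, forall t, `|a' t| <= M,
    forall s t, `|a (t + s) - a t| <= M * `|s| &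
    forall s t, `|a (t + s) - a t - a' t * s| <= M * s ^+ 2].
Proof.
move=> /bsmoothP[[M0 h0] [a' [sa' da]]].
have [[M1 h1] [a'' [sa'' da']]] := bsmoothP sa'.
have [[M2 h2] _] := bsmoothP sa''.
exists a'; split=> //.
have p0 := le_trans (normr_ge0 _) (h0 0); have p1 := le_trans (normr_ge0 _) (h1 0).
have p2 := le_trans (normr_ge0 _) (h2 0).
exists (M0 + M1 + M2); split.
- lra.
- by move=> t; have := h0 t; lra.
- by move=> t; have := h1 t; lra.
- move=> s t; apply: (le_trans (bounded_deriv_lipschitz da h1 _ _)).
  rewrite [X in `|X|](_ : _ = s); last by ring.
  by rewrite ler_wpM2r//; lra.
move=> s t.
pose g x := a (t + x) - a' t * x.
have dg (x : R) : is_derive x 1 g (a' (t + x) - a' t).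
  have d1 : is_derive x 1 (fun x => t + x) (1 : R).
    by have := is_deriveD (is_derive_cst t x 1) (is_derive_id x 1); rewrite add0r.
  have d2 := @is_derive1_comp R a (fun x => t + x) x _ _ (da _) d1.
  have d3 : is_derive x 1 (fun x => a' t * x) (a' t) by apply: is_derive_eq; rewrite /GRing.scale/= mulr1.
  by have := is_deriveB d2 d3; rewrite mulr1.
have [c [hc hE]] : exists c, `|c| <= `|s| /\ g s - g 0 = (a' (t + c) - a' t) * s.
  have ctg (u v : R) : {within `[u, v], continuous g}.
    apply: continuous_subspaceT => x; apply: differentiable_continuous.
    by apply/derivable1_diffP; exact: (@ex_derive _ _ _ _ _ _ _ (dg x)).
  have [s0|/ltW s0] := leP 0 s.
    have [c + ->] := MVT_segment s0 (fun x _ => dg x) (ctg _ _).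
    rewrite in_itv/= subr0 => /andP[c0 cs]; exists c; split => //.
    by rewrite !ger0_norm.
  have [c + E] := MVT_segment s0 (fun x _ => dg x) (ctg _ _).
  rewrite in_itv/= => /andP[sc c0]; exists c; split.
    by rewrite !ler0_norm// lerN2.
  by rewrite -opprB E; ring.
have -> : a (t + s) - a t - a' t * s = g s - g 0 by rewrite /g addr0 mulr0 subr0; ring.
rewrite hE normrM -(real_normK (num_real s)) expr2 mulrA ler_wpM2r//.
apply: (le_trans (bounded_deriv_lipschitz da' h2 _ _)).
rewrite [X in `|X|](_ : _ = c); last by ring.
apply: (@le_trans _ _ (M2 * `|s|)); first by rewrite ler_wpM2l.
by rewrite ler_wpM2r//; lra.
Qed.

Definition tens (a b : R -> R) (x : R * R) := a x.1 * b x.2.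

(** The increment of a product splits into the remainders of the two factors and a mixed term of
    size |h.1| |h.2|, all quadratic. The constant is uniform in the base point, which is what allows
    integration against a weight in [conv_taylor]. *)
Lemma tens_taylor (a b : R -> R) : bsmooth a -> bsmooth b ->
  exists a' b', [/\ bsmooth a', bsmooth b' & exists C, forall x h,
    `|tens a b (h + x) - tens a b x - lin2 (tens a' b x) (tens a b' x) h| <=
      C * (h.1 ^+ 2 + h.2 ^+ 2)].
Proof.
move=> /bsmooth_taylor[a' [sa' [M [M0 Ma Ma' La Ta]]]] /bsmooth_taylor[b' [sb' [N [N0 Nb Nb' Lb Tb]]]].
exists a', b'; split => //; exists (3 * M * N) => x h.
rewrite /tens /lin2 /= (addrC h.1) (addrC h.2).
set a1 := a (x.1 + h.1); set a0 := a x.1; set b1 := b (x.2 + h.2); set b0 := b x.2.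
have -> : a1 * b1 - a0 * b0 - (a' x.1 * b0 * h.1 + a0 * b' x.2 * h.2) =
  (a1 - a0 - a' x.1 * h.1) * b1 + a' x.1 * h.1 * (b1 - b0) + a0 * (b1 - b0 - b' x.2 * h.2) by ring.
rewrite (le_trans (ler_normD _ _))//.
have e1 : `|(a1 - a0 - a' x.1 * h.1) * b1| <= M * h.1 ^+ 2 * N by rewrite normrM; apply: ler_pM => //; [exact: Ta|exact: Nb].
have e2 : `|a' x.1 * h.1 * (b1 - b0)| <= M * `|h.1| * (N * `|h.2|).
  by rewrite !normrM; apply: ler_pM; rewrite ?mulr_ge0//; [exact: ler_wpM2r|exact: Lb].
have e3 : `|a0 * (b1 - b0 - b' x.2 * h.2)| <= M * (N * h.2 ^+ 2).
  by rewrite normrM; apply: ler_pM => //; [exact: Ma|exact: Tb].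
have e4 : `|h.1| * `|h.2| <= h.1 ^+ 2 + h.2 ^+ 2.
  rewrite -(real_normK (num_real h.1)) -(real_normK (num_real h.2)).
  have := sqr_ge0 (`|h.1| - `|h.2|); have := sqr_ge0 (`|h.1| + `|h.2|); rewrite !expr2; lra.
have e5 : M * `|h.1| * (N * `|h.2|) <= M * N * (h.1 ^+ 2 + h.2 ^+ 2).
  by rewrite mulrACA ler_wpM2l ?mulr_ge0.
have e6 : 0 <= M * N * h.1 ^+ 2 by apply: mulr_ge0; [exact: mulr_ge0|exact: sqr_ge0].
have e7 : 0 <= M * N * h.2 ^+ 2 by apply: mulr_ge0; [exact: mulr_ge0|exact: sqr_ge0].
have := ler_normD ((a1 - a0 - a' x.1 * h.1) * b1) (a' x.1 * h.1 * (b1 - b0)).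
nra.
Qed.

Lemma smooth2_tens (a b : R -> R) : bsmooth a -> bsmooth b -> smooth2 (tens a b).
Proof.
move=> sa sb; apply: (@smooth2_family [set g | exists a b, [/\ bsmooth a, bsmooth b & g = tens a b]]); last by exists a, b.
- move=> _ [{sa}a [{sb}b [sa sb ->]]] x.
  by have [a' [b' [_ _ [C H]]]] := tens_taylor sa sb; have [] := diff2_quad (H x).
- move=> _ j [{sa}a [{sb}b [sa sb ->]]].
  have [a' [b' [sa' sb' [C H]]]] := tens_taylor sa sb.
  have [j0|j1] : j = 0 \/ j = 1 by case: j => -[|[|//]] ?; [left|right]; exact/val_inj.
    exists a', b; split => //; apply/funext => x; rewrite j0.
    by have [] := diff2_quad (H x).
  exists a, b'; split => //; apply/funext => x; rewrite j1.
  by have [] := diff2_quad (H x).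
Qed.

(** The kernel is taken at z - x and not at x - z: the value at x is then the pairing of [w] with a
    test function moved to x, the very shape of the definition of weak derivatives. The price is a
    minus sign when differentiating in x. *)
Definition conv (w : R * R -> R) (a b : R -> R) (x : R * R) : R :=
  \int[mu]_z (w z * tens a b (z.1 - x.1, z.2 - x.2)).

Lemma integrable_bounded_mul (D : set (R * R)) (w k : R * R -> R) (M : R) :
  measurable D -> mu.-integrable D (EFin \o w) -> measurable_fun setT k ->
  (forall z, `|k z| <= M) -> mu.-integrable D (EFin \o (fun z => w z * k z)).
Proof.
move=> mD iw mk kM.
have iMw : mu.-integrable D (fun z => M%:E * (w z)%:E)%E.
  exact: integrableZl.
apply: (le_integrable _ _ _ iMw) => //.
  apply/measurable_EFinP; apply: measurable_funM; last exact: measurable_funTS.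
  by apply/measurable_EFinP; exact: (measurable_int _ iw).
move=> z _ /=; rewrite lee_fin !normrM mulrC ler_wpM2r//.
exact: (le_trans (kM z) (ler_norm _)).
Qed.

Lemma tens_measurable (a b : R -> R) (x : R * R) : bsmooth a -> bsmooth b ->
  measurable_fun setT (fun z : R * R => tens a b (z.1 - x.1, z.2 - x.2)).
Proof.
move=> sa sb; have mt : measurable_fun setT (tens a b).
  by apply: continuous_measurable2; apply: smooth2_cts; exact: smooth2_tens.
exact: (measurable_fun_tr (- x.1, - x.2) mt).
Qed.

Lemma tens_bounded (a b : R -> R) : bsmooth a -> bsmooth b ->
  exists M, forall x, `|tens a b x| <= M.
Proof.
move=> /bsmoothP[[M hM] _] /bsmoothP[[N hN] _]; exists (M * N) => x.
by rewrite normrM ler_pM.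
Qed.

Lemma conv_integrable (w : R * R -> R) (a b : R -> R) (x : R * R) :
  mu.-integrable setT (EFin \o w) -> bsmooth a -> bsmooth b ->
  mu.-integrable setT (EFin \o (fun z => w z * tens a b (z.1 - x.1, z.2 - x.2))).
Proof.
move=> iw sa sb; have [M hM] := tens_bounded sa sb.
by apply: (@integrable_bounded_mul _ _ _ M) => //; exact: tens_measurable.
Qed.

(** Differentiation under the integral without dominated convergence: the uniform quadratic
    remainder of the kernel is integrated against |w|. An increment h of x moves the argument of the
    kernel by -h, whence the signs. *)
Lemma conv_taylor (w : R * R -> R) (a b : R -> R) :
  mu.-integrable setT (EFin \o w) -> bsmooth a -> bsmooth b ->
  exists a' b', [/\ bsmooth a', bsmooth b',
    (forall x z, partial 0 (fun z => tens a b (z.1 - x.1, z.2 - x.2)) z = tens a' b (z.1 - x.1, z.2 - x.2) /\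
                 partial 1 (fun z => tens a b (z.1 - x.1, z.2 - x.2)) z = tens a b' (z.1 - x.1, z.2 - x.2)) &
    exists C, forall x h,
    `|conv w a b (h + x) - conv w a b x - lin2 (- conv w a' b x) (- conv w a b' x) h| <=
      C * (h.1 ^+ 2 + h.2 ^+ 2)].
Proof.
move=> iw sa sb; have [a' [b' [sa' sb' [C HC]]]] := tens_taylor sa sb.
exists a', b'; split => //.
  move=> x z.
  have [h|_ -> ->//] := @diff2_quad (fun z => tens a b (z.1 - x.1, z.2 - x.2)) z
    (tens a' b (z.1 - x.1, z.2 - x.2)) (tens a b' (z.1 - x.1, z.2 - x.2)) C.
  have -> : ((h + z).1 - x.1, (h + z).2 - x.2) = h + (z.1 - x.1, z.2 - x.2).
    by rewrite [RHS]surjective_pairing /=; congr (_, _); rewrite addrA.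
  exact: HC.
exists (C * (\int[mu]_z `|w z|)) => x h.
have iT a0 b0 y : bsmooth a0 -> bsmooth b0 ->
  mu.-integrable setT (EFin \o (fun z => w z * tens a0 b0 (z.1 - y.1, z.2 - y.2))).
  by move=> *; exact: conv_integrable.
have i1 := iT _ _ (h + x) sa sb; have i2 := iT _ _ x sa sb.
have i3 := iT _ _ x sa' sb; have i4 := iT _ _ x sa sb'.
have -> : conv w a b (h + x) - conv w a b x - lin2 (- conv w a' b x) (- conv w a b' x) h =
  \int[mu]_z (w z * (tens a b (z.1 - (h + x).1, z.2 - (h + x).2) - tens a b (z.1 - x.1, z.2 - x.2)
    + tens a' b (z.1 - x.1, z.2 - x.2) * h.1 + tens a b' (z.1 - x.1, z.2 - x.2) * h.2)).
  rewrite /lin2 /conv.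
  pose A z := w z * tens a b (z.1 - (h + x).1, z.2 - (h + x).2).
  pose B z := w z * tens a b (z.1 - x.1, z.2 - x.2).
  pose D z := w z * tens a' b (z.1 - x.1, z.2 - x.2).
  pose E z := w z * tens a b' (z.1 - x.1, z.2 - x.2).
  transitivity (\int[mu]_z (A z - B z + (D z * h.1 + E z * h.2))); last first.
    by apply: eq_Rintegral => z _; rewrite /A /B /D /E; ring.
  have iD := integrable_mulrr measurableT h.1 (i3 : mu.-integrable setT (EFin \o D)).
  have iE := integrable_mulrr measurableT h.2 (i4 : mu.-integrable setT (EFin \o E)).
  have iAB := integrable_subr measurableT (i1 : mu.-integrable setT (EFin \o A)) (i2 : mu.-integrable setT (EFin \o B)).
  have iDE := integrable_addr measurableT iD iE.
  rewrite RintegralD// RintegralB// RintegralD// RintegralZr// RintegralZr//.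
  by ring.
pose K z : R := tens a b (z.1 - (h + x).1, z.2 - (h + x).2) - tens a b (z.1 - x.1, z.2 - x.2)
    + tens a' b (z.1 - x.1, z.2 - x.2) * h.1 + tens a b' (z.1 - x.1, z.2 - x.2) * h.2.
have KC z : `|K z| <= C * (h.1 ^+ 2 + h.2 ^+ 2).
  have := HC (z.1 - x.1, z.2 - x.2) (- h).
  rewrite /lin2 /= !sqrrN; congr (`| _ | <= _); rewrite /K /tens /=.
  rewrite (_ : z.1 - (h.1 + x.1) = - h.1 + (z.1 - x.1)); last by ring.
  rewrite (_ : z.2 - (h.2 + x.2) = - h.2 + (z.2 - x.2)); last by ring.
  by ring.
have mK : measurable_fun setT K.
  have m1 := tens_measurable (h + x) sa sb; have m2 := tens_measurable x sa sb.
  have m3 := tens_measurable x sa' sb; have m4 := tens_measurable x sa sb'.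
  by apply: measurable_funD; [apply: measurable_funD; [exact: measurable_funB|exact: measurable_funM]|exact: measurable_funM].
rewrite -/K.
have iwK : mu.-integrable setT (EFin \o (fun z => w z * K z)) by exact: integrable_bounded_mul KC.
apply: (le_trans (le_normr_Rintegral _ iwK)) => //.
rewrite mulrAC -RintegralZl//; last exact: (integrable_norm iw).
apply: le_Rintegral => //.
- exact: (integrable_norm iwK).
- by apply: integrable_mulrl => //; exact: (integrable_norm iw).
- by move=> z _; rewrite normrM mulrC ler_wpM2r.
Qed.

Lemma smooth2_conv (w : R * R -> R) (a b : R -> R) :
  mu.-integrable setT (EFin \o w) -> bsmooth a -> bsmooth b ->
  smooth2 (conv w a b).
Proof.
move=> iw sa sb.
apply: (@smooth2_family [set g | exists k a b, [/\ bsmooth a, bsmooth b & g = fun x => k * conv w a b x]]); last first.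
  by exists 1, a, b; split => //; apply/funext => x; rewrite mul1r.
- move=> _ j [k [{sa}a [{sb}b [sa sb ->]]]].
  have [a' [b' [sa' sb' pT [C H]]]] := conv_taylor iw sa sb.
  have dx x := diff2_quad (H x).
  have pk x : partial j (fun x => k * conv w a b x) x = k * partial j (conv w a b) x.
    have [d _ _] := dx x.
    by have := partialM j (differentiable_cst k x) d; rewrite partial_cst mulr0 addr0.
  have [j0|j1] : j = 0 \/ j = 1 by case: j {pk} => -[|[|//]] ?; [left|right]; exact/val_inj.
    exists (- k), a', b; split => //; apply/funext => x; rewrite pk j0.
    by have [_ -> _] := dx x; ring.
  exists (- k), a, b'; split => //; apply/funext => x; rewrite pk j1.
  by have [_ _ ->] := dx x; ring.
- move=> _ [k [{sa}a [{sb}b [sa sb ->]]]] x.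
  have [a' [b' [sa' sb' pT [C H]]]] := conv_taylor iw sa sb.
  have [d _ _] := diff2_quad (H x).
  exact: (differentiableM (differentiable_cst k x) d).
Qed.

Lemma conv_partialE (w : R * R -> R) (a b : R -> R) (j : 'I_2) (x : R * R) :
  mu.-integrable setT (EFin \o w) -> bsmooth a -> bsmooth b ->
  partial j (conv w a b) x =
  - \int[mu]_z (w z * partial j (fun z => tens a b (z.1 - x.1, z.2 - x.2)) z).
Proof.
move=> iw sa sb; have [a' [b' [sa' sb' pT [C H]]]] := conv_taylor iw sa sb.
have [_ p0 p1] := diff2_quad (H x).
have [->|->] : j = 0 \/ j = 1 by case: j => -[|[|//]] ?; [left|right]; exact/val_inj.
  by rewrite p0; congr (- _); apply: eq_Rintegral => z _; rewrite (pT x z).1.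
by rewrite p1; congr (- _); apply: eq_Rintegral => z _; rewrite (pT x z).2.
Qed.

Lemma partial_out (C : set (R * R)) (g : R * R -> R) j x : closed C ->
  (forall z, ~ C z -> g z = 0) -> ~ C x -> partial j g x = 0.
Proof.
move=> cC g0 nCx; rewrite /partial -(@derive_cst _ (R * R)%type R 0 x (basis2 R j)).
apply: near_eq_derive; near=> z; apply: g0.
near: z; have : open (~` C) by exact: closed_openC.
by rewrite openE => /(_ x nCx).
Unshelve. all: by end_near. Qed.

Lemma compact_csq (c : R * R) (r : R) : compact (csq c r).
Proof. by rewrite csqE; apply: compact_setX; exact: segment_compact. Qed.

Lemma closed_csq (c : R * R) (r : R) : closed (csq c r).
Proof. by apply: compact_closed; [exact: norm_hausdorff|exact: compact_csq]. Qed.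

End smooth_plane.

(** * Mollification in L^1 and L^2, and the fundamental lemma of the calculus of variations *)

Section mollification.
Context {R : realType}.
Local Notation mu := (@leb2 R).
Local Notation leb := (@lebesgue_measure R).

Lemma tr_sym (a x : R * R) : tr a x = tr x a.
Proof. by rewrite /tr addrC (addrC a.2). Qed.

(** A name that can carry the sigma-finite structure, which Tonelli's theorem needs on pairs of
    points of the plane. *)
Definition plane := @leb2 R.

HB.instance Definition _ := Measure.on plane.

Lemma plane_sigma_finite : sigma_finite setT plane.
Proof.
exists (fun n => csq 0 n%:R).
  apply/esym/seteqP; split => // x _.
  exists (Num.truncn (Num.max `|x.1| `|x.2|)).+1 => //=.
  have h : Num.max `|x.1| `|x.2| <= (Num.truncn (Num.max `|x.1| `|x.2|)).+1%:R.
    by rewrite ltW// truncnS_gt.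
  by split; rewrite /= subr0 (le_trans _ h)// le_max lexx ?orbT.
move=> n; split; first exact: measurable_csq.
have -> : plane (csq 0 n%:R) = (4 * n%:R ^+ 2)%:E by exact: leb2_csq.
exact: ltry.
Qed.

HB.instance Definition _ := Measure_isSigmaFinite.Build _ _ _ plane plane_sigma_finite.

Definition bump (e : R) (b : R -> R) := [/\ bsmooth b, forall t, 0 <= b t,
  forall t, e <= `|t| -> b t = 0 & (\int[leb]_t (b t)%:E = 1)%E].

Lemma bump_tens_ge0 e b (z : R * R) : bump e b -> 0 <= tens b b z.
Proof. by case=> _ b0 _ _; rewrite mulr_ge0. Qed.

Lemma bump_tens_out e b (z : R * R) : bump e b -> ~ sq 0 e z -> tens b b z = 0.
Proof.
case=> _ _ bs _ nz; rewrite /tens.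
have [h1|h1] := leP e `|z.1|; first by rewrite bs ?mul0r.
have [h2|h2] := leP e `|z.2|; first by rewrite (bs z.2) ?mulr0.
by exfalso; apply: nz; split; rewrite /= subr0.
Qed.

Lemma bump_tens_measurable e b : bump e b -> measurable_fun setT (tens b b).
Proof. by case=> sb _ _ _; apply: continuous_measurable2; apply: smooth2_cts; exact: smooth2_tens. Qed.

Lemma bump_tens_int e b : bump e b -> (\int[mu]_z (tens b b z)%:E = 1)%E.
Proof.
move=> bb; have mb := bump_tens_measurable bb.
have [sb b0 bs ib] := bb.
have mb1 : measurable_fun setT b by apply: continuous_measurable_fun; exact: bsmooth_continuous.
rewrite (@fubini_tonelli1 _ _ _ _ _ leb leb (fun z => (tens b b z)%:E)); last 2 first.
- exact/measurable_EFinP.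
- by move=> z; rewrite lee_fin; exact: bump_tens_ge0 bb.
transitivity (\int[leb]_x (b x)%:E)%E => //; apply: eq_integral => x _.
rewrite /fubini_F; transitivity (\int[leb]_y ((b x)%:E * (b y)%:E))%E.
  by apply: eq_integral.
rewrite (@ge0_integralZl _ _ _ leb setT measurableT (fun y => (b y)%:E)) ?ib ?mule1//.
- exact/measurable_EFinP.
- by move=> y _; rewrite lee_fin.
- by rewrite lee_fin.
Qed.

Lemma convE (w : R * R -> R) e b x : mu.-integrable setT (EFin \o w) -> bump e b ->
  conv w b b x = \int[mu]_z (w (tr x z) * tens b b z).
Proof.
move=> iw bb; have [sb _ _ _] := bb; rewrite /conv /Rintegral.
have i1 := conv_integrable x iw sb sb.
rewrite -(integral_tr x i1); congr fine; apply: eq_integral => z _ /=.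
by rewrite !addrK; case: z.
Qed.

(** After exchanging the integrals the inner one is the translation error by a fixed z, at most
    [eta] wherever [rho] is nonzero, and [rho] has mass 1. The generality in [Phi] and [rho] covers
    L^1 and L^2 mollification as well as averages over squares. *)
Lemma weighted_tonelli (w rho : R * R -> R) (Phi : R -> R) (e eta : R) :
  measurable_fun setT w -> measurable_fun setT Phi -> (forall t, 0 <= Phi t) ->
  measurable_fun setT rho -> (forall z, 0 <= rho z) ->
  (forall z, ~ sq 0 e z -> rho z = 0) -> (\int[mu]_z (rho z)%:E = 1)%E -> 0 <= eta ->
  (forall a : R * R, `|a.1| < e -> `|a.2| < e ->
     (\int[mu]_x (Phi (w (tr a x) - w x))%:E <= eta%:E)%E) ->
  measurable_fun setT (fun x => \int[mu]_z (Phi (w (tr x z) - w x) * rho z)%:E)%E /\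
  (\int[mu]_x \int[mu]_z (Phi (w (tr x z) - w x) * rho z)%:E <= eta%:E)%E.
Proof.
move=> mw mP P0 mb rho0 rho_out rho1 eta0 H.
pose F (p : (R * R) * (R * R)) : R := Phi (w (tr p.1 p.2) - w p.1) * rho p.2.
have mtr : measurable_fun setT (fun p : (R * R) * (R * R) => tr p.1 p.2).
  apply: measurable_fun_pair.
  - apply: measurable_funD.
      exact: (measurableT_comp measurable_fst measurable_snd).
    exact: (measurableT_comp measurable_fst measurable_fst).
  - apply: measurable_funD.
      exact: (measurableT_comp measurable_snd measurable_snd).
    exact: (measurableT_comp measurable_snd measurable_fst).
have mF : measurable_fun setT F.
  apply: measurable_funM; last exact: (measurableT_comp mb measurable_snd).
  apply: (measurableT_comp mP); apply: measurable_funB; first exact: (measurableT_comp mw mtr).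
  exact: (measurableT_comp mw measurable_fst).
have F0 p : (0 <= (F p)%:E)%E by rewrite lee_fin mulr_ge0.
have mEF : measurable_fun setT (EFin \o F) by exact/measurable_EFinP.
have FT := @fubini_tonelli _ _ _ _ _ plane plane (EFin \o F) mEF F0.
split; first exact: (@measurable_fun_fubini_tonelli_F _ _ _ _ _ plane (EFin \o F)).
rewrite [leLHS](_ : _ = \int[plane]_x fubini_F plane (EFin \o F) x)%E//.
rewrite FT.
apply: (@le_trans _ _ (\int[mu]_z (eta%:E * (rho z)%:E))%E); last first.
  rewrite ge0_integralZl ?rho1 ?mule1//.
  - exact/measurable_EFinP.
  - by move=> z _; rewrite lee_fin.
have mwd (z : R * R) : measurable_fun setT (fun x => (Phi (w (tr z x) - w x))%:E).
  apply/measurable_EFinP; apply: (measurableT_comp mP); apply: measurable_funB => //.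
  exact: measurable_fun_tr.
apply: ge0_le_integral => //.
- by move=> z _; apply: integral_ge0 => x _; exact: F0.
- exact: measurable_fun_fubini_tonelli_G.
- by apply: measurable_funeM; exact/measurable_EFinP.
move=> z _; rewrite /fubini_G.
have -> : (\int[plane]_x (EFin \o F) (x, z) =
   \int[mu]_x ((rho z)%:E * (Phi (w (tr z x) - w x))%:E))%E.
  by apply: eq_integral => x _ /=; rewrite -EFinM mulrC /F/= tr_sym.
have -> : (\int[mu]_x ((rho z)%:E * (Phi (w (tr z x) - w x))%:E) =
   (rho z)%:E * \int[mu]_x (Phi (w (tr z x) - w x))%:E)%E.
  apply: ge0_integralZl => //.
  - exact: mwd.
  - by move=> x _; rewrite lee_fin.
  - by rewrite lee_fin.
have [[z1 z2]|nz] := pselect (sq 0 e z); last first.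
  by rewrite (rho_out _ nz) mul0e mule0.
rewrite muleC lee_wpmul2r//; first by rewrite lee_fin.
by apply: H; [move: z1|move: z2]; rewrite /= subr0.
Qed.

Lemma moll_tonelli (w : R * R -> R) (Phi : R -> R) e b (eta : R) :
  measurable_fun setT w -> measurable_fun setT Phi -> (forall t, 0 <= Phi t) ->
  bump e b -> 0 <= eta ->
  (forall a : R * R, `|a.1| < e -> `|a.2| < e ->
     (\int[mu]_x (Phi (w (tr a x) - w x))%:E <= eta%:E)%E) ->
  measurable_fun setT (fun x => \int[mu]_z (Phi (w (tr x z) - w x) * tens b b z)%:E)%E /\
  (\int[mu]_x \int[mu]_z (Phi (w (tr x z) - w x) * tens b b z)%:E <= eta%:E)%E.
Proof.
move=> mw mP P0 bb; apply: weighted_tonelli => //.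
- exact: bump_tens_measurable bb.
- by move=> z; exact: bump_tens_ge0 bb.
- by move=> z; exact: bump_tens_out bb.
- exact: bump_tens_int bb.
Qed.

(** Integrate (D - m)^2 rho >= 0, where m is the weighted mean. *)
Lemma jensen_sq (rho D : R * R -> R) :
  (forall z, 0 <= rho z) -> mu.-integrable setT (EFin \o rho) -> \int[mu]_z rho z = 1 ->
  mu.-integrable setT (EFin \o (fun z => D z * rho z)) ->
  mu.-integrable setT (EFin \o (fun z => D z ^+ 2 * rho z)) ->
  (\int[mu]_z (D z * rho z)) ^+ 2 <= \int[mu]_z (D z ^+ 2 * rho z).
Proof.
move=> r0 ir r1 iD iD2; set m := \int[mu]_z (D z * rho z).
have -> : m ^+ 2 = \int[mu]_z (2 * m * (D z * rho z) - m ^+ 2 * rho z).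
  rewrite RintegralB//; [|exact: integrable_mulrl..].
  by rewrite !RintegralZl// r1 -/m; ring.
apply: le_Rintegral => //.
  by apply: integrable_subr => //; exact: integrable_mulrl.
move=> z _; have := r0 z; have := sqr_ge0 (D z - m); nra.
Qed.

Lemma conv_sub (w : R * R -> R) e b x : mu.-integrable setT (EFin \o w) -> bump e b ->
  mu.-integrable setT (EFin \o (fun z => (w (tr x z) - w x) * tens b b z)) /\
  conv w b b x - w x = \int[mu]_z ((w (tr x z) - w x) * tens b b z).
Proof.
move=> iw bb; have [sb _ _ _] := bb.
have ib : mu.-integrable setT (EFin \o tens b b).
  apply/integrableP; split; first by apply/measurable_EFinP; exact: bump_tens_measurable bb.
  have -> : (\int[mu]_z `|(tens b b z)%:E| = \int[mu]_z (tens b b z)%:E)%E.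
    by apply: eq_integral => z _ /=; rewrite ger0_norm//; exact: bump_tens_ge0 bb.
  by rewrite (bump_tens_int bb) ltry.
have i1 := conv_integrable x iw sb sb.
have i2 : mu.-integrable setT (EFin \o (fun z => w (tr x z) * tens b b z)).
  have := integrable_tr x i1; congr (_.-integrable _ _); apply/funext => z /=.
  by rewrite !addrK; case: z.
have E z : (w (tr x z) - w x) * tens b b z = w (tr x z) * tens b b z - w x * tens b b z by rewrite mulrBl.
split; first by under eq_fun do rewrite E; apply: integrable_subr => //; exact: integrable_mulrl.
under eq_Rintegral do rewrite E.
rewrite RintegralB//; last exact: integrable_mulrl.
by rewrite (convE x iw bb) RintegralZl// [X in w x * X](_ : _ = 1) ?mulr1// /Rintegral (bump_tens_int bb).
Qed.

Lemma conv_measurable (w : R * R -> R) e b : mu.-integrable setT (EFin \o w) -> bump e b ->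
  measurable_fun setT (conv w b b).
Proof.
move=> iw [sb _ _ _]; apply: continuous_measurable2; apply: smooth2_cts.
exact: smooth2_conv.
Qed.

(** The threshold on the support is independent of the shape of the bump; it comes from the
    continuity of translations alone. *)
Lemma moll_L1 (w : R * R -> R) (k : R) : mu.-integrable setT (EFin \o w) ->
  (forall x, ~ csq 0 k x -> w x = 0) -> forall eta, 0 < eta ->
  exists2 e0 : R, 0 < e0 & forall e b, e <= e0 -> bump e b ->
    (\int[mu]_x `|conv w b b x - w x|%:E <= eta%:E)%E.
Proof.
move=> iw w0 eta eta0.
have mw : measurable_fun setT w by apply/measurable_EFinP; exact: (measurable_int _ iw).
have [d d0 H] := tcont_L1 iw w0 eta0.
exists d => // e b ed bb; have mb := bump_tens_measurable bb.
have [//|//|||m1] := @moll_tonelli w Num.norm e b eta mw _ _ bb.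
- exact: ltW.
- by move=> a a1 a2; apply: H; [exact: lt_le_trans a1 ed|exact: lt_le_trans a2 ed].
apply: le_trans; apply: ge0_le_integral => //.
- apply/measurable_EFinP; apply: measurableT_comp => //; apply: measurable_funB => //.
  exact: conv_measurable bb.
move=> x _; have [i1 ->] := conv_sub x iw bb.
rewrite EFin_normr_Rintegral//.
have m2 : measurable_fun setT (EFin \o (fun z => (w (tr x z) - w x) * tens b b z)) := measurable_int _ i1.
apply: (le_trans (le_abse_integral mu measurableT m2)).
rewrite le_eqVlt; apply/orP; left; apply/eqP; apply: eq_integral => z _ /=.
by rewrite normrM (ger0_norm (bump_tens_ge0 _ bb)).
Qed.

Lemma sqrB_weight_le (a c t M : R) : 0 <= t -> t <= M ->
  (a - c) ^+ 2 * t <= 2 * M * a ^+ 2 + 2 * c ^+ 2 * t.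
Proof.
move=> t0 tM; have q := mulr_ge0 t0 (sqr_ge0 (a + c)).
have h : 0 <= (M - t) * a ^+ 2 by rewrite mulr_ge0 ?subr_ge0 ?sqr_ge0.
nra.
Qed.

(** As in L^1, with Jensen's inequality under the kernel. Uniformity in the bump lets one kernel
    approximate a function and its weak derivatives simultaneously in [smooth_approx]. *)
Lemma moll_L2 (w : R * R -> R) (k : R) : mu.-integrable setT (EFin \o w) ->
  mu.-integrable setT (EFin \o (fun x => w x ^+ 2)) ->
  (forall x, ~ csq 0 k x -> w x = 0) -> forall eta, 0 < eta ->
  exists2 e0 : R, 0 < e0 & forall e b, e <= e0 -> bump e b ->
    (\int[mu]_x ((conv w b b x - w x) ^+ 2)%:E <= eta%:E)%E.
Proof.
move=> iw iw2 w0 eta eta0.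
have mw : measurable_fun setT w by apply/measurable_EFinP; exact: (measurable_int _ iw).
have [d d0 H] := tcont_sqr mw iw2 w0 eta0.
exists d => // e b ed bb; have mb := bump_tens_measurable bb.
have [||||m1] := @moll_tonelli w (fun t => t ^+ 2) e b eta mw _ _ bb.
- exact: measurable_funX.
- by move=> t; exact: sqr_ge0.
- exact: ltW.
- by move=> a a1 a2; apply: H; [exact: lt_le_trans a1 ed|exact: lt_le_trans a2 ed].
apply: le_trans; apply: ge0_le_integral => //.
- by move=> x _; rewrite lee_fin sqr_ge0.
- apply/measurable_EFinP; apply: measurable_funX; apply: measurable_funB => //.
  exact: conv_measurable bb.
move=> x _; have [i1 ->] := conv_sub x iw bb.
have ib : mu.-integrable setT (EFin \o tens b b).
  apply/integrableP; split; first exact/measurable_EFinP.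
  have -> : (\int[mu]_z `|(tens b b z)%:E| = \int[mu]_z (tens b b z)%:E)%E.
    by apply: eq_integral => z _ /=; rewrite ger0_norm//; exact: bump_tens_ge0 bb.
  by rewrite (bump_tens_int bb) ltry.
have iD2 : mu.-integrable setT (EFin \o (fun z => (w (tr x z) - w x) ^+ 2 * tens b b z)).
  have [sb _ _ _] := bb; have [M hM] := tens_bounded sb sb.
  have i2 : mu.-integrable setT (EFin \o (fun z => 2 * M * (w (tr x z)) ^+ 2 + 2 * (w x) ^+ 2 * tens b b z)).
    apply: integrable_addr => //; apply: integrable_mulrl => //.
    exact: (integrable_tr x iw2).
  apply: (le_integrable _ _ _ i2) => //.
    apply/measurable_EFinP; apply: measurable_funM => //; apply: measurable_funX; apply: measurable_funB => //.
    exact: (measurable_fun_tr x mw).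
  move=> z _ /=; rewrite lee_fin.
  have r0 := bump_tens_ge0 z bb.
  have rM : tens b b z <= M by apply: le_trans (hM z); exact: ler_norm.
  rewrite ger0_norm; last by rewrite mulr_ge0// sqr_ge0.
  rewrite ger0_norm; last by rewrite addr_ge0// mulr_ge0// ?sqr_ge0// mulr_ge0// ?sqr_ge0// (le_trans r0).
  exact: sqrB_weight_le.
have J := jensen_sq (fun z => bump_tens_ge0 z bb) ib _ i1 iD2.
have h := J _.
rewrite [leRHS](_ : _ = (\int[mu]_z ((w (tr x z) - w x) ^+ 2 * tens b b z))%:E); last first.
  by rewrite /Rintegral fineK//; exact: (@integrable_fin_num _ _ _ mu).
by rewrite lee_fin; apply: J; rewrite /Rintegral (bump_tens_int bb).
Qed.

Lemma test_fun_bump (O : set (R * R)) e b (x : R * R) : bump e b ->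
  csq x e `<=` O -> test_fun O (fun z => tens b b (z.1 - x.1, z.2 - x.2)).
Proof.
move=> bb xO; have [sb _ _ _] := bb; split.
  have -> : (fun z : R * R => tens b b (z.1 - x.1, z.2 - x.2)) =
     tens (fun t => b (1 * t + - x.1)) (fun t => b (1 * t + - x.2)).
    by apply/funext => z; rewrite /tens/= !mul1r.
  by apply: smooth2_tens; exact: bsmooth_affine.
exists (csq x e); split => //; first exact: compact_csq.
move=> z nz; rewrite (bump_tens_out bb)// => -[/= h1 h2]; apply: nz.
by rewrite !subr0 in h1 h2; split; exact: ltW.
Qed.

Lemma bump_out e b (x z : R * R) : bump e b -> ~ csq x e z ->
  tens b b (z.1 - x.1, z.2 - x.2) = 0.
Proof.
move=> bb nz; rewrite (bump_tens_out bb)// => -[/= h1 h2]; apply: nz.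
by rewrite !subr0 in h1 h2; split; exact: ltW.
Qed.

(** The kernel centred at x is an admissible test function, and the sign of [conv_partialE] cancels
    that of the weak derivative. Restricting to [S] gives a globally integrable function and is
    invisible to a kernel supported in [S]. *)
Lemma conv_weak (O S : set (R * R)) (v g : R * R -> R) (j : 'I_2) e b x :
  (forall phi, test_fun O phi ->
    \int[mu]_(z in O) (v z * partial j phi z) = - \int[mu]_(z in O) (g z * phi z)) ->
  S `<=` O -> mu.-integrable setT (EFin \o (v \_ S)) -> bump e b -> csq x e `<=` S ->
  partial j (conv (v \_ S) b b) x = conv (g \_ S) b b x.
Proof.
move=> W SO iv bb xS; have [sb _ _ _] := bb.
pose K z := tens b b (z.1 - x.1, z.2 - x.2).
have tK : test_fun O K by exact: (test_fun_bump bb (subset_trans xS SO)).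
have K0 z : ~ csq x e z -> K z = 0 by exact: bump_out.
have pK0 z : ~ csq x e z -> partial j K z = 0.
  by apply: partial_out => //; exact: closed_csq.
rewrite conv_partialE// -/K.
have E (h k : R * R -> R) : (forall z, ~ csq x e z -> k z = 0) ->
    \int[mu]_z ((h \_ S) z * k z) = \int[mu]_(z in O) (h z * k z).
  move=> k0; rewrite [RHS]Rintegral_mkcond; apply: eq_Rintegral => z _.
  rewrite !patchE; case: ifPn => [/set_mem Sz|/negP Sz].
    by rewrite ifT//; apply/mem_set/SO.
  rewrite k0 ?mulr0 ?if_same//; last by move=> /xS/mem_set.
by rewrite E// W// opprK /conv -E.
Qed.

(** On the half of a square contained in [O] the mollifications of [h] vanish for small kernels and
    also converge to [h] in L^1, so [h] is zero a.e. there. Countably many such halves cover [O]. *)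
Lemma weak_zero (O : set (R * R)) (h : R * R -> R) : open O -> L1loc O h ->
  (forall phi, test_fun O phi -> \int[mu]_(z in O) (h z * phi z) = 0) ->
  {ae mu, forall x, O x -> h x = 0}.
Proof.
move=> oO [mh ih] H.
have loc c r : 0 < r -> csq c r `<=` O -> mu.-negligible [set x | csq c (r / 2) x /\ h x != 0].
  move=> r0 cO; pose S := csq c r; pose w := h \_ S.
  have mS : measurable S by exact: measurable_csq.
  have iw : mu.-integrable setT (EFin \o w).
    have := (@integrable_mkcond _ _ _ mu _ (EFin \o h) mS).1 (ih _ (@compact_csq _ c r) cO).
    by rewrite restrict_EFin.
  have w0 x : ~ csq 0 (`|c.1| + `|c.2| + r) x -> w x = 0.
    move=> nx; rewrite /w patchE; case: ifPn => // /set_mem /csq_sub0 //.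
  have mw : measurable_fun setT w by apply/measurable_EFinP; exact: (measurable_int _ iw).
  have mS2 : measurable (csq c (r / 2)) by exact: measurable_csq.
  have I0 : (\int[mu]_(x in csq c (r / 2)) `|w x|%:E = 0)%E.
    apply/eqP; rewrite eq_le integral_ge0 ?andbT//.
    apply/lee_addgt0Pr => eta eta0; rewrite add0e.
    have [e0 e00 He] := moll_L1 iw w0 eta0.
    pose e := Num.min e0 (r / 2).
    have ep : 0 < e by rewrite lt_min e00/= divr_gt0.
    have [b bb] := bump_exists ep.
    have := He e b _ bb; rewrite ge_min lexx => /(_ isT); apply: le_trans.
    rewrite integral_mkcond; apply: ge0_le_integral => //.
    - by move=> x _; rewrite patchE; case: ifP.
    - by apply/(measurable_restrictT _ _).1 => //; apply/measurable_EFinP; apply: measurable_funTS; exact: measurableT_comp.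
    - apply/measurable_EFinP; apply: measurableT_comp => //; apply: measurable_funB => //.
      exact: conv_measurable bb.
    move=> x _; rewrite patchE; case: ifPn => [cx'|_]; last by apply: (@abse_ge0 _ (_%:E)).
    have cx := set_mem cx'; have [/= x1 x2] := cx.
    suff -> : conv w b b x = 0 by rewrite sub0r normrN.
    have xS : csq x e `<=` S.
      have er : e <= r / 2 by rewrite ge_min lexx orbT.
      move=> y [y1 y2]; split.
        by have := ler_distD x.1 y.1 c.1; lra.
      by have := ler_distD x.2 y.2 c.2; lra.
    rewrite /conv -[RHS](H _ (test_fun_bump bb (subset_trans xS cO))).
    rewrite [RHS]Rintegral_mkcond; apply: eq_Rintegral => z _.
    rewrite /w !patchE; case: ifPn => [/set_mem Sz|/negP Sz].
      by rewrite ifT//; apply/mem_set/cO.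
    by rewrite (bump_out bb) ?mulr0 ?if_same// => /xS/mem_set.
  have /(ae_eq_integral_abs mu mS2) : measurable_fun (csq c (r / 2)) (EFin \o w).
    by apply/measurable_EFinP; exact: measurable_funTS.
  move=> /iffLR /(_ I0).
  apply: negligibleS => x /= [cx hx] /(_ cx) [] wx; move: hx.
  have Sx : S x by case: cx => ? ?; split; lra.
  by rewrite -wx /w patchE ifT ?eqxx//; exact/mem_set.
have [c [k ck]] := @dyadic_squares R.
(* The local statement concerns half of a square inside [O], hence the doubled radius. The bound
   [r / 3] below makes a doubled dyadic square around x stay within distance r of x. *)
pose good i := csq (c i) (2 * 2^-1 ^+ k i) `<=` O.
pose N i := if `[< good i >] then [set x | csq (c i) (2 * 2^-1 ^+ k i / 2) x /\ h x != 0] else set0.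
apply: (@negligibleS _ _ _ mu (\bigcup_i N i)); last first.
  apply: negligible_bigcup => i; rewrite /N; case: asboolP => gi; last exact: negligible_set0.
  by apply: loc => //; rewrite mulr_gt0// exprn_gt0.
move=> x /= /not_implyP[Ox hx].
have [r r0 rO] := open_csq oO Ox.
have [n _ /(_ n (leqnn n)) /= nr] := @exp2_lt R (r / 3) ltac:(lra).
have [i [ki [xi1 xi2]]] := ck x n.
exists i => //; rewrite /N; case: asboolP => [_|].
  split; last exact/eqP.
  by rewrite mulrC mulKf// ki; split; exact: ltW.
case=> y [y1 y2]; apply: rO; rewrite ki in y1 y2; split.
  by have := ler_distD (c i).1 y.1 x.1; rewrite (distrC (c i).1); lra.
by have := ler_distD (c i).2 y.2 x.2; rewrite (distrC (c i).2); lra.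
Qed.

End mollification.

(** * Compact sets, bounded factors and integrability *)

Section compact_integrability.
Context {R : realType}.
Local Notation mu := (@leb2 R).
Local Notation leb := (@lebesgue_measure R).
Implicit Types (f g v : R * R -> R) (O S : set (R * R)).

Lemma compact_sub_csq (K : set (R * R)) : compact K ->
  exists2 k : R, 0 < k & K `<=` csq 0 k.
Proof.
move=> /(@compact_bounded R (R * R)%type)[M [_ /(_ (`|M| + 1)) h]].
exists (`|M| + 1); first by rewrite ltr_wpDl.
move=> x Kx; have : `|x| <= `|M| + 1.
  by apply: h => //; rewrite (le_lt_trans (ler_norm _))// ltrDl.
by rewrite prod_normE ge_max => /andP[? ?]; split; rewrite /= subr0.
Qed.

Lemma compact_measurable2 (K : set (R * R)) : compact K -> measurable K.
Proof.
move=> cK; rewrite -(setCK K); apply: measurableC; apply: open_measurable2.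
apply: (@closed_openC (R * R)%type); apply: (@compact_closed (R * R)%type) => //.
Qed.

Lemma leb2_csq_fin c (r : R) : (mu (csq c r) < +oo)%E.
Proof.
have [r0|r0] := leP 0 r; first by rewrite leb2_csq// ltry.
have -> : csq c r = set0.
  by apply/seteqP; split => // x [+ _]; have := normr_ge0 (x.1 - c.1); rewrite /=; lra.
have -> : mu set0 = 0%E by exact: measure0.
exact: ltry.
Qed.

Lemma continuous_bounded_csq g c r : continuous g ->
  exists2 M : R, 0 <= M & forall x, csq c r x -> `|g x| <= M.
Proof.
move=> cg; have : compact (g @` csq c r).
  apply: continuous_compact; last exact: compact_csq.
  exact: continuous_subspaceT.
move=> /compact_bounded[M [_ /(_ (`|M| + 1)) h]].
exists (`|M| + 1); first by rewrite addr_ge0.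
move=> x cx; apply: h; last by exists x.
by rewrite (le_lt_trans (ler_norm _))// ltrDl.
Qed.

Lemma integrable_bounded_on (S : set (R * R)) (w k : R * R -> R) (M : R) :
  measurable S -> mu.-integrable S (EFin \o w) -> measurable_fun S k ->
  (forall z, S z -> `|k z| <= M) -> mu.-integrable S (EFin \o (fun z => w z * k z)).
Proof.
move=> mS iw mk kM.
have mw : measurable_fun S w by apply/measurable_EFinP; exact: (measurable_int _ iw).
have i2 : mu.-integrable S (EFin \o (fun z => M * `|w z|)).
  by apply: integrable_mulrl => //; exact: integrable_normr.
apply: (le_integrable _ _ _ i2) => //.
  by apply/measurable_EFinP; exact: measurable_funM.
move=> z Sz /=; rewrite lee_fin normrM mulrC (le_trans _ (ler_norm _))//.
by rewrite ler_wpM2r// kM.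
Qed.

Lemma integrable_cst_csq c r (k : R) : mu.-integrable (csq c r) (EFin \o cst k).
Proof.
apply/integrableP; split; first by apply/measurable_EFinP; exact: measurable_cst.
rewrite (_ : (fun x => `|(EFin \o cst k) x|)%E = cst `|k|%:E)//.
rewrite integral_cst//; last exact: measurable_csq.
by rewrite lte_mul_pinfty// ?lee_fin// leb2_csq_fin.
Qed.

Lemma continuous_integrable_csq g c r : continuous g ->
  mu.-integrable (csq c r) (EFin \o g).
Proof.
move=> cg; have [M M0 hM] := continuous_bounded_csq c r cg.
have mc : measurable (csq c r) by exact: measurable_csq.
have mg : measurable_fun (csq c r) g.
  by apply: measurable_funTS; exact: continuous_measurable2.
have := integrable_bounded_on mc (integrable_cst_csq c r 1) mg hM.
by congr (_.-integrable _ _); apply/funext => x; rewrite /= mul1r.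
Qed.

Lemma continuous_integrable_compact g (K : set (R * R)) : continuous g ->
  compact K -> mu.-integrable K (EFin \o g).
Proof.
move=> cg cK; have [k k0 Kk] := compact_sub_csq cK.
apply: (@integrableS _ _ _ mu (csq 0 k)) => //.
- exact: measurable_csq.
- exact: compact_measurable2.
- exact: continuous_integrable_csq.
Qed.

End compact_integrability.

(** * Square-integrable functions on a set *)

Section L2on.
Context {R : realType}.
Local Notation mu := (@leb2 R).
Implicit Types (f g v : R * R -> R) (O S : set (R * R)).

(** Membership in L^2 without norms or real exponents; [Lp_on2] links it to the general notion. *)
Definition L2on O g :=
  measurable_fun O g /\ mu.-integrable O (EFin \o (fun x => g x ^+ 2)).

Lemma Lp_on2 O g : measurable O -> Lp_on O 2%:E g <-> L2on O g.
Proof.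
move=> mO; rewrite /Lp_on; split.
  move=> l2; have i2 := Lfun2_integrable_sqr l2; split.
    apply/(measurable_restrictT _ mO).
    by move: l2; rewrite inE => /andP[/[!inE]].
  apply/(@integrable_mkcond _ _ _ mu _ (EFin \o (fun x => g x ^+ 2)) mO).
  move: i2; congr (_.-integrable _ _); apply/funext => x /=.
  by rewrite !patchE; case: ifP => //=; rewrite expr0n.
move=> [mg i2]; rewrite inE; apply/andP; split; rewrite inE/=.
  exact/(measurable_restrictT _ mO).
rewrite /finite_norm unlock; apply: poweR_lty.
have := (@integrable_mkcond _ _ _ mu _ (EFin \o (fun x => g x ^+ 2)) mO).1 i2.
move=> /integrableP[_]; apply: le_lt_trans.
rewrite le_eqVlt; apply/orP; left; apply/eqP; apply: eq_integral => x _ /=.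
rewrite !patchE; case: ifP => _ /=; last by rewrite !normr0 powR0.
by rewrite powR_mulrn// normrX.
Qed.

Lemma L2on_ae O f g : measurable O -> L2on O f -> measurable_fun O g ->
  {ae mu, forall x, O x -> g x = f x} -> L2on O g.
Proof.
move=> mO [mf i2] mg fg; split => //; apply/integrableP; split.
  by apply/measurable_EFinP; exact: measurable_funX.
have /integrableP[_] := i2; apply: le_lt_trans.
rewrite le_eqVlt; apply/orP; left; apply/eqP.
apply: ae_eq_integral => //.
- by apply: measurableT_comp => //; apply/measurable_EFinP; exact: measurable_funX.
- by apply: measurableT_comp => //; apply/measurable_EFinP; exact: measurable_funX.
by apply: (@filterS _ _ (ae_filter_ringOfSetsType mu) _ _ _ fg) => x h Ox /=; rewrite h.
Qed.

Lemma L2onS O S g : measurable O -> measurable S -> S `<=` O -> L2on O g -> L2on S g.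
Proof.
move=> mO mS SO [mg ig]; split; first exact: measurable_funS mg.
exact: (@integrableS _ _ _ mu O).
Qed.

Lemma L2onM O f g : measurable O -> L2on O f -> L2on O g ->
  mu.-integrable O (EFin \o (fun x => f x * g x)).
Proof.
move=> mO [mf i2] [mg j2].
have i : mu.-integrable O (EFin \o (fun x => f x ^+ 2 + g x ^+ 2)) by exact: integrable_addr.
apply: (le_integrable _ _ _ i) => //.
  by apply/measurable_EFinP; exact: measurable_funM.
move=> x _ /=; rewrite lee_fin [leRHS]ger0_norm ?addr_ge0 ?sqr_ge0//.
rewrite ler_norml; have := sqr_ge0 (f x - g x); have := sqr_ge0 (f x + g x).
move=> h1 h2; apply/andP; split; nra.
Qed.

Lemma L2onD O f g : measurable O -> L2on O f -> L2on O g -> L2on O (fun x => f x + g x).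
Proof.
move=> mO lf lg; have [mf i2] := lf; have [mg j2] := lg; split; first exact: measurable_funD.
have -> : (fun x => (f x + g x) ^+ 2) = (fun x => f x ^+ 2 + 2 * (f x * g x) + g x ^+ 2).
  by apply/funext => x; ring.
apply: integrable_addr => //; apply: integrable_addr => //.
by apply: integrable_mulrl => //; exact: L2onM.
Qed.

Lemma L2onZ O (k : R) g : measurable O -> L2on O g -> L2on O (fun x => k * g x).
Proof.
move=> mO [mg j2]; split; first exact: measurable_funM.
under eq_fun do rewrite exprMn.
exact: integrable_mulrl.
Qed.

Lemma L2onB O f g : measurable O -> L2on O f -> L2on O g -> L2on O (fun x => f x - g x).
Proof.
move=> mO lf lg; have := L2onD mO lf (L2onZ (-1) mO lg).
by congr (L2on _ _); apply/funext => x; rewrite mulN1r.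
Qed.

Lemma L2on_int O g : measurable O -> (mu O < +oo)%E -> L2on O g ->
  mu.-integrable O (EFin \o g).
Proof.
move=> mO fO lg; have l1 : L2on O (cst 1).
  split; first exact: measurable_cst.
  apply/integrableP; split; first by apply/measurable_EFinP; apply: measurable_funX; exact: measurable_cst.
  rewrite (_ : (fun x => `|(EFin \o _) x|)%E = cst 1%:E); last first.
    by apply/funext => x /=; rewrite expr1n normr1.
  by rewrite integral_cst// mul1e.
have := L2onM mO lg l1; congr (_.-integrable _ _); apply/funext => x.
by rewrite /= mulr1.
Qed.

Lemma continuous_L2on g c r : continuous g -> L2on (csq c r) g.
Proof.
move=> cg; split; first by apply: measurable_funTS; exact: continuous_measurable2.
apply: continuous_integrable_csq => x; have := cg x => h.
by under eq_fun do rewrite expr2; exact: continuousM.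
Qed.

End L2on.

Lemma ord2E (j : 'I_2) : j = 0 \/ j = 1.
Proof. by case: j => [[|[|//]] ij]; [left|right]; exact/val_inj. Qed.

(** * The fundamental theorem of calculus along horizontal and vertical lines *)

Section line_integrals.
Context {R : realType}.
Local Notation mu := (@leb2 R).
Local Notation leb := (@lebesgue_measure R).
Implicit Types (f g v : R * R -> R) (O S : set (R * R)).

Lemma is_derive_line0 v (s y : R) : differentiable v (s, y) ->
  is_derive s 1 (fun t => v (t, y)) (partial 0 v (s, y)).
Proof.
move=> dv; have := @diff_derivable _ _ _ _ _ (basis2 R 0) dv.
rewrite /partial /derivable /derive /basis2/= => dv'.
have E : (fun h : R => h^-1 *: (v (h *: 1 + s, y) - v (s, y))) =
  (fun h : R => h^-1 *: ((v \o shift (s, y)) (h *: (1, 0)) - v (s, y))).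
  apply/funext => h; have E2 : (h *: ((1 : R), (0 : R)) + (s, y) : R * R) = (h *: 1 + s, h *: 0 + y) by [].
  by rewrite /= E2 scaler0 add0r.
apply: DeriveDef; first by rewrite /derivable E.
by rewrite /derive E.
Qed.

Lemma is_derive_line1 v (s y : R) : differentiable v (s, y) ->
  is_derive y 1 (fun t => v (s, t)) (partial 1 v (s, y)).
Proof.
move=> dv; have := @diff_derivable _ _ _ _ _ (basis2 R 1) dv.
rewrite /partial /derivable /derive /basis2/= => dv'.
have E : (fun h : R => h^-1 *: (v (s, h *: 1 + y) - v (s, y))) =
  (fun h : R => h^-1 *: ((v \o shift (s, y)) (h *: (0, 1)) - v (s, y))).
  apply/funext => h; have E2 : (h *: ((0 : R), (1 : R)) + (s, y) : R * R) = (h *: 0 + s, h *: 1 + y) by [].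
  by rewrite /= E2 scaler0 add0r.
apply: DeriveDef; first by rewrite /derivable E.
by rewrite /derive E.
Qed.

Lemma continuous_line0 v y : smooth2 v -> continuous (fun t => v (t, y)).
Proof.
move=> sv t; apply: differentiable_continuous; apply/derivable1_diffP.
exact: (@ex_derive _ _ _ _ _ _ _ (is_derive_line0 (smooth2_diff (t, y) sv))).
Qed.

Lemma continuous_line1 v s : smooth2 v -> continuous (fun t => v (s, t)).
Proof.
move=> sv t; apply: differentiable_continuous; apply/derivable1_diffP.
exact: (@ex_derive _ _ _ _ _ _ _ (is_derive_line1 (smooth2_diff (s, t) sv))).
Qed.

Lemma line_FTC (phi phi' : R -> R) (a b : R) : a <= b ->
  (forall t : R, is_derive t 1 phi (phi' t)) -> continuous phi' ->
  (\int[leb]_(t in `[a, b]) (phi' t)%:E = (phi b - phi a)%:E)%E.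
Proof.
move=> ab dphi cphi'.
have cphi : continuous phi.
  move=> t; apply: differentiable_continuous; apply/derivable1_diffP.
  exact: (@ex_derive _ _ _ _ _ _ _ (dphi t)).
move: ab; rewrite le_eqVlt => /predU1P[->|ab].
  by rewrite set_itv1 integral_set1 subrr.
rewrite EFinB; apply: (@continuous_FTC2 R phi' phi) => //.
- exact: continuous_subspaceT.
- split.
  + by move=> x _; exact: (@ex_derive _ _ _ _ _ _ _ (dphi x)).
  + exact/cvg_at_right_filter/cphi.
  + exact/cvg_at_left_filter/cphi.
by move=> x _; rewrite derive1E; exact: (@derive_val _ _ _ _ _ _ _ (dphi x)).
Qed.

Lemma line_integral0 (phi phi' : R -> R) (k : R) : 0 <= k ->
  (forall t : R, is_derive t 1 phi (phi' t)) -> continuous phi' ->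
  phi k = 0 -> phi (- k) = 0 -> (forall t, k < `|t| -> phi' t = 0) ->
  (\int[leb]_t (phi' t)%:E = 0)%E.
Proof.
move=> k0 dphi cphi' p1 p2 out; have kk : - k <= k by lra.
transitivity (\int[leb]_(t in `[(- k)%R, k]) (phi' t)%:E)%E; last first.
  by rewrite (line_FTC kk dphi cphi') p1 p2 subrr.
rewrite [RHS]integral_mkcond; apply: eq_integral => t _; rewrite patchE.
case: ifPn => // /negP nt; rewrite out// ltNge ler_norml.
by apply/negP => tk; apply: nt; apply/mem_set; rewrite /= in_itv.
Qed.

(** Fubini with the differentiated variable innermost: on each line the integral of the derivative
    is a difference of boundary values, both zero. *)
Lemma integral_partial0 (h : R * R -> R) (K : set (R * R)) j : smooth2 h ->
  compact K -> (forall x, ~ K x -> h x = 0) -> \int[mu]_x partial j h x = 0.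
Proof.
move=> sh cK hK; have [k k0 Kk] := compact_sub_csq cK.
have h0 x : ~ csq 0 k x -> h x = 0 by move=> nx; apply: hK => /Kk.
have p0 x : ~ csq 0 k x -> partial j h x = 0.
  by apply: partial_out => //; exact: closed_csq.
have cp : continuous (partial j h) by apply: smooth2_cts; exact: smooth2_partial.
have ip : mu.-integrable setT (EFin \o partial j h).
  have := (@integrable_mkcond _ _ _ mu _ (EFin \o partial j h) (measurable_csq 0 k)).1
    (continuous_integrable_csq 0 k cp).
  congr (_.-integrable _ _); apply/funext => x /=; rewrite patchE; case: ifPn => // /negP nx.
  by rewrite p0// => cx; apply: nx; exact/mem_set.
have out1 s y : k < `|s| -> ~ csq 0 k (s, y) by move=> ks [+ _]; rewrite /= subr0; lra.
have out2 s y : k < `|y| -> ~ csq 0 k (s, y) by move=> ks [_]; rewrite /= subr0; lra.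
have k1 : k < `|k + 1| by rewrite ger0_norm; lra.
have k2 : k < `|- (k + 1)| by rewrite normrN.
have cd := smooth2_partial j sh.
rewrite /Rintegral; case: (ord2E j) => jE; rewrite jE in p0 cp ip cd *.
  have := @integral21_prod_meas1 _ _ _ _ _ leb leb (EFin \o partial 0 h) ip.
  rewrite /fubini_G => <-; rewrite integral0_eq// => y _.
  (* The radius [k + 1] and not [k]: [h] is known to vanish outside the closed square of radius [k],
     not on its boundary. *)
  apply: (@line_integral0 (fun t => h (t, y)) (fun t => partial 0 h (t, y)) (k + 1)).
  - by lra.
  - by move=> t; apply: is_derive_line0; exact: smooth2_diff.
  - exact: continuous_line0.
  - by apply: h0; exact: out1.
  - by apply: h0; exact: out1.
  - by move=> t kt; apply: p0; apply: out1; lra.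
have := @integral12_prod_meas1 _ _ _ _ _ leb leb (EFin \o partial 1 h) ip.
rewrite /fubini_F => <-; rewrite integral0_eq// => x _.
apply: (@line_integral0 (fun t => h (x, t)) (fun t => partial 1 h (x, t)) (k + 1)).
- by lra.
- by move=> t; apply: is_derive_line1; exact: smooth2_diff.
- exact: continuous_line1.
- by apply: h0; exact: out2.
- by apply: h0; exact: out2.
- by move=> t kt; apply: p0; apply: out2; lra.
Qed.

End line_integrals.

(** * Weak gradients: uniqueness, comparison with classical gradients, smooth approximation *)

Section weak_gradients.
Context {R : realType}.
Local Notation mu := (@leb2 R).
Implicit Types (f g : R * R -> R) (O S : set (R * R)) (v : R * R -> 'rV[R]_2).

Lemma test_fun_zero_out O g : test_fun O g ->
  exists K, [/\ compact K, K `<=` O, forall x, ~ K x -> g x = 0 &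
    forall j x, ~ K x -> partial j g x = 0].
Proof.
move=> [sg [K [cK KO gK]]]; exists K; split => // j x; apply: partial_out => //.
by apply: (@compact_closed (R * R)%type) => //; exact: norm_hausdorff.
Qed.

Lemma Rintegral_zero_out O g : (forall x, ~ O x -> g x = 0) ->
  \int[mu]_(x in O) g x = \int[mu]_x g x.
Proof.
move=> g0; rewrite [LHS]Rintegral_mkcond; apply: eq_Rintegral => x _.
by rewrite patchE; case: ifPn => // /negP nx; rewrite g0// => Ox; apply: nx; exact/mem_set.
Qed.

Lemma L1loc_continuous O g : continuous g -> measurable O -> L1loc O g.
Proof.
move=> cg mO; split; first by apply: measurable_funTS; exact: continuous_measurable2.
by move=> K cK _; exact: continuous_integrable_compact.
Qed.

Lemma smooth_by_parts O j f g : smooth2 f -> test_fun O g ->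
  \int[mu]_(x in O) (f x * partial j g x) = - \int[mu]_(x in O) (partial j f x * g x).
Proof.
move=> sf tg; have [K [cK KO g0 p0]] := test_fun_zero_out tg; have [sg _] := tg.
rewrite Rintegral_zero_out; last by move=> x nx; rewrite p0 ?mulr0// => /KO.
rewrite [in RHS]Rintegral_zero_out; last by move=> x nx; rewrite g0 ?mulr0// => /KO.
have int h : continuous h -> (forall x, ~ K x -> h x = 0) -> mu.-integrable setT (EFin \o h).
  move=> ch hK; have mK := compact_measurable2 cK.
  have := (@integrable_mkcond _ _ _ mu _ (EFin \o h) mK).1 (continuous_integrable_compact ch cK).
  congr (_.-integrable _ _); apply/funext => x /=; rewrite patchE; case: ifPn => // /negP nx.
  by rewrite hK// => cx; apply: nx; exact/mem_set.
have i1 : mu.-integrable setT (EFin \o (fun x => f x * partial j g x)).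
  apply: int; last by move=> x nx; rewrite p0 ?mulr0.
  by apply: smooth2_cts; apply: smooth2M => //; exact: smooth2_partial.
have i2 : mu.-integrable setT (EFin \o (fun x => partial j f x * g x)).
  apply: int; last by move=> x nx; rewrite g0 ?mulr0.
  by apply: smooth2_cts; apply: smooth2M => //; exact: smooth2_partial.
apply/eqP; rewrite -subr_eq0 opprK -RintegralD//; apply/eqP.
rewrite -[RHS](@integral_partial0 _ (fun x => f x * g x) K j) //; last 2 first.
- exact: smooth2M.
- by move=> x nx; rewrite g0 ?mulr0.
apply: eq_Rintegral => x _; rewrite partialM; [|exact: smooth2_diff..].
by rewrite [X in _ + X]mulrC.
Qed.

Lemma wgrad_unique O v (G H : R * R -> 'M[R]_2) : open O ->
  is_wgrad O v G -> is_wgrad O v H ->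
  forall i j, {ae mu, forall x, O x -> G x i j = H x i j}.
Proof.
move=> oO wG wH i j; have mO := open_measurable2 oO.
  have [_ [mG iG] EG] := wG i j; have [_ [mH iH] EH] := wH i j.
  suff A : {ae mu, forall x, O x -> G x i j - H x i j = 0}.
    by apply: (@filterS _ _ (ae_filter_ringOfSetsType mu) _ _ _ A) => x /= h Ox; apply/eqP; rewrite -subr_eq0 h.
  apply: (@weak_zero _ O (fun x => G x i j - H x i j)) => //.
    split; first exact: measurable_funB.
    move=> K cK KO; apply: integrable_subr; [exact: compact_measurable2|exact: iG|exact: iH].
  move=> phi tphi; have [K [cK KO g0 p0]] := test_fun_zero_out tphi; have [sp _] := tphi.
  have mK := compact_measurable2 cK.
  have loc (h : R * R -> R) : \int[mu]_(x in O) (h x * phi x) = \int[mu]_(x in K) (h x * phi x).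
    rewrite Rintegral_zero_out; last by move=> x nx; rewrite g0 ?mulr0// => /KO.
    by rewrite [in RHS]Rintegral_zero_out// => x nx; rewrite g0 ?mulr0.
  have int (h : R * R -> R) : mu.-integrable K (EFin \o h) ->
      mu.-integrable K (EFin \o (fun x => h x * phi x)).
    move=> ih; have [k k0 Kk] := compact_sub_csq cK.
    have [M M0 hM] := continuous_bounded_csq 0 k (smooth2_cts sp).
    apply: (integrable_bounded_on (M := M)) => //; last by move=> z /Kk /hM.
    by apply: measurable_funTS; apply: continuous_measurable2; exact: smooth2_cts.
  rewrite loc; under eq_Rintegral do rewrite mulrBl.
  rewrite RintegralB//; [|by apply: int; exact: iG|by apply: int; exact: iH].
  by rewrite -!loc; have := EG _ tphi; rewrite EH// => /oppr_inj ->; rewrite subrr.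
Qed.

(** [wgrad] is a chosen representative, in general different from the square-integrable one that
    [H1] provides; it inherits integrability through uniqueness almost everywhere. *)
Lemma H1_wgrad O v : open O -> H1 O v ->
  [/\ is_wgrad O v (wgrad O v), forall i, L2on O (vcomp v i) &
    forall i j, L2on O (fun x => wgrad O v x i j)].
Proof.
move=> oO [lv [G [wG lG]]]; have mO := open_measurable2 oO.
have ww : is_wgrad O v (wgrad O v) by exact: (@getPex _ [set G | is_wgrad O v G] (ex_intro _ G wG)).
split => //; first by move=> i; apply/Lp_on2.
move=> i j; have [_ [mw _] _] := ww i j.
apply: (@L2on_ae _ O (fun x => G x i j)) => //; first by apply/Lp_on2.
exact: wgrad_unique.
Qed.

Lemma L2on_test O g : measurable O -> continuous g ->
  (exists K, [/\ compact K, K `<=` O & forall x, ~ K x -> g x = 0]) -> L2on O g.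
Proof.
move=> mO cg [K [cK KO g0]]; split.
  by apply: measurable_funTS; exact: continuous_measurable2.
have mK := compact_measurable2 cK.
apply: (@integrableS _ _ _ mu setT) => //.
have cg2 : continuous (fun x => g x ^+ 2).
  by move=> x; under eq_fun do rewrite expr2; apply: continuousM; exact: cg.
have := (@integrable_mkcond _ _ _ mu _ (EFin \o (fun x => g x ^+ 2)) mK).1 (continuous_integrable_compact cg2 cK).
congr (_.-integrable _ _); apply/funext => x /=; rewrite patchE; case: ifPn => // /negP nx.
by rewrite g0 ?expr0n// => cx; apply: nx; exact/mem_set.
Qed.

Definition cgrad v : R * R -> 'M[R]_2 := fun x => \matrix_(i, j) partial j (vcomp v i) x.

Lemma test_map_wgrad O v : open O -> test_map O v -> is_wgrad O v (cgrad v).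
Proof.
move=> oO tv i j; have mO := open_measurable2 oO; have [sv _] := tv i.
have E : (fun x => cgrad v x i j) = partial j (vcomp v i).
  by apply/funext => x; rewrite mxE.
split.
- by apply: L1loc_continuous => //; exact: smooth2_cts.
- by rewrite E; apply: L1loc_continuous => //; apply: smooth2_cts; exact: smooth2_partial.
- move=> g tg; rewrite smooth_by_parts//; congr (- _); apply: eq_Rintegral => x _.
  by rewrite mxE.
Qed.

Lemma test_map_H1 O v : open O -> test_map O v -> H1 O v.
Proof.
move=> oO tv; have mO := open_measurable2 oO; split.
  move=> i; apply/Lp_on2 => //; have [sv hK] := tv i.
  by apply: L2on_test => //; exact: smooth2_cts.
exists (cgrad v); split; first exact: test_map_wgrad.
move=> i j; apply/Lp_on2 => //; have [sv _] := tv i.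
have [K [cK KO g0 p0]] := test_fun_zero_out (tv i).
have -> : (fun x => cgrad v x i j) = partial j (vcomp v i).
  by apply/funext => x; rewrite mxE.
apply: L2on_test => //; first by apply: smooth2_cts; exact: smooth2_partial.
by exists K; split => // x; exact: p0.
Qed.

Lemma test_map_ae O v : open O -> test_map O v -> forall i j,
  {ae mu, forall x, O x -> wgrad O v x i j = partial j (vcomp v i) x}.
Proof.
move=> oO tv i j; have [ww _ _] := H1_wgrad oO (test_map_H1 oO tv).
have := wgrad_unique oO ww (test_map_wgrad oO tv) i j.
by apply: (@filterS _ _ (ae_filter_ringOfSetsType mu)) => x /= h Ox; rewrite h// mxE.
Qed.

Lemma ord2_sum (F : 'I_2 -> R) : \sum_(i < 2) F i = F 0 + F 1.
Proof. by rewrite big_ord_recl big_ord1; congr (_ + F _); exact/val_inj. Qed.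

Lemma frobmx2E (A B : 'M[R]_2) : frobmx A B =
  A 0 0 * B 0 0 + A 0 1 * B 0 1 + A 1 0 * B 1 0 + A 1 1 * B 1 1.
Proof. by rewrite /frobmx /mxtrace !ord2_sum !mxE !ord2_sum !mxE; ring. Qed.

Lemma frobrv2E (a b : 'rV[R]_2) : frobmx a b = a 0 0 * b 0 0 + a 0 1 * b 0 1.
Proof. by rewrite /frobmx /mxtrace !ord2_sum !mxE !big_ord1 !mxE; ring. Qed.

Lemma det2E (A : 'M[R]_2) : \det A = A 0 0 * A 1 1 - A 0 1 * A 1 0.
Proof. have [h0 h1 _ _] := cofmx2E A; rewrite /cofmx !mxE in h0 h1.
by rewrite (expand_det_row _ 0) ord2_sum h0 h1; ring. Qed.

(** The constant sequence works. What has to be checked is that the [H1norm] of the zero map is 0,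
    since the gradient chosen for it is zero only almost everywhere. *)
Lemma test_map_H10 O v : open O -> test_map O v -> H10 O v.
Proof.
move=> oO tv; split; first exact: test_map_H1.
exists (fun=> v); split => //.
have -> : v \- v = (fun=> 0) by apply/funext => x /=; rewrite subrr.
suff -> : H1norm O (fun=> 0) = 0 by exact: cvg_cst.
have mO := open_measurable2 oO.
have t0 : test_map O (fun=> 0 : 'rV[R]_2).
  move=> i; rewrite (_ : vcomp _ i = fun=> 0); last by apply/funext => x; rewrite /vcomp mxE.
  split; first exact: (@smooth2_cst R 0).
  by exists set0; split => //; exact: compact0.
have [_ _ l2] := H1_wgrad oO (test_map_H1 oO t0).
have A := test_map_ae oO t0.
rewrite /H1norm [X in Num.sqrt X](_ : _ = 0) ?sqrtr0//.
have P0 i j x : partial j (vcomp (fun=> 0 : 'rV[R]_2) i) x = 0.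
  by rewrite (_ : vcomp _ i = cst 0) ?partial_cst//; apply/funext => y; rewrite /vcomp mxE.
have -> : (fun x => frobmx (0 : 'rV[R]_2) 0 + frobmx (wgrad O (fun=> 0) x) (wgrad O (fun=> 0) x)) =
  (fun x => let w := wgrad O (fun=> 0 : 'rV[R]_2) x in
    w 0 0 ^+ 2 + w 0 1 ^+ 2 + w 1 0 ^+ 2 + w 1 1 ^+ 2).
  by apply/funext => x; rewrite frobmx2E frobrv2E !mxE/=; ring.
rewrite (@ae_eq_Rintegral _ _ _ mu O mO _ (cst 0)).
- by rewrite Rintegral_cst// mul0r.
- apply: integrable_addr => //; last by case: (l2 1 1).
  apply: integrable_addr => //; last by case: (l2 1 0).
  by apply: integrable_addr => //; [case: (l2 0 0)|case: (l2 0 1)].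
- exact: measurable_cst.
have I := @filterI _ _ (ae_filter_ringOfSetsType mu).
have := I _ _ (I _ _ (A 0 0) (A 0 1)) (I _ _ (A 1 0) (A 1 1)).
apply: (@filterS _ _ (ae_filter_ringOfSetsType mu)) => x /= [[h1 h2] [h3 h4]] Ox.
by rewrite h1// h2// h3// h4// !P0; ring.
Qed.

(** Clamping [f] at its essential bound gives a representative bounded at every point, as the
    pointwise algebra of [caccio_pointwise] requires. *)
Lemma Linfty_bounded O f : measurable O -> Lp_on O +oo%E f ->
  exists f0 : R * R -> R, exists2 M : R, 0 <= M &
    [/\ measurable_fun setT f0, forall x, `|f0 x| <= M &
      {ae mu, forall x, O x -> f0 x = f x}].
Proof.
move=> mO; rewrite /Lp_on inE => /andP[/[!inE]/= mf nf].
have mT : (0 < mu setT)%E.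
  apply: (@lt_le_trans _ _ (mu (csq 0 1))); first by rewrite leb2_csq// lte_fin; lra.
  apply: le_measure; rewrite ?inE//; exact: measurable_csq.
have [M M0 hM] : exists2 M : R, 0 <= M & {ae mu, forall x, `|(f \_ O) x| <= M}.
  move: nf; rewrite /finite_norm unlock mT; set s := ess_sup _ _ => s1.
  exists (Num.max 0 (fine s)); first by rewrite le_max lexx.
  have /ess_supP : (s <= (Num.max 0 (fine s))%:E)%E.
    by case: s s1 => [r||]//= _; rewrite ?leNye// lee_fin le_max lexx orbT.
  by apply: (@filterS _ _ (ae_filter_ringOfSetsType mu)) => x /=; rewrite lee_fin.
exists (fun x => Num.max (- M) (Num.min M ((f \_ O) x))); exists M => //; split.
- by apply: measurable_maxr => //; exact: measurable_minr.
- move=> x; rewrite ler_norml le_max lexx/= ge_max; apply/andP; split; first by lra.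
  by rewrite ge_min lexx.
apply: (@filterS _ _ (ae_filter_ringOfSetsType mu) _ _ _ hM) => x /= h Ox.
have E : (f \_ O) x = f x by rewrite patchE mem_set.
move: h; rewrite E ler_norml => /andP[h1 h2].
by rewrite (min_idPr h2) (max_idPr h1).
Qed.

Lemma cofmx_frob2E (A B : 'M[R]_2) : frobmx (cofmx A) B =
  A 1 1 * B 0 0 - A 1 0 * B 0 1 - A 0 1 * B 1 0 + A 0 0 * B 1 1.
Proof. by rewrite frobmx2E; have [-> -> -> ->] := cofmx2E A; ring. Qed.

Lemma cgrad_L2 O v i j : open O -> test_map O v -> L2on O (partial j (vcomp v i)).
Proof.
move=> oO tv; have mO := open_measurable2 oO; have [sv _] := tv i.
have [K [cK KO g0 p0]] := test_fun_zero_out (tv i).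
apply: L2on_test => //; first by apply: smooth2_cts; exact: smooth2_partial.
by exists K; split => // x; exact: p0.
Qed.

Lemma measurable_frobmx O (A B : R * R -> 'M[R]_2) :
  (forall i j, measurable_fun O (fun x => A x i j)) ->
  (forall i j, measurable_fun O (fun x => B x i j)) ->
  measurable_fun O (fun x => frobmx (A x) (B x)).
Proof.
move=> mA mB; under eq_fun do rewrite frobmx2E.
by apply: measurable_funD; [apply: measurable_funD; [apply: measurable_funD|]|];
  apply: measurable_funM.
Qed.

Lemma measurable_cofmx_frob O (A B : R * R -> 'M[R]_2) :
  (forall i j, measurable_fun O (fun x => A x i j)) ->
  (forall i j, measurable_fun O (fun x => B x i j)) ->
  measurable_fun O (fun x => frobmx (cofmx (A x)) (B x)).
Proof.
move=> mA mB; under eq_fun do rewrite cofmx_frob2E.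
by apply: measurable_funD; [apply: measurable_funB; [apply: measurable_funB|]|];
  apply: measurable_funM.
Qed.

Lemma measurable_det2 O (A : R * R -> 'M[R]_2) :
  (forall i j, measurable_fun O (fun x => A x i j)) ->
  measurable_fun O (fun x => \det (A x)).
Proof.
move=> mA; under eq_fun do rewrite det2E.
by apply: measurable_funB; apply: measurable_funM.
Qed.

(** Replacement almost everywhere of [f] by [f0] and of the chosen gradient of the test map by its
    classical one. With this and [coercive_classical] both hypotheses speak of smooth test maps, and
    [H10] is left behind. *)
Lemma weak_solution_classical O f f0 (M : R) u : open O -> measurable_fun O f ->
  measurable_fun setT f0 -> (forall x, `|f0 x| <= M) ->
  {ae mu, forall x, O x -> f0 x = f x} -> H1 O u -> weak_solution O f u ->
  forall phi, test_map O phi -> \int[mu]_(x in O)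
    (2 * frobmx (wgrad O u x) (cgrad phi x) +
     f0 x * frobmx (cofmx (wgrad O u x)) (cgrad phi x)) = 0.
Proof.
move=> oO mf mf0 f0M ff hu W phi tphi; have mO := open_measurable2 oO.
rewrite -[RHS](W phi (test_map_H10 oO tphi)).
have [_ _ lu] := H1_wgrad oO hu; have [_ _ lp] := H1_wgrad oO (test_map_H1 oO tphi).
have lc i j := cgrad_L2 i j oO tphi.
have mu_ i j : measurable_fun O (fun x => wgrad O u x i j) by case: (lu i j).
have mp i j : measurable_fun O (fun x => wgrad O phi x i j) by case: (lp i j).
apply: ae_eq_Rintegral => //.
- have -> : (fun x => 2 * frobmx (wgrad O u x) (cgrad phi x) +
     f0 x * frobmx (cofmx (wgrad O u x)) (cgrad phi x)) = (fun x =>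
     (2 * (wgrad O u x 0 0 * partial 0 (vcomp phi 0) x + wgrad O u x 0 1 * partial 1 (vcomp phi 0) x +
      wgrad O u x 1 0 * partial 0 (vcomp phi 1) x + wgrad O u x 1 1 * partial 1 (vcomp phi 1) x)) +
     (wgrad O u x 1 1 * partial 0 (vcomp phi 0) x - wgrad O u x 1 0 * partial 1 (vcomp phi 0) x -
      wgrad O u x 0 1 * partial 0 (vcomp phi 1) x + wgrad O u x 0 0 * partial 1 (vcomp phi 1) x) * f0 x).
    by apply/funext => x; rewrite frobmx2E cofmx_frob2E !mxE; ring.
  have P i j k l : mu.-integrable O (EFin \o (fun x => wgrad O u x i j * partial k (vcomp phi l) x)).
    by apply: L2onM.
  apply: integrable_addr => //.
    by apply: integrable_mulrl => //; do 3 (apply: integrable_addr => //).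
  apply: (integrable_bounded_on (M := M)) => //; last exact: measurable_funTS.
  by apply: integrable_addr => //; do 2 (apply: integrable_subr => //).
- apply: measurable_funD; apply: measurable_funM => //; first exact: measurable_frobmx.
  exact: measurable_cofmx_frob.
have A := test_map_ae oO tphi.
have I := @filterI _ _ (ae_filter_ringOfSetsType mu).
have := I _ _ ff (I _ _ (I _ _ (A 0 0) (A 0 1)) (I _ _ (A 1 0) (A 1 1))).
apply: (@filterS _ _ (ae_filter_ringOfSetsType mu)) => x /= [h0 [[h1 h2] [h3 h4]]] Ox.
by rewrite !cofmx_frob2E !frobmx2E !mxE h0// h1// h2// h3// h4.
Qed.

Lemma coercive_classical O f f0 (M gamma : R) : open O -> measurable_fun O f ->
  measurable_fun setT f0 -> (forall x, `|f0 x| <= M) ->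
  {ae mu, forall x, O x -> f0 x = f x} ->
  (forall phi, H10 O phi -> energy O f phi >= gamma *
      \int[mu]_(x in O) frobmx (wgrad O phi x) (wgrad O phi x)) ->
  forall phi, test_map O phi ->
    gamma * \int[mu]_(x in O) frobmx (cgrad phi x) (cgrad phi x) <=
    \int[mu]_(x in O) (frobmx (cgrad phi x) (cgrad phi x) + f0 x * \det (cgrad phi x)).
Proof.
move=> oO mf mf0 f0M ff C phi tphi; have mO := open_measurable2 oO.
have := C phi (test_map_H10 oO tphi); rewrite /energy.
have [_ _ lp] := H1_wgrad oO (test_map_H1 oO tphi).
have lc i j := cgrad_L2 i j oO tphi.
have mp i j : measurable_fun O (fun x => wgrad O phi x i j) by case: (lp i j).
have P i j k l : mu.-integrable O (EFin \o (fun x => partial i (vcomp phi j) x * partial k (vcomp phi l) x)).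
  by apply: L2onM.
have A := test_map_ae oO tphi.
have I := @filterI _ _ (ae_filter_ringOfSetsType mu).
have AE := I _ _ ff (I _ _ (I _ _ (A 0 0) (A 0 1)) (I _ _ (A 1 0) (A 1 1))).
have i1 : mu.-integrable O (EFin \o (fun x => frobmx (cgrad phi x) (cgrad phi x))).
  under eq_fun do rewrite frobmx2E !mxE.
  by do 3 (apply: integrable_addr => //).
have m1 : measurable_fun O (fun x => frobmx (wgrad O phi x) (wgrad O phi x)).
  exact: measurable_frobmx.
have -> : \int[mu]_(x in O) frobmx (wgrad O phi x) (wgrad O phi x) =
    \int[mu]_(x in O) frobmx (cgrad phi x) (cgrad phi x).
  apply/esym/ae_eq_Rintegral => //.
  apply: (@filterS _ _ (ae_filter_ringOfSetsType mu) _ _ _ AE) => x /= [h0 [[h1 h2] [h3 h4]]] Ox.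
  by rewrite !frobmx2E !mxE h1// h2// h3// h4.
suff -> : \int[mu]_(x in O) (frobmx (wgrad O phi x) (wgrad O phi x) + f x * \det (wgrad O phi x)) =
  \int[mu]_(x in O) (frobmx (cgrad phi x) (cgrad phi x) + f0 x * \det (cgrad phi x)) by [].
apply/esym/ae_eq_Rintegral => //.
- have -> : (fun x => frobmx (cgrad phi x) (cgrad phi x) + f0 x * \det (cgrad phi x)) =
    (fun x => frobmx (cgrad phi x) (cgrad phi x) +
      (partial 0 (vcomp phi 0) x * partial 1 (vcomp phi 1) x -
       partial 1 (vcomp phi 0) x * partial 0 (vcomp phi 1) x) * f0 x).
    by apply/funext => x; rewrite det2E !mxE; ring.
  apply: integrable_addr => //; apply: (integrable_bounded_on (M := M)) => //; last exact: measurable_funTS.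
  exact: integrable_subr.
- apply: measurable_funD => //; apply: measurable_funM => //.
  exact: measurable_det2.
apply: (@filterS _ _ (ae_filter_ringOfSetsType mu) _ _ _ AE) => x /= [h0 [[h1 h2] [h3 h4]]] Ox.
by rewrite !frobmx2E !det2E !mxE h0// h1// h2// h3// h4.
Qed.

Lemma csq_shrink c (r e : R) (x : R * R) : csq c r x -> csq x e `<=` csq c (r + e).
Proof.
move=> [/= x1 x2] y [/= y1 y2]; split => /=.
  by have := ler_distD x.1 y.1 c.1; lra.
by have := ler_distD x.2 y.2 c.2; lra.
Qed.

Lemma csqS c (r r' : R) : r <= r' -> csq c r `<=` csq c r'.
Proof. by move=> rr x [/= x1 x2]; split => /=; lra. Qed.

Lemma integral_sub_le (S : set (R * R)) (w : R * R -> R) (eta : R) : measurable S ->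
  measurable_fun setT w -> (forall x, 0 <= w x) ->
  (\int[mu]_x (w x)%:E <= eta%:E)%E ->
  mu.-integrable S (EFin \o w) /\ \int[mu]_(x in S) w x <= eta.
Proof.
move=> mS mw w0 h.
have h2 : (\int[mu]_(x in S) (w x)%:E <= eta%:E)%E.
  apply: le_trans h; rewrite integral_mkcond; apply: ge0_le_integral => //.
  - by move=> x _; rewrite patchE; case: ifP => // _; rewrite lee_fin.
  - by apply/(measurable_restrictT _ mS); apply/measurable_EFinP; exact: measurable_funTS.
  - exact/measurable_EFinP.
  - by move=> x _; rewrite patchE; case: ifP => // _; rewrite lee_fin.
suff ii : mu.-integrable S (EFin \o w).
  by split => //; rewrite -lee_fin /Rintegral fineK//; exact: (@integrable_fin_num _ _ _ mu).
apply/integrableP; split; first by apply/measurable_EFinP; exact: measurable_funTS.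
rewrite (le_lt_trans _ (ltry eta))// (le_trans _ h2)// le_eqVlt; apply/orP; left.
by apply/eqP/eq_integral => x _ /=; rewrite ger0_norm.
Qed.

(** The gap between the two squares accommodates the kernel, so that on the smaller one the gradient
    of the mollified component is exactly the mollified weak gradient. *)
Lemma smooth_approx O v i c (r r' : R) : open O -> H1 O v -> csq c r `<=` O -> r' < r ->
  forall eta, 0 < eta -> exists h, [/\ smooth2 h,
    \int[mu]_(x in csq c r') (h x - vcomp v i x) ^+ 2 <= eta &
    forall j, \int[mu]_(x in csq c r') (partial j h x - wgrad O v x i j) ^+ 2 <= eta].
Proof.
move=> oO hv cO rr eta eta0; have mO := open_measurable2 oO.
have [ww lv lw] := H1_wgrad oO hv; pose S := csq c r.
have mS : measurable S by exact: measurable_csq.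
have lS (h : R * R -> R) : L2on O h ->
    [/\ mu.-integrable setT (EFin \o (h \_ S)),
        mu.-integrable setT (EFin \o (fun x => (h \_ S) x ^+ 2)) &
        forall x, ~ csq 0 (`|c.1| + `|c.2| + r) x -> (h \_ S) x = 0].
  move=> /(L2onS mO mS cO) lh; split.
  - have := (@integrable_mkcond _ _ _ mu _ (EFin \o h) mS).1 (L2on_int mS (leb2_csq_fin c r) lh).
    by rewrite restrict_EFin.
  - have := (@integrable_mkcond _ _ _ mu _ (EFin \o (fun x => h x ^+ 2)) mS).1 lh.2.
    congr (_.-integrable _ _); apply/funext => x /=; rewrite !patchE; case: ifP => //= _.
    by rewrite expr0n.
  - move=> x nx; rewrite patchE; case: ifPn => // /set_mem /csq_sub0 //.
have M (h : R * R -> R) : L2on O h -> exists2 e0 : R, 0 < e0 & forall e b, e <= e0 -> bump e b ->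
    \int[mu]_(x in csq c r') (conv (h \_ S) b b x - h x) ^+ 2 <= eta.
  move=> lh; have [i1 i2 i3] := lS h lh; have [e0 e00 He] := moll_L2 i1 i2 i3 eta0.
  exists e0 => // e b ee bb; have mS' : measurable (csq c r') by exact: measurable_csq.
  have mh : measurable_fun setT (h \_ S) by apply/measurable_EFinP; exact: (measurable_int _ i1).
  have [|_ I] := integral_sub_le mS' _ (fun x => sqr_ge0 (conv (h \_ S) b b x - (h \_ S) x)) (He e b ee bb).
    by apply: measurable_funX; apply: measurable_funB => //; exact: conv_measurable bb.
  apply: le_trans I; rewrite le_eqVlt; apply/orP; left; apply/eqP/eq_Rintegral => x /set_mem cx.
  by rewrite patchE mem_set//; apply: csqS cx; exact: ltW.
have [e1 e10 H1] := M _ (lv i); have [e2 e20 H2] := M _ (lw i 0); have [e3 e30 H3] := M _ (lw i 1).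
(* One kernel for three approximations, that of the component and those of its two weak derivatives,
   and small enough for the gap. *)
pose e := Num.min (Num.min e1 (r - r')) (Num.min e2 e3).
have ep : 0 < e by rewrite !lt_min e10 e20 e30 !andbT/= subr_gt0.
have [ee1 er ee2 ee3] : [/\ e <= e1, e <= r - r', e <= e2 & e <= e3].
  by split; rewrite !ge_min lexx ?orbT.
have [b bb] := bump_exists ep; have [sb _ _ _] := bb.
exists (conv (vcomp v i \_ S) b b); split.
- by apply: smooth2_conv => //; case: (lS _ (lv i)).
- exact: (H1 e).
move=> j.
have E x : x \in csq c r' -> (partial j (conv (vcomp v i \_ S) b b) x - wgrad O v x i j) ^+ 2 =
    (conv ((fun x => wgrad O v x i j) \_ S) b b x - wgrad O v x i j) ^+ 2.
  move=> /set_mem cx; have [_ _ W] := ww i j.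
  rewrite (conv_weak W cO _ bb)//; first by case: (lS _ (lv i)).
  apply: (subset_trans (csq_shrink cx)); apply: csqS; lra.
have -> : \int[mu]_(x in csq c r')
    (partial j (conv (vcomp v i \_ S) b b) x - wgrad O v x i j) ^+ 2 =
    \int[mu]_(x in csq c r') (conv ((fun x => wgrad O v x i j) \_ S) b b x - wgrad O v x i j) ^+ 2.
  by apply: eq_Rintegral => x cx; exact: E.
case: (ord2E j) => ->; [exact: (H2 e)|exact: (H3 e)].
Qed.

End weak_gradients.

(** * The inequality between the L^2 oscillation on a square and the L^1 norm of the gradient *)

Section poincare.
Context {R : realType}.
Local Notation mu := (@leb2 R).
Local Notation leb := (@lebesgue_measure R).
Implicit Types (f g v : R * R -> R).

Lemma measurable_lineint1 g (J : set R) : measurable J -> measurable_fun setT g ->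
  (forall x, 0 <= g x) ->
  measurable_fun setT (fun x : R => \int[leb]_(t in J) (g (x, t))%:E)%E.
Proof.
move=> mJ mg g0; pose F (p : R * R) : \bar R := (g p * \1_J p.2)%:E.
have mF : measurable_fun setT F.
  apply/measurable_EFinP; apply: measurable_funM => //.
  exact: (measurableT_comp (measurable_indic mJ) measurable_snd).
have F0 p : (0 <= F p)%E by rewrite lee_fin mulr_ge0.
have := @measurable_fun_fubini_tonelli_F _ _ _ _ _ leb F mF F0.
congr (measurable_fun _ _); apply/funext => x; rewrite [RHS]integral_mkcond.
apply: eq_integral => t _; rewrite /F patchE indicE /=.
by case: ifP => _; rewrite ?mulr1 ?mulr0.
Qed.

Lemma measurable_lineint0 g (I : set R) : measurable I -> measurable_fun setT g ->
  (forall x, 0 <= g x) ->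
  measurable_fun setT (fun y : R => \int[leb]_(s in I) (g (s, y))%:E)%E.
Proof.
move=> mI mg g0; pose F (p : R * R) : \bar R := (g p * \1_I p.1)%:E.
have mF : measurable_fun setT F.
  apply/measurable_EFinP; apply: measurable_funM => //.
  exact: (measurableT_comp (measurable_indic mI) measurable_fst).
have F0 p : (0 <= F p)%E by rewrite lee_fin mulr_ge0.
have := @measurable_fun_fubini_tonelli_G _ _ _ _ _ leb F mF F0.
congr (measurable_fun _ _); apply/funext => y; rewrite [RHS]integral_mkcond.
apply: eq_integral => t _; rewrite /F patchE indicE /=.
by case: ifP => _; rewrite ?mulr1 ?mulr0.
Qed.

Lemma tonelli_box g (I J : set R) : measurable I -> measurable J ->
  measurable_fun setT g -> (forall x, 0 <= g x) ->
  (\int[mu]_(x in I `*` J) (g x)%:E = \int[leb]_(s in I) \int[leb]_(t in J) (g (s, t))%:E)%E /\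
  (\int[mu]_(x in I `*` J) (g x)%:E = \int[leb]_(t in J) \int[leb]_(s in I) (g (s, t))%:E)%E.
Proof.
move=> mI mJ mg g0; pose F (p : R * R) : \bar R := (g p * (\1_I p.1 * \1_J p.2))%:E.
have mF : measurable_fun setT F.
  apply/measurable_EFinP; apply: measurable_funM => //; apply: measurable_funM.
    exact: (measurableT_comp (measurable_indic mI) measurable_fst).
  exact: (measurableT_comp (measurable_indic mJ) measurable_snd).
have F0 p : (0 <= F p)%E by rewrite lee_fin mulr_ge0// mulr_ge0.
have E : (\int[mu]_(x in I `*` J) (g x)%:E = \int[mu]_x F x)%E.
  rewrite integral_mkcond; apply: eq_integral => x _; rewrite patchE /F.
  case: ifPn => [/set_mem [/= Ix Jx]|nx]; first by rewrite !indicE !mem_set// !mulr1.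
  rewrite !indicE; case: (boolP (x.1 \in I)) => Ix; last by rewrite mul0r mulr0.
  case: (boolP (x.2 \in J)) => Jx; last by rewrite !mulr0.
  by move/negP : nx => []; apply/mem_set; split; exact: set_mem.
split; rewrite E.
  rewrite (@fubini_tonelli1 _ _ _ _ _ leb leb F mF F0) [RHS]integral_mkcond.
  apply: eq_integral => s _; rewrite /fubini_F patchE; case: ifPn => Is.
    rewrite [RHS]integral_mkcond; apply: eq_integral => t _; rewrite patchE /F /= !indicE Is mul1r.
    by case: ifP => _; rewrite ?mulr1 ?mulr0.
  apply: integral0_eq => t _; by rewrite /F /= !indicE (negbTE Is) mul0r mulr0.
rewrite (@fubini_tonelli2 _ _ _ _ _ leb leb F mF F0) [RHS]integral_mkcond.
apply: eq_integral => t _; rewrite /fubini_G patchE; case: ifPn => Jt.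
  rewrite [RHS]integral_mkcond; apply: eq_integral => s _; rewrite patchE /F /= !indicE Jt mulr1.
  by case: ifP => _; rewrite ?mulr1 ?mulr0.
by apply: integral0_eq => s _; rewrite /F /= !indicE (negbTE Jt) !mulr0.
Qed.

Lemma below_mean (h : R -> \bar R) (p q m d : R) : p < q -> 0 < d ->
  measurable_fun setT h -> (forall t, 0 <= h t)%E ->
  (\int[leb]_(t in `[p, q]) h t <= m%:E)%E ->
  exists2 y : R, p <= y <= q & (h y <= (m / (q - p) + d)%:E)%E.
Proof.
move=> pq d0 mh h0 hm; apply: contrapT => H.
have L : (0 < q - p) by rewrite subr_gt0.
have m0 : 0 <= m by rewrite -lee_fin (le_trans _ hm)// integral_ge0.
have : (\int[leb]_(t in `[p, q]) (cst (m / (q - p) + d)%:E t) <= m%:E)%E.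
  apply: (le_trans _ hm); apply: ge0_le_integral => //.
  - by move=> t _; rewrite lee_fin addr_ge0 ?divr_ge0// ltW.
  - exact: measurable_funTS.
  move=> t; rewrite /= in_itv/= => tpq; rewrite leNgt; apply/negP => hlt; apply: H.
  by exists t => //; exact: ltW.
rewrite integral_cst//= lebesgue_measure_itv/= lte_fin pq -EFinB -EFinM lee_fin.
by rewrite mulrDl divfK ?gt_eqF//; apply/negP; rewrite -ltNge ltrDl mulr_gt0.
Qed.

Lemma line_bound (phi phi' : R -> R) (p q s t : R) :
  (forall t : R, is_derive t 1 phi (phi' t)) -> continuous phi' ->
  p <= s <= q -> p <= t <= q ->
  (`|phi s - phi t|%:E <= \int[leb]_(r in `[p, q]) `|phi' r|%:E)%E.
Proof.
move=> dphi cphi'.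
wlog st : s t / s <= t.
  move=> H ps pt; have [st|/ltW ts] := leP s t; first exact: H.
  by rewrite distrC; exact: H.
move=> /andP[ps sq] /andP[pt tq]; rewrite distrC.
have := line_FTC st dphi cphi' => /(congr1 abse) /= <-.
have mphi : measurable_fun setT phi' by exact: continuous_measurable_fun.
apply: le_trans; first apply: le_abse_integral => //.
  by apply/measurable_EFinP; exact: measurable_funTS.
apply: ge0_subset_integral => //.
  by apply/measurable_EFinP; apply: measurable_funTS; exact: measurableT_comp.
by apply: subset_itvScc; rewrite bnd_simp.
Qed.

(** The Gagliardo-Nirenberg trick. Let a(y) and b(x) be the integrals of the partial derivatives
    along the horizontal and the vertical line. Going from (x, y) to a base point first vertically
    or first horizontally bounds |v - k| by b(x) plus a constant and by a(y) plus a constant; in the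
    product of the two bounds the variables separate. *)
Lemma poincare v c (r e : R) : smooth2 v -> 0 < r -> 0 < e ->
  exists k : R, \int[mu]_(x in csq c r) (v x - k) ^+ 2 <=
    (\int[mu]_(x in csq c r) `|partial 0 v x| + \int[mu]_(x in csq c r) `|partial 1 v x| + e) ^+ 2.
Proof.
move=> sv r0 e0.
pose I : set R := `[c.1 - r, c.1 + r]%classic; pose J : set R := `[c.2 - r, c.2 + r]%classic.
have mI : measurable I by exact: measurable_itv.
have mJ : measurable J by exact: measurable_itv.
have cg j : continuous (fun x => `|partial j v x|).
  move=> x; apply: continuous_comp; last exact: norm_continuous.
  by apply: smooth2_cts; exact: smooth2_partial.
have mg j : measurable_fun setT (fun x => `|partial j v x|) by exact: continuous_measurable2.
have gp j x : 0 <= `|partial j v x| by [].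
pose a (y : R) : \bar R := (\int[leb]_(s in I) `|partial 0 v (s, y)|%:E)%E.
pose b (x : R) : \bar R := (\int[leb]_(t in J) `|partial 1 v (x, t)|%:E)%E.
have ma : measurable_fun setT a by exact: measurable_lineint0 (mg 0) (gp 0).
have mb : measurable_fun setT b by exact: measurable_lineint1 (mg 1) (gp 1).
have a0 y : (0 <= a y)%E by apply: integral_ge0 => s _; rewrite lee_fin; exact: gp.
have b0 x : (0 <= b x)%E by apply: integral_ge0 => s _; rewrite lee_fin; exact: gp.
pose al := \int[mu]_(x in csq c r) `|partial 0 v x|; pose be := \int[mu]_(x in csq c r) `|partial 1 v x|.
have alE : (\int[leb]_(t in J) a t = al%:E)%E.
  have [_ <-] := tonelli_box mI mJ (mg 0) (gp 0).
  by rewrite -csqE /al /Rintegral fineK//; apply: (@integrable_fin_num _ _ _ mu);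
    [exact: measurable_csq|exact: (continuous_integrable_csq _ _ (cg 0))].
have beE : (\int[leb]_(t in I) b t = be%:E)%E.
  have [<- _] := tonelli_box mI mJ (mg 1) (gp 1).
  by rewrite -csqE /be /Rintegral fineK//; apply: (@integrable_fin_num _ _ _ mu);
    [exact: measurable_csq|exact: (continuous_integrable_csq _ _ (cg 1))].
have al0 : 0 <= al by apply: Rintegral_ge0 => x _.
have be0 : 0 <= be by apply: Rintegral_ge0 => x _.
(* The lines through the base point are chosen by [below_mean] to carry at most the mean plus [d];
   integrated over a side of length [2 * r] this slack becomes [e]. *)
pose d := e / (2 * r); have d0 : 0 < d by rewrite divr_gt0// mulr_gt0.
have lr (z : R) : z - r < z + r by lra.
have LE (z : R) : z + r - (z - r) = 2 * r by lra.
rewrite -/al -/be; clearbody al be.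
have D0 y s t : c.1 - r <= s <= c.1 + r -> c.1 - r <= t <= c.1 + r ->
    (`|v (s, y) - v (t, y)|%:E <= a y)%E.
  apply: (@line_bound (fun t => v (t, y)) (fun t => partial 0 v (t, y))).
    by move=> z; apply: is_derive_line0; exact: smooth2_diff.
  by apply: continuous_line0; exact: smooth2_partial.
have D1 x s t : c.2 - r <= s <= c.2 + r -> c.2 - r <= t <= c.2 + r ->
    (`|v (x, s) - v (x, t)|%:E <= b x)%E.
  apply: (@line_bound (fun t => v (x, t)) (fun t => partial 1 v (x, t))).
    by move=> z; apply: is_derive_line1; exact: smooth2_diff.
  by apply: continuous_line1; exact: smooth2_partial.
clearbody a b.
have [y' y'J] : exists2 y : R, c.2 - r <= y <= c.2 + r & (a y <= (al / (2 * r) + d)%:E)%E.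
  have hJ : (\int[leb]_(t in J) a t <= al%:E)%E by rewrite alE.
  by have := below_mean (lr c.2) d0 ma a0 hJ; rewrite LE.
have [x' x'I] : exists2 x : R, c.1 - r <= x <= c.1 + r & (b x <= (be / (2 * r) + d)%:E)%E.
  have hI : (\int[leb]_(t in I) b t <= be%:E)%E by rewrite beE.
  by have := below_mean (lr c.1) d0 mb b0 hI; rewrite LE.
set al' := al / (2 * r) + d; set be' := be / (2 * r) + d => bx' ay'.
have al'0 : 0 <= al' by rewrite addr_ge0 ?divr_ge0 ?mulr_ge0// ltW.
have be'0 : 0 <= be' by rewrite addr_ge0 ?divr_ge0 ?mulr_ge0// ltW.
exists (v (x', y')).
pose k := v (x', y').
have B1 x y : c.1 - r <= x <= c.1 + r -> c.2 - r <= y <= c.2 + r ->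
    (`|v (x, y) - k|%:E <= b x + al'%:E)%E.
  move=> xI yJ; apply: (@le_trans _ _ (`|v (x, y) - v (x, y')|%:E + `|v (x, y') - k|%:E)%E).
    by rewrite -EFinD lee_fin ler_distD.
  by apply: leeD; [exact: D1|apply: le_trans ay'; exact: D0].
have B2 x y : c.1 - r <= x <= c.1 + r -> c.2 - r <= y <= c.2 + r ->
    (`|v (x, y) - k|%:E <= a y + be'%:E)%E.
  move=> xI yJ; apply: (@le_trans _ _ (`|v (x, y) - v (x', y)|%:E + `|v (x', y) - k|%:E)%E).
    by rewrite -EFinD lee_fin ler_distD.
  by apply: leeD; [exact: D0|apply: le_trans bx'; exact: D1].
have sw : smooth2 (fun x => v x + - k) by apply: smooth2D => //; exact: smooth2_cst.
have ml (x : R) : measurable_fun setT (fun t : R => v (x, t) - k).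
  have cl := @continuous_line1 _ _ x sw.
  exact: (continuous_measurable_fun cl).
have lw : L2on (csq c r) (fun x => v x - k) by apply: continuous_L2on; exact: smooth2_cts.
have mw2 : measurable_fun setT (fun x => (v x - k) ^+ 2).
  by apply: measurable_funX; apply: continuous_measurable2; exact: smooth2_cts.
have LI (z : R) : leb `[z - r, z + r]%classic = (2 * r)%:E.
  by rewrite lebesgue_measure_itv/= lte_fin lr -EFinB LE.
have EJ (z : R) : (\int[leb]_(_ in J) z%:E = (z * (2 * r))%:E)%E.
  by rewrite EFinM -(LI c.2); exact: integral_cst.
have EI (z : R) : (\int[leb]_(_ in I) z%:E = (z * (2 * r))%:E)%E.
  by rewrite EFinM -(LI c.1); exact: integral_cst.
rewrite -lee_fin [leLHS](_ : _ = \int[mu]_(x in csq c r) ((v x - k) ^+ 2)%:E)%E; last first.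
  by rewrite /Rintegral fineK//; apply: (@integrable_fin_num _ _ _ mu); [exact: measurable_csq|case: lw].
rewrite csqE; have [-> _] := tonelli_box mI mJ mw2 (fun x => sqr_ge0 (v x - k)).
have Ia : (\int[leb]_(y in J) (a y + be'%:E) = (al + 2 * r * be')%:E)%E.
  rewrite ge0_integralD//; last exact: measurable_funTS.
  by rewrite [in RHS]mulrC; exact: (congr2 (fun p q => (p + q)%E) alE (EJ be')).
have Ib : (\int[leb]_(x in I) (b x + al'%:E) = (be + 2 * r * al')%:E)%E.
  rewrite ge0_integralD//; last exact: measurable_funTS.
  by rewrite [in RHS]mulrC; exact: (congr2 (fun p q => (p + q)%E) beE (EI al')).
have mbI : measurable_fun I (fun x => b x + al'%:E)%E.
  by apply: emeasurable_funD => //; exact: measurable_funTS.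
have maJ : measurable_fun J (fun x => a x + be'%:E)%E.
  by apply: emeasurable_funD => //; exact: measurable_funTS.
apply: (@le_trans _ _ (\int[leb]_(x in I) ((b x + al'%:E) * (al + 2 * r * be')%:E))%E).
  apply: ge0_le_integral => //.
  - by move=> x _; apply: integral_ge0 => t _; rewrite lee_fin sqr_ge0.
  - by apply: measurable_funTS; apply: (measurable_lineint1 mJ mw2) => x; exact: sqr_ge0.
  - exact: emeasurable_funM.
  move=> x; rewrite /I/= in_itv/= => xI.
  rewrite -Ia -ge0_integralZl//; last 2 first.
  - by move=> y _; rewrite adde_ge0// lee_fin.
  - by rewrite adde_ge0// lee_fin.
  apply: ge0_le_integral => //.
  - by move=> t _; rewrite lee_fin sqr_ge0.
  - by apply: measurable_funTS; apply/measurable_EFinP; apply: measurable_funX; exact: (ml x).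
  - exact: measurable_funeM.
  move=> y; rewrite /J/= in_itv/= => yJ.
  rewrite -[(v (x, y) - k) ^+ 2]ger0_norm ?sqr_ge0// normrX expr2 EFinM.
  by apply: lee_pmul => //; [exact: B1|exact: B2].
rewrite ge0_integralZr//; last 2 first.
- by move=> y _; rewrite adde_ge0// lee_fin.
- by rewrite lee_fin addr_ge0 ?mulr_ge0// ltW.
rewrite Ib -EFinM lee_fin expr2.
have E1 : al + 2 * r * be' = al + be + e by rewrite /be' /d; field; rewrite gt_eqF.
have E2 : be + 2 * r * al' = al + be + e by rewrite /al' /d; field; rewrite gt_eqF.
by rewrite E1 E2.
Qed.

End poincare.

(** * The pointwise algebra of the Caccioppoli inequality and the cut-off functions *)

Section caccioppoli.
Context {R : realType}.
Local Notation mu := (@leb2 R).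
Implicit Types (f g v : R * R -> R).

Lemma young_mul (a b t : R) : 0 < t -> `|a * b| <= t / 2 * a ^+ 2 + (2 * t)^-1 * b ^+ 2.
Proof.
move=> t0; have h (x : R) : x * b <= t / 2 * x ^+ 2 + (2 * t)^-1 * b ^+ 2.
  rewrite -subr_ge0.
  have -> : t / 2 * x ^+ 2 + (2 * t)^-1 * b ^+ 2 - x * b = (2 * t)^-1 * (t * x - b) ^+ 2.
    by field; rewrite gt_eqF.
  by rewrite mulr_ge0 ?sqr_ge0// invr_ge0 mulr_ge0// ltW.
by rewrite ler_norml h andbT lerNl -mulNr (le_trans (h _))// sqrrN.
Qed.

(** At one point: [e], [e0], [e1] are the cut-off and its partials, [w] is v - k, [m] the gradient
    of v, [g] the weak gradient of u, [q] and [p] the gradients of eta w and eta^2 w. The third line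
    of the bound is the part with a sign after integration: the equation kills the first term,
    coercivity the second. Since [m] differs from [g], the identity leaves the bilinear error [X] in
    [m - g], paid for by the last term. *)
Lemma caccio_pointwise (gam M f e e0 e1 w0 w1 m00 m01 m10 m11 g00 g01 g10 g11
    q00 q01 q10 q11 p00 p01 p10 p11 : R) :
  0 < gam -> `|f| <= M -> 0 <= e <= 1 ->
  q00 = e0 * w0 + e * m00 -> q01 = e1 * w0 + e * m01 ->
  q10 = e0 * w1 + e * m10 -> q11 = e1 * w1 + e * m11 ->
  p00 = 2 * e * e0 * w0 + e ^+ 2 * m00 -> p01 = 2 * e * e1 * w0 + e ^+ 2 * m01 ->
  p10 = 2 * e * e0 * w1 + e ^+ 2 * m10 -> p11 = 2 * e * e1 * w1 + e ^+ 2 * m11 ->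
  gam / 4 * (e ^+ 2 * (m00 ^+ 2 + m01 ^+ 2 + m10 ^+ 2 + m11 ^+ 2)) <=
  2^-1 * (2 * (g00 * p00 + g01 * p01 + g10 * p10 + g11 * p11) +
    f * (g11 * p00 - g10 * p01 - g01 * p10 + g00 * p11))
  - (q00 ^+ 2 + q01 ^+ 2 + q10 ^+ 2 + q11 ^+ 2 + f * (q00 * q11 - q01 * q10)
     - gam * (q00 ^+ 2 + q01 ^+ 2 + q10 ^+ 2 + q11 ^+ 2))
  + (1 + gam) * ((w0 ^+ 2 + w1 ^+ 2) * (e0 ^+ 2 + e1 ^+ 2))
  + (2 + M) ^+ 2 / (4 * gam) *
    ((m00 - g00) ^+ 2 + (m01 - g01) ^+ 2 + (m10 - g10) ^+ 2 + (m11 - g11) ^+ 2).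
Proof.
move=> gam0 fM /andP[e_ge0 e_le1] q00E q01E q10E q11E p00E p01E p10E p11E.
set Q := q00 ^+ 2 + q01 ^+ 2 + q10 ^+ 2 + q11 ^+ 2.
set T := 2 * _ + f * _; set P := Q + _ - _.
set W := (w0 ^+ 2 + w1 ^+ 2) * _; set E := (m00 - g00) ^+ 2 + _ + _ + _.
have M0 : 0 <= M by rewrite (le_trans _ fM).
pose d00 := m00 - g00; pose d01 := m01 - g01; pose d10 := m10 - g10; pose d11 := m11 - g11.
pose X := 2 * (d00 * p00 + d01 * p01 + d10 * p10 + d11 * p11) +
  f * (d11 * p00 - d10 * p01 - d01 * p10 + d00 * p11).
have ident : 2^-1 * T - P = gam * Q - W - 2^-1 * X.
  by rewrite /P /Q /T /W /X /d00 /d01 /d10 /d11 q00E q01E q10E q11E p00E p01E p10E p11E; field.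
(* The bilinear form has size at most [2 + M]; with this weight in Young's inequality half of [X]
   costs only [gam / 2 * (Q + W)], and half of [gam * Q] survives. *)
pose t := gam / (2 + M); have t0 : 0 < t by rewrite divr_gt0//; lra.
pose S := p00 ^+ 2 + p01 ^+ 2 + p10 ^+ 2 + p11 ^+ 2.
pose Y := t / 2 * S + (2 * t)^-1 * E.
have Xle : X <= (2 + M) * Y.
  have Z (a b c d : R) : a ^+ 2 + b ^+ 2 + c ^+ 2 + d ^+ 2 = E ->
     `|a * p00| + `|b * p01| + `|c * p10| + `|d * p11| <= Y.
    move=> hE; rewrite /Y /S -hE; clear hE.
    have := young_mul p00 a t0; have := young_mul p01 b t0.
    have := young_mul p10 c t0; have := young_mul p11 d t0.
    by rewrite ![_ * p00]mulrC ![_ * p01]mulrC ![_ * p10]mulrC ![_ * p11]mulrC; lra.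
  have Z1 := Z d00 d01 d10 d11 erefl.
  have Z2 : `|d11 * p00| + `|d10 * p01| + `|d01 * p10| + `|d00 * p11| <= Y.
    by apply: Z; rewrite /E -/d00 -/d01 -/d10 -/d11; ring.
  have h1 : 2 * (d00 * p00 + d01 * p01 + d10 * p10 + d11 * p11) <= 2 * Y.
    rewrite ler_wpM2l// (le_trans _ Z1)//.
    have := ler_norm (d00 * p00); have := ler_norm (d01 * p01).
    by have := ler_norm (d10 * p10); have := ler_norm (d11 * p11); lra.
  have h2 : f * (d11 * p00 - d10 * p01 - d01 * p10 + d00 * p11) <= M * Y.
    rewrite (le_trans (ler_norm _))// normrM ler_pM// (le_trans _ Z2)//.
    rewrite (le_trans (ler_normD _ _))// lerD2r (le_trans (ler_normB _ _))// lerD2r.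
    exact: ler_normB.
  by rewrite /X; lra.
(* The gradient of eta^2 w is eta times the sum of the gradient of eta w and w (x) D eta, and 0 <=
   eta <= 1. *)
have SQ : S <= 2 * Q + 2 * W.
  have sq1 (m ej w p q : R) : q = ej * w + e * m -> p = 2 * e * ej * w + e ^+ 2 * m ->
      p ^+ 2 <= 2 * q ^+ 2 + 2 * (ej ^+ 2 * w ^+ 2).
    move=> qE pE; have -> : p = e * (q + ej * w) by rewrite pE qE; ring.
    rewrite exprMn; have e2 : e ^+ 2 <= 1 by rewrite expr_le1.
    rewrite (le_trans (ler_wpM2r (sqr_ge0 _) e2))// mul1r -exprMn.
    by have := sqr_ge0 (q - ej * w); nra.
  have := sq1 _ _ _ _ _ q00E p00E; have := sq1 _ _ _ _ _ q01E p01E.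
  have := sq1 _ _ _ _ _ q10E p10E; have := sq1 _ _ _ _ _ q11E p11E.
  by rewrite /S /Q /W; clear; lra.
have MQ : e ^+ 2 * (m00 ^+ 2 + m01 ^+ 2 + m10 ^+ 2 + m11 ^+ 2) <= 2 * Q + 2 * W.
  have sq1 (m ej w q : R) : q = ej * w + e * m ->
      e ^+ 2 * m ^+ 2 <= 2 * q ^+ 2 + 2 * (ej ^+ 2 * w ^+ 2).
    move=> qE; rewrite -!exprMn; have -> : e * m = q - ej * w by rewrite qE; ring.
    by have := sqr_ge0 (q + ej * w); nra.
  have := sq1 _ _ _ _ q00E; have := sq1 _ _ _ _ q01E.
  have := sq1 _ _ _ _ q10E; have := sq1 _ _ _ _ q11E.
  by rewrite /Q /W; clear; lra.
rewrite ident.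
have XY : 2^-1 * X <= gam / 2 * (Q + W) + (2 + M) ^+ 2 / (4 * gam) * E.
  have : (2 + M) * Y = gam / 2 * S + (2 + M) ^+ 2 / (2 * gam) * E.
    by rewrite /Y /t; field; rewrite !gt_eqF//; lra.
  have : (2 + M) ^+ 2 / (2 * gam) * E = 2 * ((2 + M) ^+ 2 / (4 * gam) * E).
    by field; rewrite !gt_eqF.
  have : gam / 2 * S <= gam / 2 * (2 * Q + 2 * W) by rewrite ler_wpM2l// ltW// divr_gt0.
  move: Xle; clear; lra.
have := ler_wpM2l (ltW (divr_gt0 gam0 (ltr0n R 4))) MQ.
move: XY; clear; lra.
Qed.

Lemma partial_tens (a b : R -> R) (a' b' : R) x : bsmooth a -> bsmooth b ->
  is_derive (x.1 : R) (1 : R) a a' -> is_derive (x.2 : R) (1 : R) b b' ->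
  partial 0 (tens a b) x = a' * b x.2 /\ partial 1 (tens a b) x = a x.1 * b'.
Proof.
move=> sa sb da db; have st := smooth2_tens sa sb; case: x da db => s t /= da db.
have dt : differentiable (tens a b) (s, t) by exact: smooth2_diff.
split.
  have h0 := is_derive_line0 dt.
  have h1 : is_derive s 1 (fun s => a s * b t) (b t *: a').
    have := is_deriveM da (is_derive_cst (b t) s (1 : R)).
    by rewrite scaler0 add0r.
  have := @derive_val _ _ _ _ _ _ _ h0; rewrite (@derive_val _ _ _ _ _ _ _ h1) => <-.
  by rewrite mulrC.
have h0 := is_derive_line1 dt.
have h1 : is_derive t 1 (fun t => a s * b t) (a s *: b').
  have := is_deriveM (is_derive_cst (a s) t (1 : R)) db.
  by rewrite scaler0 addr0.
by have := @derive_val _ _ _ _ _ _ _ h0; rewrite (@derive_val _ _ _ _ _ _ _ h1) => <-.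
Qed.

(** The profile H(2 + t) H(2 - t) is 1 for |t| <= 1 and 0 for |t| >= 2; the cut-off is its rescaling
    in each variable. [C] is fixed before centre and radius, as the scale-invariant constant of the
    reverse Hoelder inequality demands. *)
Lemma cutoff_exists : exists2 C : R, 0 < C & forall c (r : R), 0 < r ->
  exists eta : R * R -> R, [/\ smooth2 eta, forall x, 0 <= eta x <= 1,
    forall x, csq c r x -> eta x = 1, forall x, ~ csq c (2 * r) x -> eta x = 0 &
    forall j x, `|partial j eta x| <= C / r].
Proof.
have [H [sH H01 H0 H1]] := @step_exists R.
pose A (t : R) := H (1 * t + 2) * H (-1 * t + 2).
have sA : bsmooth A by apply: bsmoothM; exact: bsmooth_affine.
have [_ [A' [sA' dA]]] := bsmoothP sA; have [[C0 hC0] _] := bsmoothP sA'.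
have C00 : 0 <= C0 by apply: le_trans (hC0 0).
exists (C0 + 1) => [|c r r0]; first by lra.
have ri : 0 < r^-1 by rewrite invr_gt0.
pose a (s t : R) := A (r^-1 * t + - (s / r)).
have sa s : bsmooth (a s) by exact: bsmooth_affine.
have aE s t : a s t = H (2 + (t - s) / r) * H (2 - (t - s) / r).
  by rewrite /a /A; congr (H _ * H _); ring.
have a01 s t : 0 <= a s t <= 1.
  rewrite aE; have /andP[h1 h2] := H01 (2 + (t - s) / r).
  have /andP[h3 h4] := H01 (2 - (t - s) / r).
  by rewrite mulr_ge0//= mulr_ile1.
have a1 s t : `|t - s| <= r -> a s t = 1.
  rewrite ler_norml => /andP[h1 h2]; rewrite aE !H1 ?mulr1//.
    suff : (t - s) / r <= 1 by lra.
    by rewrite ler_pdivrMr// mul1r.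
  suff : - 1 <= (t - s) / r by lra.
  by rewrite ler_pdivlMr// mulN1r.
have a0 s t : 2 * r < `|t - s| -> a s t = 0.
  rewrite aE lter_normr => /orP[h|h].
    by rewrite [X in _ * X]H0 ?mulr0// subr_le0 ler_pdivlMr// ltW.
  rewrite H0 ?mul0r//; suff : 2 <= - ((t - s) / r) by lra.
  by rewrite -mulNr ler_pdivlMr// ltW.
have da (s t : R) : exists2 l : R, is_derive t 1 (a s) l & `|l| <= (C0 + 1) / r.
  exists (A' (r^-1 * t + - (s / r)) *: r^-1).
    apply: (@is_derive1_comp _ A (fun t => r^-1 * t + - (s / r))).
    have h := is_deriveD (is_deriveZ r^-1 (is_derive_id t (1 : R))) (is_derive_cst (- (s / r)) t (1 : R)).
    by apply: (is_derive_eq h); rewrite addr0; exact: mulr1.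
  rewrite normrM (gtr0_norm ri) ler_wpM2r// ?(ltW ri)// (le_trans (hC0 _))//.
  by rewrite lerDl.
exists (tens (a c.1) (a c.2)); split.
- exact: smooth2_tens.
- move=> x; have /andP[h1 h2] := a01 c.1 x.1; have /andP[h3 h4] := a01 c.2 x.2.
  by rewrite /tens mulr_ge0//= mulr_ile1.
- by move=> x [/= x1 x2]; rewrite /tens !a1 ?mulr1.
- move=> x nx; rewrite /tens; have [h1|h1] := leP `|x.1 - c.1| (2 * r); last by rewrite a0 ?mul0r.
  have [h2|h2] := leP `|x.2 - c.2| (2 * r); last by rewrite [X in _ * X]a0 ?mulr0.
  by exfalso; apply: nx.
move=> j x; have [l dl hl] := da c.1 x.1; have [l' dl' hl'] := da c.2 x.2.
have [p0 p1] := partial_tens (sa c.1) (sa c.2) dl dl'.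
have /andP[h1 h2] := a01 c.1 x.1; have /andP[h3 h4] := a01 c.2 x.2.
case: (ord2E j) => ->; [rewrite p0|rewrite p1]; rewrite normrM.
  by rewrite (ger0_norm h3) -[leRHS]mulr1 ler_pM.
by rewrite (ger0_norm h1) -[leRHS]mul1r ler_pM.
Qed.

End caccioppoli.

(** * The Caccioppoli and reverse Hoelder inequalities *)

Section reverse_hoelder.
Context {R : realType}.
Local Notation mu := (@leb2 R).
Implicit Types (f g : R * R -> R) (O S : set (R * R)).

Lemma Rintegral_subset_le (A B : set (R * R)) f : measurable A -> measurable B ->
  A `<=` B -> mu.-integrable B (EFin \o f) -> (forall x, 0 <= f x) ->
  \int[mu]_(x in A) f x <= \int[mu]_(x in B) f x.
Proof.
move=> mA mB AB iB f0.
have iA : mu.-integrable A (EFin \o f) by exact: (@integrableS _ _ _ mu B).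
rewrite -lee_fin /Rintegral !fineK; [|exact: (@integrable_fin_num _ _ _ mu)..].
apply: ge0_subset_integral => //; first exact: (measurable_int _ iB).
by move=> x _; rewrite lee_fin.
Qed.

Lemma caccio_arith (gam h a b k r s w d q e z : R) : 0 <= h -> 0 <= a -> r <= s ->
  h * s <= - (d - gam * q) + a * w + k * e -> gam * q <= d -> w <= b * z ->
  h * r <= a * b * z + k * e.
Proof.
move=> h0 a0 rs main DQ wz; have := ler_wpM2l h0 rs; have := ler_wpM2l a0 wz.
by rewrite mulrA; lra.
Qed.

(** Here [v] is any pair of smooth functions, so that eta w and eta^2 w are genuine test maps. The
    solution enters through [G] only, in the equation and in the final error. *)
Lemma caccioppoli O (G : R * R -> 'M[R]_2) f0 (M gam C r : R) c (eta : R * R -> R)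
    (v : 'I_2 -> R * R -> R) (k : 'I_2 -> R) :
  open O -> (forall i j, L2on O (fun x => G x i j)) ->
  measurable_fun setT f0 -> (forall x, `|f0 x| <= M) -> 0 < gam -> 0 <= C ->
  (forall phi, test_map O phi -> \int[mu]_(x in O)
    (2 * frobmx (G x) (cgrad phi x) + f0 x * frobmx (cofmx (G x)) (cgrad phi x)) = 0) ->
  (forall phi, test_map O phi ->
    gam * \int[mu]_(x in O) frobmx (cgrad phi x) (cgrad phi x) <=
    \int[mu]_(x in O) (frobmx (cgrad phi x) (cgrad phi x) + f0 x * \det (cgrad phi x))) ->
  csq c (2 * r) `<=` O -> 0 < r -> smooth2 eta -> (forall x, 0 <= eta x <= 1) ->
  (forall x, csq c r x -> eta x = 1) -> (forall x, ~ csq c (2 * r) x -> eta x = 0) ->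
  (forall j x, `|partial j eta x| <= C) ->
  (forall i, smooth2 (v i)) ->
  gam / 4 * \int[mu]_(x in csq c r) (partial 0 (v 0) x ^+ 2 + partial 1 (v 0) x ^+ 2 +
      partial 0 (v 1) x ^+ 2 + partial 1 (v 1) x ^+ 2) <=
  (1 + gam) * (2 * C ^+ 2) * (\int[mu]_(x in csq c (2 * r)) (v 0 x - k 0) ^+ 2 +
     \int[mu]_(x in csq c (2 * r)) (v 1 x - k 1) ^+ 2) +
  (2 + M) ^+ 2 / (4 * gam) * \int[mu]_(x in csq c (2 * r))
   ((partial 0 (v 0) x - G x 0 0) ^+ 2 + (partial 1 (v 0) x - G x 0 1) ^+ 2 +
    (partial 0 (v 1) x - G x 1 0) ^+ 2 + (partial 1 (v 1) x - G x 1 1) ^+ 2).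
Proof.
move=> oO lG mf0 f0M gam0 C0 EQ CO SO r0 seta e01 e1 e0 eC sv.
have r2 : r <= 2 * r by lra.
have g1 : 0 <= 1 + gam by lra.
pose S := csq c (2 * r); have mO := open_measurable2 oO.
have mS : measurable S by exact: measurable_csq.
pose w i x := v i x + - k i.
have sw i : smooth2 (w i) by apply: smooth2D => //; exact: smooth2_cst.
have pw i j x : partial j (w i) x = partial j (v i) x.
  rewrite partialD; [|exact: smooth2_diff..|]; last exact: smooth2_diff (smooth2_cst _).
  by rewrite (partial_cst j (- k i)) addr0.
pose psi x : 'rV[R]_2 := \row_i (eta x * w i x).
pose phi x : 'rV[R]_2 := \row_i (eta x * (eta x * w i x)).
have psiE i : vcomp psi i = fun x => eta x * w i x by apply/funext => x; rewrite /vcomp mxE.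
have phiE i : vcomp phi i = fun x => eta x * (eta x * w i x) by apply/funext => x; rewrite /vcomp mxE.
have tpsi : test_map O psi.
  move=> i; rewrite psiE; split; first exact: smooth2M.
  exists S; split => //; first exact: compact_csq.
  by move=> x nx; rewrite e0// mul0r.
have tphi : test_map O phi.
  move=> i; rewrite phiE; split; first by apply: smooth2M => //; exact: smooth2M.
  exists S; split => //; first exact: compact_csq.
  by move=> x nx; rewrite e0// mul0r.
pose q i j x := partial j (vcomp psi i) x; pose p i j x := partial j (vcomp phi i) x.
have qE i j x : q i j x = partial j eta x * w i x + eta x * partial j (v i) x.
  rewrite /q psiE partialM; [|exact: smooth2_diff..].
  by rewrite pw; ring.
have pE i j x : p i j x = 2 * eta x * partial j eta x * w i x + eta x ^+ 2 * partial j (v i) x.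
  rewrite /p phiE partialM; [|exact: smooth2_diff|apply: smooth2_diff; exact: smooth2M].
  rewrite partialM; [|exact: smooth2_diff..].
  by rewrite pw; ring.
have out0 (h : R * R -> 'rV[R]_2) i j x : (forall x, ~ S x -> vcomp h i x = 0) ->
    ~ S x -> partial j (vcomp h i) x = 0.
  by move=> h0; apply: partial_out => //; exact: closed_csq.
have q0 i j x : ~ S x -> q i j x = 0.
  by apply: out0 => y ny; rewrite psiE e0// mul0r.
have p0 i j x : ~ S x -> p i j x = 0.
  by apply: out0 => y ny; rewrite phiE e0// mul0r.
have lS h : continuous h -> L2on S h by exact: continuous_L2on.
have lq i j : L2on S (q i j).
  by apply: lS; apply: smooth2_cts; apply: smooth2_partial; case: (tpsi i).
have lp i j : L2on S (p i j).
  by apply: lS; apply: smooth2_cts; apply: smooth2_partial; case: (tphi i).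
have lg i j : L2on S (fun x => G x i j) by exact: L2onS (lG i j).
have lm i j : L2on S (partial j (v i)).
  by apply: lS; apply: smooth2_cts; exact: smooth2_partial.
have lE i j : L2on S (fun x => partial j (v i) x - G x i j) by exact: L2onB.
have mf0S : measurable_fun S f0 by exact: measurable_funTS.
have bd h : mu.-integrable S (EFin \o h) -> mu.-integrable S (EFin \o (fun x => h x * f0 x)).
  by move=> ih; exact: (integrable_bounded_on (M := M)).
pose T x := 2 * (G x 0 0 * p 0 0 x + G x 0 1 * p 0 1 x + G x 1 0 * p 1 0 x + G x 1 1 * p 1 1 x) +
    f0 x * (G x 1 1 * p 0 0 x - G x 1 0 * p 0 1 x - G x 0 1 * p 1 0 x + G x 0 0 * p 1 1 x).
pose Q x := q 0 0 x ^+ 2 + q 0 1 x ^+ 2 + q 1 0 x ^+ 2 + q 1 1 x ^+ 2.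
pose D x := Q x + f0 x * (q 0 0 x * q 1 1 x - q 0 1 x * q 1 0 x).
pose W x := (w 0 x ^+ 2 + w 1 x ^+ 2) * (partial 0 eta x ^+ 2 + partial 1 eta x ^+ 2).
pose E x := (partial 0 (v 0) x - G x 0 0) ^+ 2 + (partial 1 (v 0) x - G x 0 1) ^+ 2 +
    (partial 0 (v 1) x - G x 1 0) ^+ 2 + (partial 1 (v 1) x - G x 1 1) ^+ 2.
pose m2 x := partial 0 (v 0) x ^+ 2 + partial 1 (v 0) x ^+ 2 +
      partial 0 (v 1) x ^+ 2 + partial 1 (v 1) x ^+ 2.
have iT : mu.-integrable S (EFin \o T).
  have -> : T = (fun x =>
     2 * (G x 0 0 * p 0 0 x + G x 0 1 * p 0 1 x + G x 1 0 * p 1 0 x + G x 1 1 * p 1 1 x) +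
     (G x 1 1 * p 0 0 x - G x 1 0 * p 0 1 x - G x 0 1 * p 1 0 x + G x 0 0 * p 1 1 x) * f0 x).
    by apply/funext => x; rewrite /T [f0 x * _]mulrC.
  have I i j k' l : mu.-integrable S (EFin \o (fun x => G x i j * p k' l x)) by exact: L2onM.
  apply: integrable_addr => //.
    by apply: integrable_mulrl => //; do 3 (apply: integrable_addr => //).
  by apply: bd; apply: integrable_addr => //; do 2 (apply: integrable_subr => //).
have sqi h : L2on S h -> mu.-integrable S (EFin \o (fun x => h x ^+ 2)) by case.
have iQ : mu.-integrable S (EFin \o Q).
  by do 3 (apply: integrable_addr => //; last exact: sqi); exact: sqi.
have iD : mu.-integrable S (EFin \o D).
  have -> : D = (fun x => Q x + (q 0 0 x * q 1 1 x - q 0 1 x * q 1 0 x) * f0 x).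
    by apply/funext => x; rewrite /D [f0 x * _]mulrC.
  by apply: integrable_addr => //; apply: bd; apply: integrable_subr => //; exact: L2onM.
have iE : mu.-integrable S (EFin \o E).
  by do 3 (apply: integrable_addr => //; last exact: (sqi _ (lE _ _))); exact: (sqi _ (lE _ _)).
have im2 : mu.-integrable S (EFin \o m2).
  by do 3 (apply: integrable_addr => //; last exact: sqi); exact: sqi.
have lw i : L2on S (w i) by apply: lS; exact: smooth2_cts.
have ceta j : continuous (partial j eta) by apply: smooth2_cts; exact: smooth2_partial.
have iw : mu.-integrable S (EFin \o (fun x => w 0 x ^+ 2 + w 1 x ^+ 2)).
  by apply: integrable_addr => //; exact: sqi.
have eta2 x : partial 0 eta x ^+ 2 + partial 1 eta x ^+ 2 <= 2 * C ^+ 2.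
  have h j : partial j eta x ^+ 2 <= C ^+ 2.
    by rewrite -[leLHS]ger0_norm ?sqr_ge0// normrX lerXn2r// nnegrE.
  by have := h 0; have := h 1; lra.
have iW : mu.-integrable S (EFin \o W).
  apply: (integrable_bounded_on (M := 2 * C ^+ 2)) => //.
    by apply: measurable_funTS; apply: measurable_funD; apply: measurable_funX; exact: continuous_measurable2.
  by move=> x _; rewrite ger0_norm ?addr_ge0 ?sqr_ge0.
have T0 : \int[mu]_(x in S) T x = 0.
  rewrite -[RHS](EQ phi tphi) Rintegral_zero_out; last by move=> x nx; rewrite /T !p0//; ring.
  rewrite [in RHS]Rintegral_zero_out; last first.
    move=> x nx; rewrite frobmx2E cofmx_frob2E !mxE.
    have nS : ~ S x by move=> /SO.
    by rewrite -!/(p _ _ _) !p0//; ring.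
  by apply: eq_Rintegral => x _; rewrite frobmx2E cofmx_frob2E !mxE.
have DQ : gam * \int[mu]_(x in S) Q x <= \int[mu]_(x in S) D x.
  have := CO psi tpsi; rewrite Rintegral_zero_out; last first.
    move=> x nx; have nS : ~ S x by move=> /SO.
    by rewrite frobmx2E !mxE -!/(q _ _ _) !q0//; ring.
  rewrite [X in _ <= X -> _]Rintegral_zero_out; last first.
    move=> x nx; have nS : ~ S x by move=> /SO.
    by rewrite frobmx2E det2E !mxE -!/(q _ _ _) !q0//; ring.
  rewrite (@Rintegral_zero_out _ S Q); last by move=> x nx; rewrite /Q !q0//; ring.
  rewrite (@Rintegral_zero_out _ S D); last by move=> x nx; rewrite /D /Q !q0//; ring.
  have -> : (fun x => frobmx (cgrad psi x) (cgrad psi x)) = Q.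
    by apply/funext => x; rewrite frobmx2E !mxE /Q !expr2.
  have -> // : (fun x => frobmx (cgrad psi x) (cgrad psi x) + f0 x * \det (cgrad psi x)) = D.
  by apply/funext => x; rewrite frobmx2E det2E !mxE /D /Q !expr2.
have ptw x : S x -> gam / 4 * (eta x ^+ 2 * m2 x) <=
    2^-1 * T x - (D x - gam * Q x) + (1 + gam) * W x + (2 + M) ^+ 2 / (4 * gam) * E x.
  move=> _; exact: (caccio_pointwise _ _ _ _ gam0 (f0M x) (e01 x) (qE 0 0 x) (qE 0 1 x)
    (qE 1 0 x) (qE 1 1 x) (pE 0 0 x) (pE 0 1 x) (pE 1 0 x) (pE 1 1 x)).
have iem : mu.-integrable S (EFin \o (fun x => eta x ^+ 2 * m2 x)).
  under eq_fun do rewrite mulrC.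
  apply: (integrable_bounded_on (M := 1)) => //.
    by apply: measurable_funTS; apply: measurable_funX; apply: continuous_measurable2; exact: smooth2_cts.
  by move=> x _; have /andP[h1 h2] := e01 x; rewrite ger0_norm ?sqr_ge0// expr_le1.
have ieta : mu.-integrable S (EFin \o (fun x => gam / 4 * (eta x ^+ 2 * m2 x))).
  exact: integrable_mulrl.
have iDQ : mu.-integrable S (EFin \o (fun x => D x - gam * Q x)).
  by apply: integrable_subr => //; exact: integrable_mulrl.
have i1 : mu.-integrable S (EFin \o (fun x => 2^-1 * T x - (D x - gam * Q x))).
  by apply: integrable_subr => //; exact: integrable_mulrl.
have i2 : mu.-integrable S (EFin \o (fun x => 2^-1 * T x - (D x - gam * Q x) + (1 + gam) * W x)).
  by apply: integrable_addr => //; exact: integrable_mulrl.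
have i3 : mu.-integrable S (EFin \o (fun x => 2^-1 * T x - (D x - gam * Q x) + (1 + gam) * W x +
    (2 + M) ^+ 2 / (4 * gam) * E x)).
  by apply: integrable_addr => //; exact: integrable_mulrl.
have := @le_Rintegral _ _ _ mu S _ _ mS ieta i3 ptw.
rewrite RintegralD//; last exact: integrable_mulrl.
rewrite RintegralD//; last exact: integrable_mulrl.
rewrite RintegralB//; last exact: integrable_mulrl.
rewrite (@RintegralB _ _ _ mu S D _ mS iD); last exact: integrable_mulrl.
rewrite !RintegralZl// T0 mulr0 sub0r => main.
have Wle : \int[mu]_(x in S) W x <= 2 * C ^+ 2 * (\int[mu]_(x in S) (w 0 x ^+ 2) + \int[mu]_(x in S) (w 1 x ^+ 2)).
  rewrite -RintegralD//; [|exact: sqi..].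
  rewrite -RintegralZl//; apply: le_Rintegral => //; first exact: integrable_mulrl.
  by move=> x _; rewrite /W mulrC ler_wpM2r// addr_ge0 ?sqr_ge0.
have mle : \int[mu]_(x in csq c r) m2 x <= \int[mu]_(x in S) (eta x ^+ 2 * m2 x).
  have -> : \int[mu]_(x in csq c r) m2 x = \int[mu]_(x in csq c r) (eta x ^+ 2 * m2 x).
    by apply: eq_Rintegral => x /set_mem cx; rewrite e1// expr1n mul1r.
  apply: Rintegral_subset_le => //; first exact: measurable_csq.
    exact: csqS.
  by move=> x; rewrite mulr_ge0 ?sqr_ge0// !addr_ge0 ?sqr_ge0.
have g4 : 0 <= gam / 4 by rewrite divr_ge0// ltW.
exact: (caccio_arith g4 g1 mle main DQ Wle).
Qed.

(* Letting the approximation parameter [t] go to zero. *)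
Lemma le_limit_quadratic (X A B N kp : R) : 0 <= A -> 0 <= B -> 0 <= N -> 0 <= kp ->
  (forall t, 0 < t -> t <= 1 -> X <= A * (N + kp * t) ^+ 2 + B * t ^+ 2) -> X <= A * N ^+ 2.
Proof.
move=> A0 B0 N0 k0 H; apply/ler_addgt0Pr => e e0.
pose L := A * (2 * N * kp + kp ^+ 2) + B.
have L0 : 0 <= L by rewrite addr_ge0// mulr_ge0// addr_ge0 ?sqr_ge0// !mulr_ge0.
pose t := Num.min 1 (e / (L + 1)).
have t0 : 0 < t by rewrite lt_min ltr01 divr_gt0// ltr_wpDl.
have t1 : t <= 1 by rewrite ge_min lexx.
have tL : L * t <= e.
  apply: (@le_trans _ _ ((L + 1) * t)); first by rewrite ler_wpM2r ?(ltW t0)// lerDl.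
  have : t <= e / (L + 1) by rewrite ge_min lexx orbT.
  by rewrite ler_pdivlMr ?ltr_wpDl// mulrC.
have t2 : t ^+ 2 <= t by rewrite expr2 ler_piMr// ltW.
apply: (le_trans (H t t0 t1)); apply: le_trans (_ : A * N ^+ 2 + L * t <= _); last by rewrite lerD2l.
have h1 : B * t ^+ 2 <= B * t by rewrite ler_wpM2l.
have h2 : A * (kp ^+ 2 * t ^+ 2) <= A * (kp ^+ 2 * t) by rewrite !ler_wpM2l ?sqr_ge0.
have -> : A * (N + kp * t) ^+ 2 = A * N ^+ 2 + A * (2 * N * kp) * t + A * (kp ^+ 2 * t ^+ 2) by ring.
have -> : A * N ^+ 2 + L * t = A * N ^+ 2 + A * (2 * N * kp) * t + A * (kp ^+ 2 * t) + B * t by rewrite /L; ring.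
by lra.
Qed.

(** The entrywise l^1 norm: its integral splits into the four L^1 norms that the Poincare inequality
    produces. *)
Definition gnorm (A : 'M[R]_2) : R := `|A 0 0| + `|A 0 1| + `|A 1 0| + `|A 1 1|.

Lemma gnorm_ge0 A : 0 <= gnorm A.
Proof. by rewrite /gnorm !addr_ge0. Qed.

Lemma sqr_sum4_le (a b c d a' b' c' d' : R) :
  (`|a| + `|b| + `|c| + `|d|) ^+ 2 <= 8 * (a' ^+ 2 + b' ^+ 2 + c' ^+ 2 + d' ^+ 2) +
   8 * ((a' - a) ^+ 2 + (b' - b) ^+ 2 + (c' - c) ^+ 2 + (d' - d) ^+ 2).
Proof.
have h (x y z w : R) : (x + y + z + w) ^+ 2 <= 4 * (x ^+ 2 + y ^+ 2 + z ^+ 2 + w ^+ 2).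
  have := sqr_ge0 (x - y); have := sqr_ge0 (x - z); have := sqr_ge0 (x - w).
  have := sqr_ge0 (y - z); have := sqr_ge0 (y - w); have := sqr_ge0 (z - w).
  nra.
have n2 (x y : R) : `|x| ^+ 2 <= 2 * y ^+ 2 + 2 * (y - x) ^+ 2.
  by rewrite -normrX ger0_norm ?sqr_ge0//; have := sqr_ge0 (2 * y - x); nra.
apply: (le_trans (h _ _ _ _)).
have := n2 a a'; have := n2 b b'; have := n2 c c'; have := n2 d d'.
lra.
Qed.

(** Young's inequality in place of Cauchy-Schwarz: |m| <= |g| + t/2 + (m - g)^2/(2t), where the last
    term integrates to at most t/2. *)
Lemma Rintegral_norm_le (S : set (R * R)) (m g : R * R -> R) (t L : R) : measurable S ->
  mu S = L%:E -> L2on S m -> L2on S g -> 0 < t ->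
  \int[mu]_(x in S) (m x - g x) ^+ 2 <= t ^+ 2 ->
  \int[mu]_(x in S) `|m x| <= \int[mu]_(x in S) `|g x| + t * (L / 2 + 2^-1).
Proof.
move=> mS SL lm lg t0 h.
have fS : (mu S < +oo)%E by rewrite SL ltry.
have im := L2on_int mS fS lm; have ig := L2on_int mS fS lg.
have i1 : mu.-integrable S (EFin \o cst 1).
  apply/integrableP; split; first by apply/measurable_EFinP; exact: measurable_cst.
  rewrite (_ : (fun x => `|(EFin \o _) x|)%E = cst 1%:E); last first.
    by apply/funext => x /=; rewrite normr1.
  by rewrite integral_cst// mul1e.
have i2 : mu.-integrable S (EFin \o (fun x => (m x - g x) ^+ 2)) by case: (L2onB mS lm lg).
have j1 := integrable_normr ig.
have j2 : mu.-integrable S (EFin \o (fun x => t / 2 * cst 1 x)) by exact: integrable_mulrl.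
have j3 : mu.-integrable S (EFin \o (fun x => (2 * t)^-1 * (m x - g x) ^+ 2)) by exact: integrable_mulrl.
have := @le_Rintegral _ _ _ mu S (fun x => `|m x|)
  (fun x => `|g x| + t / 2 * cst 1 x + (2 * t)^-1 * (m x - g x) ^+ 2) mS.
have j12 : mu.-integrable S (EFin \o (fun x => `|g x| + t / 2 * cst 1 x)) by exact: integrable_addr.
move=> /(_ (integrable_normr im)) H.
have j123 : mu.-integrable S (EFin \o (fun x => `|g x| + t / 2 * cst 1 x + (2 * t)^-1 * (m x - g x) ^+ 2)).
  exact: integrable_addr.
move: H => /(_ j123).
have P x : S x -> `|m x| <= `|g x| + t / 2 * cst 1 x + (2 * t)^-1 * (m x - g x) ^+ 2.
  move=> _; have := young_mul 1 (m x - g x) t0; rewrite mul1r expr1n /=.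
  by have := ler_distD (g x) (m x) 0; rewrite !subr0; lra.
move=> /(_ P) /le_trans; apply.
rewrite RintegralD// RintegralD// -addrA lerD2l !RintegralZl// Rintegral_cst// mul1r.
have -> : fine (mu S) = L by rewrite SL.
have : (2 * t)^-1 * \int[mu]_(x in S) (m x - g x) ^+ 2 <= (2 * t)^-1 * t ^+ 2.
  by rewrite ler_wpM2l// invr_ge0 mulr_ge0// ltW.
have -> : (2 * t)^-1 * t ^+ 2 = t / 2 by field; rewrite gt_eqF.
move: (\int[mu]_(x in S) _) => I; clear; lra.
Qed.

(** In 64, the factor 8 comes from [sqr_sum4_le], 4 from dividing by [gam / 4], and 2 from the two
    partials of the cut-off. *)
Lemma rh_arith (gam C r M N k4 t X m2 P0 P1 E : R) : 0 < gam ->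
  X <= 8 * m2 + 8 * (4 * t ^+ 2) -> E <= 4 * t ^+ 2 ->
  gam / 4 * m2 <= (1 + gam) * (2 * (C / r) ^+ 2) * (P0 + P1) + (2 + M) ^+ 2 / (4 * gam) * E ->
  P0 + P1 <= (N + k4 * t) ^+ 2 ->
  X <= 64 / gam * (1 + gam) * C ^+ 2 / r ^+ 2 * (N + k4 * t) ^+ 2 +
       (32 * (2 + M) ^+ 2 / gam ^+ 2 + 32) * t ^+ 2.
Proof.
move=> g0 hX hE hm hP.
have g4 : 0 <= 32 / gam by rewrite divr_ge0// ltW.
have h1 : 8 * m2 <= 32 / gam * ((1 + gam) * (2 * (C / r) ^+ 2) * (P0 + P1) + (2 + M) ^+ 2 / (4 * gam) * E).
  rewrite (le_trans _ (ler_wpM2l g4 hm))// le_eqVlt; apply/orP; left; apply/eqP.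
  by field; rewrite gt_eqF.
have a0 : 0 <= (1 + gam) * (2 * (C / r) ^+ 2) by rewrite mulr_ge0 ?addr_ge0 ?(ltW g0)// mulr_ge0// sqr_ge0.
have b0 : 0 <= (2 + M) ^+ 2 / (4 * gam) by rewrite divr_ge0 ?sqr_ge0// mulr_ge0// ltW.
have h2 := lerD (ler_wpM2l a0 hP) (ler_wpM2l b0 hE).
have h3 := ler_wpM2l g4 h2.
apply: (le_trans hX); rewrite -lerBrDr; apply: (le_trans h1); apply: (le_trans h3).
rewrite le_eqVlt; apply/orP; left; apply/eqP; rewrite expr_div_n.
set y := C ^+ 2 / r ^+ 2; rewrite -[64 / gam * _ * _ / _]mulrA -/y.
by field; rewrite gt_eqF.
Qed.

Lemma sqr_add_le (a b n : R) : 0 <= a -> 0 <= b -> a + b <= n -> a ^+ 2 + b ^+ 2 <= n ^+ 2.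
Proof.
move=> a0 b0 h; apply: (@le_trans _ _ ((a + b) ^+ 2)); last first.
  by rewrite lerXn2r// nnegrE ?addr_ge0// (le_trans _ h)// addr_ge0.
by have := mulr_ge0 a0 b0; rewrite sqrrD; lra.
Qed.

(** Poincare on the square of radius [2 * r] bounds the zero-order term of the Caccioppoli
    inequality. The outer radius [3 * r] leaves room to mollify. All errors are controlled by the
    approximation parameter [t], and [le_limit_quadratic] removes them. *)
Lemma reverse_hoelder (M gam : R) : 0 <= M -> 0 < gam -> exists2 K : R, 0 < K &
  forall O u f0, open O -> H1 O u ->
  measurable_fun setT f0 -> (forall x, `|f0 x| <= M) ->
  (forall phi, test_map O phi -> \int[mu]_(x in O)
    (2 * frobmx (wgrad O u x) (cgrad phi x) +
     f0 x * frobmx (cofmx (wgrad O u x)) (cgrad phi x)) = 0) ->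
  (forall phi, test_map O phi ->
    gam * \int[mu]_(x in O) frobmx (cgrad phi x) (cgrad phi x) <=
    \int[mu]_(x in O) (frobmx (cgrad phi x) (cgrad phi x) + f0 x * \det (cgrad phi x))) ->
  forall c r, 0 < r -> csq c (3 * r) `<=` O ->
  \int[mu]_(x in csq c r) gnorm (wgrad O u x) ^+ 2 <=
    K / r ^+ 2 * (\int[mu]_(x in csq c (2 * r)) gnorm (wgrad O u x)) ^+ 2.
Proof.
move=> M0 gam0; have [C C0 cut] := @cutoff_exists R.
have K0 : 0 < 64 / gam * (1 + gam) * C ^+ 2.
  by rewrite mulr_gt0 ?exprn_gt0// mulr_gt0 ?divr_gt0// addr_gt0.
exists (64 / gam * (1 + gam) * C ^+ 2) => //.
move=> O u f0 oO hu mf0 f0M EQ CO c r r0 cO.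
have mO := open_measurable2 oO; have [_ _ lG] := H1_wgrad oO hu.
have r2 : 0 < 2 * r by rewrite mulr_gt0.
have r23 : 2 * r < 3 * r by rewrite ltr_pM2r//; lra.
have rr2 : r <= 2 * r by lra.
pose S := csq c (2 * r); pose S1 := csq c r.
have mS : measurable S by exact: measurable_csq.
have mS1 : measurable S1 by exact: measurable_csq.
have SO : S `<=` O by apply: subset_trans cO; apply: csqS; exact: ltW.
have S1S : S1 `<=` S by exact: csqS.
pose G := wgrad O u.
have lGS i j : L2on S (fun x => G x i j) by exact: L2onS (lG i j).
have iG i j : mu.-integrable S (EFin \o (fun x => `|G x i j|)).
  by apply: integrable_normr => //; apply: L2on_int => //; exact: leb2_csq_fin.
pose N i j := \int[mu]_(x in S) `|G x i j|.
have NE : \int[mu]_(x in S) gnorm (G x) = N 0 0 + N 0 1 + (N 1 0 + N 1 1).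
  rewrite /gnorm RintegralD//; last by apply: integrable_addr => //; exact: integrable_addr.
  rewrite RintegralD//; last exact: integrable_addr.
  by rewrite RintegralD// -addrA.
have N0 i j : 0 <= N i j by exact: Rintegral_ge0.
have SL : mu S = (4 * (2 * r) ^+ 2)%:E by apply: leb2_csq; exact: ltW.
(* [L] is the area of [S]. Each of the four gradient entries costs [t * (L / 2 + 2^-1)], and the
   Poincare inequalities of the two components cost a slack [t] each. *)
pose L := 4 * (2 * r) ^+ 2; pose k4 := 4 * (L / 2 + 2^-1) + 2.
have L0 : 0 <= L by rewrite mulr_ge0// sqr_ge0.
have k40 : 0 <= k4 by rewrite /k4; lra.
have [eta [seta e01 e1 e0 eC]] := cut c r r0.
have Cr : 0 <= C / r by rewrite divr_ge0// ltW.
apply: (@le_limit_quadratic _ _ (32 * (2 + M) ^+ 2 / gam ^+ 2 + 32) _ k4) => //.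
- by apply: divr_ge0; [exact: ltW|exact: sqr_ge0].
- by apply: addr_ge0 => //; apply: divr_ge0; [apply: mulr_ge0 => //|]; exact: sqr_ge0.
- by rewrite NE !addr_ge0.
move=> t t0 t1; have t20 : 0 < t ^+ 2 by rewrite exprn_gt0.
have /choice[v hv] i := smooth_approx i oO hu cO r23 t20.
have sv i : smooth2 (v i) by case: (hv i).
have vE i j : \int[mu]_(x in S) (partial j (v i) x - G x i j) ^+ 2 <= t ^+ 2 by case: (hv i).
have /choice[k hk] i := @poincare R (v i) c (2 * r) t (sv i) r2 t0.
have lm i j : L2on S (partial j (v i)).
  by apply: continuous_L2on; apply: smooth2_cts; exact: smooth2_partial.
have lE i j : mu.-integrable S (EFin \o (fun x => (partial j (v i) x - G x i j) ^+ 2)).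
  by case: (L2onB mS (lm i j) (lGS i j)).
have DN i j : \int[mu]_(x in S) `|partial j (v i) x| <= N i j + t * (L / 2 + 2^-1).
  exact: Rintegral_norm_le (vE i j).
pose P i := \int[mu]_(x in S) (v i x - k i) ^+ 2.
have D0 i j : 0 <= \int[mu]_(x in S) `|partial j (v i) x| by exact: Rintegral_ge0.
have PE : P 0 + P 1 <= (\int[mu]_(x in S) gnorm (G x) + k4 * t) ^+ 2.
  apply: (le_trans (lerD (hk 0) (hk 1))); apply: sqr_add_le.
  - by rewrite !addr_ge0// ltW.
  - by rewrite !addr_ge0// ltW.
  rewrite NE; have := DN 0 0; have := DN 0 1; have := DN 1 0; have := DN 1 1.
  rewrite /k4; move: (N 0 0) (N 0 1) (N 1 0) (N 1 1) => n1 n2 n3 n4.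
  move: (\int[mu]_(x in S) `|partial 0 (v 0) x|) (\int[mu]_(x in S) `|partial 1 (v 0) x|) => d1 d2.
  move: (\int[mu]_(x in S) `|partial 0 (v 1) x|) (\int[mu]_(x in S) `|partial 1 (v 1) x|) => d3 d4.
  clear; nra.
have cacc := caccioppoli k oO lG mf0 f0M gam0 Cr EQ CO SO r0 seta e01 e1 e0 eC sv.
pose E4 x := (partial 0 (v 0) x - G x 0 0) ^+ 2 + (partial 1 (v 0) x - G x 0 1) ^+ 2 +
    (partial 0 (v 1) x - G x 1 0) ^+ 2 + (partial 1 (v 1) x - G x 1 1) ^+ 2.
pose m2 x := partial 0 (v 0) x ^+ 2 + partial 1 (v 0) x ^+ 2 +
      partial 0 (v 1) x ^+ 2 + partial 1 (v 1) x ^+ 2.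
have iE2 : mu.-integrable S (EFin \o (fun x => (partial 0 (v 0) x - G x 0 0) ^+ 2 + (partial 1 (v 0) x - G x 0 1) ^+ 2)).
  by apply: integrable_addr.
have iE3 : mu.-integrable S (EFin \o (fun x => (partial 0 (v 0) x - G x 0 0) ^+ 2 + (partial 1 (v 0) x - G x 0 1) ^+ 2 + (partial 0 (v 1) x - G x 1 0) ^+ 2)).
  by apply: integrable_addr.
have iE4 : mu.-integrable S (EFin \o E4) by apply: integrable_addr.
have im2 : mu.-integrable S (EFin \o m2).
  have sq2 i j : mu.-integrable S (EFin \o (fun x => partial j (v i) x ^+ 2)) by case: (lm i j).
  by do 3 (apply: integrable_addr => //).
have E4t : \int[mu]_(x in S) E4 x <= 4 * t ^+ 2.
  rewrite RintegralD// RintegralD// RintegralD//.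
  have := vE 0 0; have := vE 0 1; have := vE 1 0; have := vE 1 1.
  move: (\int[mu]_(x in S) _) (\int[mu]_(x in S) _) (\int[mu]_(x in S) _) (\int[mu]_(x in S) _).
  by move: (t ^+ 2) => t2 a1 a2 a3 a4; clear; lra.
apply: (rh_arith gam0 _ E4t cacc PE).
have lg : L2on S (fun x => gnorm (G x)).
  have n2 i j : L2on S (fun x => `|G x i j|).
    have [mG iG2] := lGS i j; split; first exact: measurableT_comp.
    by under eq_fun do rewrite -normrX ger0_norm ?sqr_ge0//.
  by apply: L2onD => //; apply: L2onD => //; exact: L2onD.
have ig2 : mu.-integrable S1 (EFin \o (fun x => gnorm (G x) ^+ 2)).
  by apply: (@integrableS _ _ _ mu S) => //; case: lg.
have im21 : mu.-integrable S1 (EFin \o (fun x => 8 * m2 x)).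
  by apply: integrable_mulrl => //; exact: (@integrableS _ _ _ mu S).
have iE41 : mu.-integrable S1 (EFin \o (fun x => 8 * E4 x)).
  by apply: integrable_mulrl => //; exact: (@integrableS _ _ _ mu S).
apply: (@le_trans _ _ (\int[mu]_(x in S1) (8 * m2 x + 8 * E4 x))).
  apply: le_Rintegral => //; first exact: integrable_addr.
  by move=> x _; exact: sqr_sum4_le.
rewrite RintegralD// RintegralZl//; last exact: (@integrableS _ _ _ mu S).
rewrite [X in _ + X]RintegralZl//; last exact: (@integrableS _ _ _ mu S).
rewrite lerD2l ler_wpM2l//; apply: le_trans E4t.
apply: Rintegral_subset_le => //.
by move=> x; rewrite !addr_ge0 ?sqr_ge0.
Qed.

End reverse_hoelder.

(** * A weak form of Lebesgue's differentiation theorem *)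

Section differentiation.
Context {R : realType}.
Local Notation mu := (@leb2 R).
Implicit Types (f g h : R * R -> R).

Definition boxw (r : R) (z : R * R) : R := \1_(csq 0 r) z / (4 * r ^+ 2).

Lemma boxw_props (r : R) : 0 < r -> [/\ measurable_fun setT (boxw r), forall z, 0 <= boxw r z,
  forall z, ~ sq 0 (2 * r) z -> boxw r z = 0 & (\int[mu]_z (boxw r z)%:E = 1)%E].
Proof.
move=> r0; have mc : measurable (csq 0 r) by exact: measurable_csq.
have m1 : measurable_fun setT (\1_(csq 0 r) : R * R -> R) by exact: measurable_indic.
have q0 : 0 < 4 * r ^+ 2 by rewrite mulr_gt0// exprn_gt0.
split.
- exact: measurable_funM.
- by move=> z; rewrite /boxw divr_ge0// ltW.
- move=> z nz; rewrite /boxw indicE memNset ?mul0r// => -[z1 z2]; apply: nz; split => /=; lra.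
- transitivity (\int[mu]_z ((4 * r ^+ 2)^-1%:E * (\1_(csq 0 r) z)%:E))%E.
    by apply: eq_integral => z _; rewrite -EFinM mulrC.
  have -> : (\int[mu]_z ((4 * r ^+ 2)^-1%:E * (\1_(csq 0 r) z)%:E) =
     (4 * r ^+ 2)^-1%:E * \int[mu]_z (\1_(csq 0 r) z)%:E)%E.
    apply: ge0_integralZl => //; first exact/measurable_EFinP.
    by rewrite lee_fin invr_ge0 ltW.
  have -> : (\int[mu]_z (\1_(csq 0 r) z)%:E = (4 * r ^+ 2)%:E)%E.
    by rewrite integral_indic// setIT; apply: leb2_csq; exact: ltW.
  by rewrite -EFinM mulVf// gt_eqF.
Qed.

Lemma boxw_avg h (r : R) x : 0 < r -> mu.-integrable setT (EFin \o h) ->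
  mu.-integrable setT (EFin \o (fun z => h (tr x z) * boxw r z)) /\
  \int[mu]_z (h (tr x z) * boxw r z) = (\int[mu]_(z in csq x r) h z) / (4 * r ^+ 2).
Proof.
move=> r0 ih; have [mb b0 bout b1] := boxw_props r0.
pose F z := (h \_ (csq x r)) z / (4 * r ^+ 2).
have mx : measurable (csq x r) by exact: measurable_csq.
have ihx : mu.-integrable setT (EFin \o (h \_ (csq x r))).
  rewrite -restrict_EFin; apply/(@integrable_mkcond _ _ _ mu _ (EFin \o h) mx).
  exact: (@integrableS _ _ _ mu setT).
have iF : mu.-integrable setT (EFin \o F) by exact: integrable_mulrr.
have E z : h (tr x z) * boxw r z = F (tr x z).
  have ce : (z \in csq 0 r) = (tr x z \in csq x r).
    apply/idP/idP => /set_mem[/= h1 h2]; apply/mem_set; split => /=; move: h1 h2;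
      by rewrite ?subr0 ?addrK.
  by rewrite /F /boxw patchE indicE ce; case: ifP => _; rewrite ?mul1r// !(mul0r, mulr0).
split.
  have -> : (fun z => h (tr x z) * boxw r z) = F \o tr x by apply/funext => z; rewrite E.
  exact: (integrable_tr x iF).
transitivity (\int[mu]_z F z).
  rewrite /Rintegral -(integral_tr x iF); congr fine; apply: eq_integral => z _.
  by rewrite E.
by rewrite RintegralZr// [in RHS]Rintegral_mkcond.
Qed.

(** No maximal function is involved. Where the conclusion fails by 1/(m+1), the mean over every
    dyadic square differs from h(x) by at least that much. Continuity of translations makes the L^1
    distance between [h] and its means small at a small scale, and Chebyshev's inequality at that
    single scale bounds the exceptional set by any [e]. *)
Lemma weak_differentiation h (k : R) : mu.-integrable setT (EFin \o h) ->
  (forall x, ~ csq 0 k x -> h x = 0) ->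
  {ae mu, forall x, forall q : R,
    (forall n, \int[mu]_(z in csq x (2^-1 ^+ n)) h z <= q * (4 * (2^-1 ^+ n) ^+ 2)) -> h x <= q}.
Proof.
move=> ih h0.
have mh : measurable_fun setT h by apply/measurable_EFinP; exact: (measurable_int _ ih).
pose N (m : nat) := [set x | exists2 q : R, (forall n, \int[mu]_(z in csq x (2^-1 ^+ n)) h z <= q * (4 * (2^-1 ^+ n) ^+ 2)) & q + m.+1%:R^-1 <= h x].
have cover m (e : R) : 0 < e -> exists U : set (R * R), [/\ measurable U, N m `<=` U & (mu U <= e%:E)%E].
  move=> e0; have e1 : 0 < e / m.+1%:R by rewrite divr_gt0.
  have [d d0 H] := tcont_L1 ih h0 e1.
  have [n _ /(_ n (leqnn n)) /= nd] := @exp2_lt R (d / 2) ltac:(lra).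
  set r := 2^-1 ^+ n in nd; have r0 : 0 < r by rewrite exprn_gt0.
  have [mb b0 bout b1] := boxw_props r0.
  have [|||mT iT] := @weighted_tonelli _ h (boxw r) Num.norm (2 * r) (e / m.+1%:R) mh _ _ mb b0 bout b1 (ltW e1).
  - exact: normr_measurable.
  - by [].
  - by move=> a a1 a2; apply: H; lra.
  set T := (fun x => _) in mT.
  have T0 x : (0 <= T x)%E by apply: integral_ge0 => z _; rewrite lee_fin mulr_ge0.
  exists [set x | (m.+1%:R^-1%:E <= T x)%E]; split.
  - have -> : [set x | (m.+1%:R^-1%:E <= T x)%E] = setT `&` T @^-1` `[m.+1%:R^-1%:E, +oo[%classic.
      by rewrite setTI; apply/seteqP; split => x /=; rewrite in_itv/= andbT.
    by apply: mT => //; exact: emeasurable_itv.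
  - move=> x [q hq qh] /=; have [i1 E1] := boxw_avg x r0 ih.
    have ib : mu.-integrable setT (EFin \o boxw r).
      apply/integrableP; split; first exact/measurable_EFinP.
      by under eq_integral do rewrite /= ger0_norm//; rewrite b1 ltry.
    have I1 : \int[mu]_z boxw r z = 1 by rewrite /Rintegral b1.
    have i2 : mu.-integrable setT (EFin \o (fun z => (h (tr x z) - h x) * boxw r z)).
      under eq_fun do rewrite mulrBl; apply: integrable_subr => //; exact: integrable_mulrl.
    have E2 : \int[mu]_z ((h (tr x z) - h x) * boxw r z) = \int[mu]_z (h (tr x z) * boxw r z) - h x.
      under eq_Rintegral do rewrite mulrBl.
      rewrite RintegralB//; last exact: integrable_mulrl.
      by rewrite RintegralZl// I1 mulr1.
    have avg : \int[mu]_z (h (tr x z) * boxw r z) <= q.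
      by rewrite E1 ler_pdivrMr ?mulr_gt0 ?exprn_gt0//; exact: hq.
    have m2 : measurable_fun setT (EFin \o (fun z => (h (tr x z) - h x) * boxw r z)) := measurable_int _ i2.
    apply: (@le_trans _ _ `|\int[mu]_z ((h (tr x z) - h x) * boxw r z)%R|%:E).
      rewrite lee_fin E2 -normrN; apply: le_trans (ler_norm _); rewrite opprB lerBrDr.
      by apply: le_trans qh; rewrite addrC lerD2r.
    rewrite EFin_normr_Rintegral//.
    apply: (le_trans (le_abse_integral mu measurableT m2)).
    rewrite le_eqVlt; apply/orP; left; apply/eqP; apply: eq_integral => z _ /=.
    by rewrite normrM (ger0_norm (b0 _)).
  - pose i := m.+1%:R^-1 : R; have i0 : 0 < i by rewrite invr_gt0.
    have := @le_integral_comp_abse _ _ _ mu setT measurableT T i id (@measurable_id _ _ setT)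
      (fun r => id) (fun _ _ _ _ => id) mT i0.
    have -> : (\int[mu]_x id `|T x| = \int[mu]_x T x)%E.
      by apply: eq_integral => x _ /=; rewrite gee0_abs.
    have -> : setT `&` [set x | (i%:E <= `|T x|)%E] = [set x | (i%:E <= T x)%E].
      by rewrite setTI; apply/seteqP; split => x /=; rewrite gee0_abs.
    move=> /le_trans /(_ iT); rewrite /id.
    rewrite muleC -lee_pdivlMr// => /le_trans; apply.
    by rewrite /i invrK -EFinM divfK.
have neg m : mu.-negligible (N m).
  have /choice[U hU] j := cover m j.+1%:R^-1 ltac:(by rewrite invr_gt0).
  exists (\bigcap_j U j); split.
  - by apply: bigcap_measurableType => j _; case: (hU j).
  - apply/eqP; rewrite eq_le measure_ge0 andbT; apply/lee_addgt0Pr => e e0; rewrite add0e.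
    have [j hj] : exists j : nat, (j.+1%:R^-1 : R) < e.
      exists (Num.truncn e^-1); rewrite -[ltRHS]invrK ltf_pV2 ?posrE ?invr_gt0//.
      exact: truncnS_gt.
    apply: (@le_trans _ _ (mu (U j))).
      apply: le_measure; rewrite ?inE.
      + by apply: bigcap_measurableType => i _; case: (hU i).
      + by case: (hU j).
      + by move=> x; apply.
    have [_ _ hj2] := hU j; apply: (le_trans hj2); rewrite lee_fin; exact: ltW.
  - by move=> x Nx j _; have [_ + _] := hU j; apply.
apply: (@negligibleS _ _ _ mu (\bigcup_m N m)); last exact: negligible_bigcup.
move=> x /= /existsNP[q /not_implyP[hq /negP]]; rewrite -ltNge => qh.
exists (Num.truncn (h x - q)^-1) => //; exists q => //.
rewrite -lerBrDl -[leRHS]invrK lef_pV2 ?posrE ?invr_gt0 ?subr_gt0//.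
by rewrite ltW// truncnS_gt.
Qed.

End differentiation.

(** * Passing to the limit in integrals of eventually constant sequences *)

Section eventually_limit.
Context d (T : measurableType d) (R : realType) (m : {measure set T -> \bar R}).

(** Fatou's lemma. It serves to remove truncations and to pass from finite to countable unions. *)
Lemma integral_eventually_le (D : set T) (psi : nat -> T -> R) (phi : T -> R) (M : \bar R) :
  measurable D -> (forall n, measurable_fun D (psi n)) ->
  (forall n x, D x -> 0 <= psi n x) ->
  (forall x, D x -> \forall n \near \oo, psi n x = phi x) ->
  (forall n, (\int[m]_(x in D) (psi n x)%:E <= M)%E) ->
  (\int[m]_(x in D) (phi x)%:E <= M)%E.
Proof.
move=> mD mpsi psi0 ev H.
have mE n : measurable_fun D (EFin \o psi n) by exact/measurable_EFinP.
have E0 n x : D x -> (0 <= (EFin \o psi n) x)%E by move=> Dx; rewrite lee_fin psi0.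
have F := fatou m mD mE E0.
have -> : (\int[m]_(x in D) (phi x)%:E = \int[m]_(x in D) limn_einf ((fun n => EFin \o psi n) ^~ x))%E.
  apply: eq_integral => x /set_mem Dx.
  have c : (fun n => (EFin \o psi n) x) @ \oo --> (phi x)%:E.
    apply: cvg_near_cst; apply: filterS (ev x Dx) => n /= ->//.
  by rewrite is_cvg_limn_einfE ?(cvg_lim _ c)//; apply/cvg_ex; exists (phi x)%:E.
apply: (le_trans F); rewrite limn_einf_lim; apply: lime_le; first exact: is_cvg_einfs.
apply: nearW => n; apply: le_trans (H n); apply: ereal_inf_lbound.
by exists n => /=.
Qed.

End eventually_limit.

(** * A finite Vitali covering by squares *)

Section vitali.
Context {R : realType}.
Implicit Types (c : nat -> R * R) (rho : nat -> R).

Lemma seq_argmax (rho : nat -> R) (i : nat) (s : seq nat) :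
  exists2 j, j \in i :: s & forall l, l \in i :: s -> rho l <= rho j.
Proof.
elim: s i => [|a s IH] i.
  by exists i; rewrite ?mem_head// => l; rewrite inE => /eqP->.
have [j js hj] := IH a; have [ij|ij] := leP (rho i) (rho j).
  exists j; first by rewrite inE js orbT.
  by move=> l; rewrite inE => /predU1P[->//|/hj].
exists i; first by rewrite mem_head.
move=> l; rewrite inE => /predU1P[->//|/hj h]; exact: (le_trans h (ltW ij)).
Qed.

(** Greedy choice: keep a square of largest radius, discard those that meet it, which its threefold
    enlargement contains, and recurse on the rest. *)
Lemma vitali_squares c rho (s : seq nat) : (forall i, 0 < rho i) ->
  exists s', [/\ uniq s', {subset s' <= s},
    forall i j, i \in s' -> j \in s' -> i != j ->
      csq (c i) (rho i) `&` csq (c j) (rho j) = set0 &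
    forall i, i \in s -> exists2 j, j \in s' & csq (c i) (rho i) `<=` csq (c j) (3 * rho j)].
Proof.
move=> r0; have [n] := ubnP (size s); elim: n s => // n IH [|i0 s0] sn.
  by exists [::]; split.
set s := i0 :: s0; have [j js jmax] := seq_argmax rho i0 s0.
pose p i := `[< csq (c i) (rho i) `&` csq (c j) (rho j) = set0 >].
have njp : ~~ p j.
  apply/asboolP; rewrite setIid => /seteqP[+ _] => /(_ (c j)); apply; split; rewrite /= subrr normr0;
  exact: ltW.
have [|s1 [us1 ss1 d1 c1]] := IH (seq.filter p s).
  rewrite size_filter; apply: (@leq_trans (size s)); last by rewrite -ltnS.
  by rewrite -(count_predC p s) -addn1 leq_add2l -has_count; apply/hasP; exists j.
exists (j :: s1); split.
- rewrite /= us1 andbT; apply/negP => /ss1; rewrite mem_filter (negbTE njp) //.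
- by move=> l; rewrite inE => /predU1P[->//|/ss1]; rewrite mem_filter => /andP[].
- move=> a b; rewrite !inE => /predU1P[->|as1] /predU1P[->|bs1]; rewrite ?eqxx//.
  + by move=> _; move: (ss1 _ bs1); rewrite mem_filter setIC => /andP[/asboolP].
  + by move=> _; move: (ss1 _ as1); rewrite mem_filter => /andP[/asboolP].
  + exact: d1.
move=> i is_; have [pi|npi] := boolP (p i).
  have [l ls il] := c1 i ltac:(by rewrite mem_filter pi).
  by exists l; rewrite // inE ls orbT.
exists j; first by rewrite mem_head.
move/asboolP : npi => /eqP/set0P[z [[/= z1 z2] [/= z3 z4]]] y [/= y1 y2].
have ij := jmax i is_; split => /=.
- have := ler_distD z.1 y.1 (c j).1; have := ler_distD (c i).1 y.1 z.1.
  by rewrite (distrC (c i).1); lra.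
- have := ler_distD z.2 y.2 (c j).2; have := ler_distD (c i).2 y.2 z.2.
  by rewrite (distrC (c i).2); lra.
Qed.

Lemma sum_indic_disjoint (B : nat -> set (R * R)) (s : seq nat) x : uniq s ->
  (forall i j, i \in s -> j \in s -> i != j -> B i `&` B j = set0) ->
  \sum_(j <- s) (\1_(B j) x : R) <= 1.
Proof.
elim: s => [|a s IH] /=; first by rewrite big_nil.
move=> /andP[na us] D; rewrite big_cons indicE; have [xa|xa] := boolP (x \in B a); last first.
  by rewrite add0r; apply: IH => // i j is_ js; apply: D; rewrite inE ?is_ ?js orbT.
rewrite big1_seq ?addr0// => j /= js; rewrite indicE memNset//.
move=> xj; have : (B a `&` B j) x by split => //; exact: set_mem.
rewrite D ?mem_head ?inE ?js ?orbT//.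
by apply: contraNneq na => ->.
Qed.

End vitali.

(** * Stopping-time covering and the good-lambda inequality *)

Section good_lambda.
Context {R : realType}.
Local Notation mu := (@leb2 R).
(** Heavy squares will have radius below 1/b of the distance to the boundary. The value 640 makes
    that distance vary little on their enlargements and satisfies 107/100 * 1024 <= 2 b, as used in
    [good_upper]. [kp] stands for an upper bound of the square root of [K]. *)
Context (g : R * R -> R) (x0 : R * R) (R0 K kp b : R) (bE : b = 640).
Context (mg : measurable_fun setT g) (g0 : forall x, 0 <= g x)
  (ig2 : mu.-integrable setT (EFin \o (fun x => g x ^+ 2)))
  (gout : forall x, ~ csq x0 R0 x -> g x = 0) (R00 : 0 < R0) (R01 : R0 <= 1)
  (kp1 : 1 <= kp) (Kkp : K <= kp ^+ 2)
  (RH : forall c r, 0 < r -> csq c (3 * r) `<=` csq x0 R0 ->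
    \int[mu]_(x in csq c r) g x ^+ 2 <=
      K / r ^+ 2 * (\int[mu]_(x in csq c (2 * r)) g x) ^+ 2).

Definition cheb (x : R * R) : R := Num.max `|x.1 - x0.1| `|x.2 - x0.2|.
Definition dl (x : R * R) : R := Num.max 0 (R0 - cheb x).
(** The weight vanishes at the boundary of the square, so that the reverse Hoelder inequality,
    available only on interior squares, still gives an inequality over the whole plane. *)
Definition wg (x : R * R) : R := dl x * g x.

Lemma dl_ge0 x : 0 <= dl x. Proof. by rewrite le_max lexx. Qed.

Lemma dl_leR0 x : dl x <= R0.
Proof.
rewrite ge_max (ltW R00)/= lerBlDr lerDl le_max; apply/orP; left; exact: normr_ge0.
Qed.

Lemma cheb_le x y r : csq x r y -> cheb y <= cheb x + r.
Proof.
move=> [/= h1 h2]; rewrite /cheb ge_max; apply/andP; split.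
  rewrite (le_trans (ler_distD x.1 _ _))// addrC lerD// le_max lexx//.
by rewrite (le_trans (ler_distD x.2 _ _))// addrC lerD// le_max lexx orbT.
Qed.

Lemma csq_sym (x y : R * R) r : csq x r y -> csq y r x.
Proof. by move=> [/= h1 h2]; split; rewrite /= distrC. Qed.

Lemma dl_lip x y r : csq x r y -> dl x - r <= dl y <= dl x + r.
Proof.
move=> h; have h1 := cheb_le h; have h2 := cheb_le (csq_sym h).
have r0 : 0 <= r by case: h => h _; rewrite (le_trans _ h).
rewrite /dl; case: (leP 0 (R0 - cheb x)) => hx; case: (leP 0 (R0 - cheb y)) => hy; apply/andP; split; lra.
Qed.

Lemma dl_pos_csq x r : 0 < dl x -> r <= dl x -> csq x r `<=` csq x0 R0.
Proof.
rewrite {1}/dl lt_max ltxx/= subr_gt0 => hx; rewrite /dl.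
have -> : Num.max 0 (R0 - cheb x) = R0 - cheb x by apply/max_idPr; rewrite subr_ge0 ltW.
move=> hr y [/= h1 h2].
have : `|x.1 - x0.1| <= cheb x by rewrite le_max lexx.
have : `|x.2 - x0.2| <= cheb x by rewrite le_max lexx orbT.
have := ler_distD x.1 y.1 x0.1; have := ler_distD x.2 y.2 x0.2.
by split => /=; lra.
Qed.

Lemma measurable_dl : measurable_fun setT dl.
Proof.
apply: measurable_maxr => //; apply: measurable_funB => //; apply: measurable_maxr.
  by apply: measurableT_comp => //; apply: measurable_funB => //; exact: measurable_fst.
by apply: measurableT_comp => //; apply: measurable_funB => //; exact: measurable_snd.
Qed.

Lemma measurable_wg : measurable_fun setT wg.
Proof. by apply: measurable_funM => //; exact: measurable_dl. Qed.

Lemma wg_ge0 x : 0 <= wg x. Proof. by rewrite mulr_ge0// dl_ge0. Qed.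

Lemma ig_csq c r : mu.-integrable (csq c r) (EFin \o g).
Proof.
apply: L2on_int; [exact: measurable_csq|exact: leb2_csq_fin|].
split; first exact: measurable_funTS.
by apply: (@integrableS _ _ _ mu setT) => //; exact: measurable_csq.
Qed.

Lemma ig2_csq c r : mu.-integrable (csq c r) (EFin \o (fun x => g x ^+ 2)).
Proof. by apply: (@integrableS _ _ _ mu setT) => //; exact: measurable_csq. Qed.

Definition above (t : R) (x : R * R) : R := if t < wg x then wg x else 0.

Lemma above_ge0 t x : 0 <= above t x.
Proof. by rewrite /above; case: ifP => // _; exact: wg_ge0. Qed.

Lemma measurable_above t : measurable_fun setT (above t).
Proof.
rewrite /above; apply: measurable_fun_ifT => //; last exact: measurable_wg.
by apply: measurable_fun_ltr => //; exact: measurable_wg.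
Qed.

Lemma wg_le_g x : wg x <= g x.
Proof. by rewrite /wg ler_piMl// (le_trans (dl_leR0 x)). Qed.

Lemma iwg2 : mu.-integrable setT (EFin \o (fun x => wg x ^+ 2)).
Proof.
apply: (le_integrable _ _ _ ig2) => //.
  by apply/measurable_EFinP; apply: measurable_funX; exact: measurable_wg.
move=> x _ /=; rewrite lee_fin !ger0_norm ?sqr_ge0// lerXn2r ?nnegrE ?wg_ge0//.
exact: wg_le_g.
Qed.

Lemma iwg_csq c r : mu.-integrable (csq c r) (EFin \o wg).
Proof.
apply: L2on_int; [exact: measurable_csq|exact: leb2_csq_fin|].
split; first by apply: measurable_funTS; exact: measurable_wg.
by apply: (@integrableS _ _ _ mu setT) => //; [exact: measurable_csq|exact: iwg2].
Qed.

Lemma iabove_csq t c r : mu.-integrable (csq c r) (EFin \o above t).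
Proof.
apply: (le_integrable _ _ _ (iwg_csq c r)); first exact: measurable_csq.
  by apply/measurable_EFinP; apply: measurable_funTS; exact: measurable_above.
move=> x _ /=; rewrite lee_fin !ger0_norm ?wg_ge0 ?above_ge0// /above.
by case: ifP => // _; exact: wg_ge0.
Qed.

(** With 4 (2^-k)^2 as the area: the distance to the boundary times the quadratic mean of [g] on the
    square exceeds [lam]. *)
Definition heavy (lam : R) (x : R * R) (k : nat) : Prop :=
  lam ^+ 2 / dl x ^+ 2 * (4 * (2^-1 ^+ k) ^+ 2) < \int[mu]_(y in csq x (2^-1 ^+ k)) g y ^+ 2.

(** The stopping time: the largest heavy dyadic radius at x. Heaviness gives the lower estimate, its
    failure at larger radii the upper one. *)
Definition stopped lam x k := heavy lam x k /\ forall j, (j < k)%N -> ~ heavy lam x j.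

(** For a square of radius at least [dl x / b] the threshold is at least (2 lam / b)^2, which by the
    choice of [lam] is already the total integral of g^2. *)
Lemma heavy_small lam x k : 0 < lam -> (b / 2) ^+ 2 * \int[mu]_y g y ^+ 2 <= lam ^+ 2 ->
  0 < dl x -> heavy lam x k -> b * 2^-1 ^+ k < dl x.
Proof.
move=> l0 lI d0; rewrite /heavy; set r := 2^-1 ^+ k; set d := dl x => h.
have r0 : 0 < r by rewrite exprn_gt0.
have b0 : 0 < b by rewrite bE ltr0n.
have hI : \int[mu]_(y in csq x r) g y ^+ 2 <= \int[mu]_y g y ^+ 2.
  apply: Rintegral_subset_le => //; first exact: measurable_csq.
  by move=> y; exact: sqr_ge0.
rewrite ltNge; apply/negP => dr; move: h; apply/negP; rewrite -leNgt (le_trans hI)//.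
rewrite mulrAC ler_pdivlMr ?exprn_gt0//.
have d2 : d ^+ 2 <= (b * r) ^+ 2 by rewrite lerXn2r// nnegrE ltW// mulr_gt0.
set I := \int[mu]_y _ in lI *.
have I0 : 0 <= I by apply: Rintegral_ge0 => y _; exact: sqr_ge0.
have := ler_wpM2l I0 d2; have := ler_wpM2r (sqr_ge0 r) lI.
have -> : I * (b * r) ^+ 2 = 4 * ((b / 2) ^+ 2 * I * r ^+ 2) by field.
by rewrite [lam ^+ 2 * _]mulrCA; lra.
Qed.

(** Needed so that [k - 4], used in [good_upper], is a true subtraction. *)
Lemma heavy_ge4 lam x k : 0 < lam -> (b / 2) ^+ 2 * \int[mu]_y g y ^+ 2 <= lam ^+ 2 ->
  0 < dl x -> heavy lam x k -> (4 <= k)%N.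
Proof.
move=> l0 lI d0 /(heavy_small l0 lI d0) h; rewrite leqNgt; apply/negP => k4.
have : (2^-1 : R) ^+ 3 <= 2^-1 ^+ k by apply: ler_wiXn2l; rewrite ?invr_ge0 ?invf_le1 ?ler1n.
have d1 := le_trans (dl_leR0 x) R01; rewrite bE in h; rewrite !exprS expr0; move: h d1.
by move: (dl x) (2^-1 ^+ k) => d r; lra.
Qed.

(** The square of radius 9r around [c] lies in that of radius 16r around x, which is not heavy.
    There the distance to the boundary is at most 1 + 16/640 times [dl x], whose square is below
    107/100; the area 4 (16r)^2 contributes 1024. *)
Lemma good_upper lam x k c : 0 < lam -> (b / 2) ^+ 2 * \int[mu]_y g y ^+ 2 <= lam ^+ 2 ->
  0 < dl x -> stopped lam x k -> sq c (2^-1 ^+ k) x ->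
  \int[mu]_(y in csq c (9 * 2^-1 ^+ k)) wg y ^+ 2 <= 2 * b * ((2^-1 ^+ k) ^+ 2 * lam ^+ 2).
Proof.
move=> l0 lI d0 [hk hj] [/= cx1 cx2]; have k4 := heavy_ge4 l0 lI d0 hk.
have rd := heavy_small l0 lI d0 hk; rewrite bE in rd.
have /negP := hj (k - 4)%N ltac:(by rewrite ltn_subrL/= (leq_trans _ k4)).
rewrite /heavy -leNgt; have -> : (2^-1 : R) ^+ (k - 4) = 16 * 2^-1 ^+ k.
  by rewrite -{2}(subnK k4) exprD mulrCA -[LHS]mulr1; congr (_ * _); rewrite !exprS expr0; lra.
move: rd hk cx1 cx2; set r := 2^-1 ^+ k; set d := dl x => rd hk cx1 cx2 h16.
have r0 : 0 < r by rewrite exprn_gt0.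
have sub : csq c (9 * r) `<=` csq x (16 * r).
  move=> y [/= y1 y2]; split => /=.
    by have := ler_distD c.1 y.1 x.1; rewrite (distrC c.1); lra.
  by have := ler_distD c.2 y.2 x.2; rewrite (distrC c.2); lra.
have iw : mu.-integrable (csq x (16 * r)) (EFin \o (fun y => wg y ^+ 2)).
  by apply: (@integrableS _ _ _ mu setT) => //; [exact: measurable_csq|exact: iwg2].
apply: (@le_trans _ _ (\int[mu]_(y in csq x (16 * r)) wg y ^+ 2)).
  apply: Rintegral_subset_le => //; try exact: measurable_csq.
  by move=> y; exact: sqr_ge0.
have bnd (y : R * R) : csq x (16 * r) y -> wg y ^+ 2 <= 107 / 100 * d ^+ 2 * g y ^+ 2.
  move=> cy; have /andP[_ h] := dl_lip cy.
  rewrite /wg exprMn ler_wpM2r ?sqr_ge0//.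
  have dy0 := dl_ge0 y; move: h; rewrite -/d; move: (dl y) dy0 => e e0 h; nra.
apply: (@le_trans _ _ (\int[mu]_(y in csq x (16 * r)) (107 / 100 * d ^+ 2 * g y ^+ 2))).
  apply: le_Rintegral => //; first exact: measurable_csq.
  by apply: integrable_mulrl; [exact: measurable_csq|exact: ig2_csq].
rewrite RintegralZl//; [|exact: measurable_csq|exact: ig2_csq].
have q0 : 0 <= 107 / 100 * d ^+ 2 by rewrite mulr_ge0 ?sqr_ge0//; lra.
apply: (le_trans (ler_wpM2l q0 h16)).
have -> : 107 / 100 * d ^+ 2 * (lam ^+ 2 / d ^+ 2 * (4 * (16 * r) ^+ 2)) =
   (107 / 100 * 1024) * (r ^+ 2 * lam ^+ 2) by field; rewrite gt_eqF.
rewrite bE; have : 0 <= r ^+ 2 * lam ^+ 2 by rewrite mulr_ge0 ?sqr_ge0.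
by move: (r ^+ 2 * lam ^+ 2) => z; lra.
Qed.

(** Heaviness and the reverse Hoelder inequality bound the integral of [g] on the doubled square
    from below. The points with [wg] at most [lam / (17 * kp)] cannot account for it, so a fixed
    share comes from [above]. *)
Lemma good_lower lam x k c : 0 < lam -> (b / 2) ^+ 2 * \int[mu]_y g y ^+ 2 <= lam ^+ 2 ->
  0 < dl x -> stopped lam x k -> sq c (2^-1 ^+ k) x ->
  (2^-1 ^+ k) ^+ 2 * lam <= 2 * kp * \int[mu]_(y in csq c (3 * 2^-1 ^+ k)) above (lam / (17 * kp)) y.
Proof.
move=> l0 lI d0 [hk _] [/= cx1 cx2].
have rd := heavy_small l0 lI d0 hk; rewrite bE in rd.
move: rd hk cx1 cx2; rewrite /heavy; set r := 2^-1 ^+ k; set d := dl x => rd hk cx1 cx2.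
have r0 : 0 < r by rewrite exprn_gt0.
have kp0 : 0 < kp by exact: lt_le_trans ltr01 kp1.
set t := lam / (17 * kp); have t0 : 0 < t by rewrite divr_gt0// mulr_gt0.
have sub : csq x (2 * r) `<=` csq c (3 * r).
  move=> y [/= y1 y2]; split => /=.
    by have := ler_distD x.1 y.1 c.1; lra.
  by have := ler_distD x.2 y.2 c.2; lra.
pose J := \int[mu]_(y in csq x (2 * r)) above t y.
pose N := \int[mu]_(y in csq x (2 * r)) g y.
have JJ : J <= \int[mu]_(y in csq c (3 * r)) above t y.
  apply: Rintegral_subset_le => //; try exact: measurable_csq.
    exact: iabove_csq.
  by move=> y; exact: above_ge0.
have N0 : 0 <= N by apply: Rintegral_ge0 => y _.
have S3 : csq x (3 * r) `<=` csq x0 R0 by apply: dl_pos_csq => //; rewrite -/d; lra.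
have := RH r0 S3; rewrite -/N => hRH.
have Nlow : 2 * r ^+ 2 * lam / d < kp * N.
  have q1 : 0 <= 2 * r ^+ 2 * lam / d by rewrite divr_ge0 ?mulr_ge0 ?sqr_ge0// ltW.
  have q2 : 0 <= kp * N by rewrite mulr_ge0// ltW.
  rewrite -(@ltr_pXn2r _ 2)// ?nnegrE//.
  have := lt_le_trans hk hRH.
  have hK : K / r ^+ 2 * N ^+ 2 <= kp ^+ 2 / r ^+ 2 * N ^+ 2.
    by rewrite ler_wpM2r ?sqr_ge0// ler_wpM2r// invr_ge0 sqr_ge0.
  move=> /lt_le_trans /(_ hK).
  have -> : lam ^+ 2 / d ^+ 2 * (4 * r ^+ 2) = (2 * r ^+ 2 * lam / d) ^+ 2 / r ^+ 2.
    by field; rewrite !gt_eqF.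
  have -> : kp ^+ 2 / r ^+ 2 * N ^+ 2 = (kp * N) ^+ 2 / r ^+ 2 by field; rewrite gt_eqF.
  by rewrite ltr_pM2r// invr_gt0 exprn_gt0.
(* On the doubled square the distance to the boundary is at least 15/16 of [d]. With the factor 17
   in [t] the low part contributes 16 * 16 / (15 * 17) = 256/255 times r^2 lam, strictly less than
   the 2 r^2 lam available. *)
have Nup : N <= 16 / 15 / d * (J + 16 * r ^+ 2 * t).
  have m2 : measurable (csq x (2 * r)) by exact: measurable_csq.
  have ic := integrable_cst_csq x (2 * r) t.
  have ia := iabove_csq t x (2 * r).
  apply: (@le_trans _ _ (\int[mu]_(y in csq x (2 * r)) (16 / 15 / d * (above t y + cst t y)))).
    apply: le_Rintegral => //; first exact: ig_csq.
      by apply: integrable_mulrl => //; exact: integrable_addr.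
    move=> y cy /=; have /andP[h _] := dl_lip cy.
    have dy : 15 / 16 * d <= dl y by rewrite -/d in h; lra.
    have dy0 : 0 < dl y by rewrite (lt_le_trans _ dy)// mulr_gt0//; lra.
    have wt : wg y <= above t y + t.
      by rewrite /above; case: ltP => // h'; [lra|rewrite add0r].
    rewrite mulrAC ler_pdivlMr//.
    have : 15 / 16 * d * g y <= wg y by rewrite /wg ler_wpM2r.
    by move: wt; lra.
  rewrite RintegralZl//; last exact: integrable_addr.
  rewrite RintegralD// Rintegral_cst// -/J.
  have -> : fine (mu (csq x (2 * r))) = 4 * (2 * r) ^+ 2.
    by rewrite (leb2_csq x)// mulr_ge0// ltW.
  rewrite le_eqVlt; apply/orP; left; apply/eqP; congr (_ * (_ + _)); ring.
apply: (@le_trans _ _ (2 * kp * J)); last by rewrite ler_wpM2l// mulr_ge0// ltW.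
have J0 : 0 <= J by apply: Rintegral_ge0 => y _; exact: above_ge0.
have := lt_le_trans Nlow (ler_wpM2l (ltW kp0) Nup).
rewrite -(@ltr_pM2r _ d)// => hh.
have e1 : 2 * r ^+ 2 * lam / d * d = 2 * (r ^+ 2 * lam) by rewrite divfK ?gt_eqF// mulrA.
have e2 : kp * (16 / 15 / d * (J + 16 * r ^+ 2 * t)) * d = 16 / 15 * (kp * J) + 256 / 255 * (r ^+ 2 * lam).
  by rewrite /t; field; rewrite !gt_eqF.
rewrite e1 e2 in hh; have kJ : 0 <= kp * J by rewrite mulr_ge0// ltW.
rewrite -mulrA; move: hh kJ; move: (kp * J) (r ^+ 2 * lam) => a1 a2; lra.
Qed.

Lemma stopped_exists lam x k0 : heavy lam x k0 -> exists k, stopped lam x k.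
Proof.
move=> h0; have ex : exists k, `[< heavy lam x k >] by exists k0; apply/asboolP.
have [k /asboolP hk kmin] := ex_minnP ex; exists k; split => // j jk /asboolP hj.
by have := kmin j hj; rewrite leqNgt jk.
Qed.

(** If no square at x is heavy, all means of g^2 are at most (lam / dl x)^2, and
    [weak_differentiation] turns this into [wg x <= lam]. *)
Lemma ae_heavy lam : {ae mu, forall x, lam < wg x -> 0 < lam -> exists k, heavy lam x k}.
Proof.
have [kk ck] : exists kk, forall x, ~ csq 0 kk x -> g x ^+ 2 = 0.
  exists (`|x0.1| + `|x0.2| + R0) => x nx; rewrite gout ?expr0n// => cx; apply: nx.
  exact: csq_sub0 cx.
have := weak_differentiation ig2 ck.
apply: (@filterS _ _ (ae_filter_ringOfSetsType mu)) => x /= H lw l0.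
apply: contrapT => /forallNP nh.
have d0 : 0 < dl x.
  rewrite lt_neqAle dl_ge0 andbT eq_sym; apply/negP => /eqP d0.
  by move: lw; rewrite /wg d0 mul0r ltNge (ltW l0).
have := H (lam ^+ 2 / dl x ^+ 2).
have P n : \int[mu]_(z in csq x (2^-1 ^+ n)) (g z ^+ 2) <= lam ^+ 2 / dl x ^+ 2 * (4 * (2^-1 ^+ n) ^+ 2).
  by rewrite leNgt; apply/negP; exact: nh.
move=> /(_ P); rewrite ler_pdivlMr ?exprn_gt0// -exprMn mulrC -/(wg x).
by apply/negP; rewrite -ltNge ltrXn2r// ?nnegrE ?wg_ge0// ltW.
Qed.

Lemma Rintegral_EFin (S : set (R * R)) (h : R * R -> R) : measurable S ->
  mu.-integrable S (EFin \o h) ->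
  (\int[mu]_(x in S) (h x)%:E = (\int[mu]_(x in S) h x)%:E)%E.
Proof. by move=> mS ih; rewrite /Rintegral fineK//; exact: (@integrable_fin_num _ _ _ mu). Qed.

Lemma integral_indicE (S : set (R * R)) (h : R * R -> R) : measurable S ->
  (\int[mu]_x (h x * \1_S x)%:E = \int[mu]_(x in S) (h x)%:E)%E.
Proof.
move=> mS; rewrite [RHS]integral_mkcond; apply: eq_integral => x _; rewrite patchE indicE.
by case: ifP => _; rewrite ?mulr1 ?mulr0.
Qed.

Definition cut2 (t : R) (x : R * R) : R := if t < wg x then wg x ^+ 2 else 0.

(** The Vitali selection runs on the tripled squares, since [good_lower] measures [above] there;
    being disjoint, their contributions add up. Their enlargements of radius 9r cover, and that is
    the radius of [good_upper]. *)
Lemma good_lambda_finite lam (c : nat -> R * R) (kk : nat -> nat) (s : seq nat) :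
  0 < lam -> (b / 2) ^+ 2 * \int[mu]_y g y ^+ 2 <= lam ^+ 2 ->
  (forall i, i \in s -> exists x, [/\ 0 < dl x, stopped lam x (kk i) & sq (c i) (2^-1 ^+ kk i) x]) ->
  (\int[mu]_(x in \bigcup_(i in [set i | i \in s]) csq (c i) (2^-1 ^+ kk i)) (wg x ^+ 2)%:E <=
   (4 * b * kp * lam)%:E * \int[mu]_x (above (lam / (17 * kp)) x)%:E)%E.
Proof.
move=> l0 lI good; pose r i : R := 2^-1 ^+ kk i.
have r0 i : 0 < r i by rewrite exprn_gt0.
have r30 i : 0 < 3 * r i by rewrite mulr_gt0.
have b0 : 0 < b by rewrite bE ltr0n.
have [s' [us' ss' dis cov]] := vitali_squares c s r30.
have kp0 : 0 < kp by exact: lt_le_trans ltr01 kp1.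
set U := \bigcup_(i in _) _; set t := lam / (17 * kp).
have mU : measurable U by apply: bigcup_measurable => i _; exact: measurable_csq.
have mc i rr : measurable (csq (c i) rr) by exact: measurable_csq.
have mw := measurable_wg; have ma := measurable_above t.
have C0 : 0 <= 4 * b * kp * lam by rewrite !mulr_ge0// ltW.
have mF i : measurable_fun setT (fun x => (wg x ^+ 2 * \1_(csq (c i) (9 * r i)) x)%:E).
  by apply/measurable_EFinP; apply: measurable_funM; [exact: measurable_funX|exact: measurable_indic].
have mA i : measurable_fun setT (fun x => (above t x * \1_(csq (c i) (3 * r i)) x)%:E).
  by apply/measurable_EFinP; apply: measurable_funM => //; exact: measurable_indic.
apply: (@le_trans _ _ (\int[mu]_x \sum_(j <- s') (wg x ^+ 2 * \1_(csq (c j) (9 * r j)) x)%:E)%E).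
  rewrite -integral_indicE//; apply: ge0_le_integral => //.
  - by move=> x _; rewrite lee_fin mulr_ge0// sqr_ge0.
  - by apply/measurable_EFinP; apply: measurable_funM; [exact: measurable_funX|exact: measurable_indic].
  - exact: emeasurable_sum.
  move=> x _; rewrite indicE; have [/set_mem[i /= is_ xi]|_] := boolP (x \in U); last first.
    by rewrite mulr0; apply: sume_ge0 => j _; rewrite lee_fin mulr_ge0// sqr_ge0.
  have [j js ij] := cov i is_; rewrite mulr1 (bigD1_seq j)//=.
  apply: (@le_trans _ _ (wg x ^+ 2 * \1_(csq (c j) (9 * r j)) x)%:E).
    rewrite indicE mem_set ?mulr1//.
    have -> : 9 * r j = 3 * (3 * r j) by rewrite mulrA -natrM.
    by apply: ij; apply: csqS xi; have := r0 i; rewrite /r; lra.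
  by apply: leeDl; apply: sume_ge0 => l _; rewrite lee_fin mulr_ge0// sqr_ge0.
rewrite ge0_integral_sum//; last by move=> j x _; rewrite lee_fin mulr_ge0// sqr_ge0.
apply: (@le_trans _ _ (\sum_(j <- s') ((4 * b * kp * lam)%:E *
    \int[mu]_x (above t x * \1_(csq (c j) (3 * r j)) x)%:E))%E).
  rewrite big_seq [leRHS]big_seq; apply: lee_sum => j js.
  have [x [d0 sx cx]] := good j (ss' j js).
  rewrite !integral_indicE// Rintegral_EFin//; last first.
    by apply: (@integrableS _ _ _ mu setT) => //; first exact: mc; exact: iwg2.
  rewrite Rintegral_EFin//; last exact: iabove_csq.
  rewrite -EFinM lee_fin (le_trans (good_upper l0 lI d0 sx cx))//.
  have h := good_lower l0 lI d0 sx cx.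
  have bl : 0 <= 2 * b * lam by rewrite !mulr_ge0// ltW.
  have := ler_wpM2l bl h; rewrite -/(r j) -/t; move: (\int[mu]_(y in _) _) => I.
  have -> : 2 * b * lam * (r j ^+ 2 * lam) = 2 * b * (r j ^+ 2 * lam ^+ 2) by ring.
  by have -> : 2 * b * lam * (2 * kp * I) = 4 * b * kp * lam * I by ring.
rewrite -ge0_sume_distrr; last by move=> j _; apply: integral_ge0 => x _; rewrite lee_fin mulr_ge0// above_ge0.
apply: lee_wpmul2l; first by rewrite lee_fin.
rewrite -ge0_integral_sum//; last by move=> j x _; rewrite lee_fin mulr_ge0// above_ge0.
apply: ge0_le_integral => //.
- by move=> x _; apply: sume_ge0 => j _; rewrite lee_fin mulr_ge0// above_ge0.
- exact: emeasurable_sum.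
- exact/measurable_EFinP.
move=> x _; rewrite sumEFin lee_fin -mulr_sumr ler_piMr ?above_ge0//.
exact: sum_indic_disjoint.
Qed.

(** Replacing a stopped square at x by a dyadic square of the same radius containing x makes the
    cover of {wg > lam} countable. The finite estimate is uniform and passes to the increasing
    union. *)
Lemma good_lambda lam : 0 < lam -> (b / 2) ^+ 2 * \int[mu]_y g y ^+ 2 <= lam ^+ 2 ->
  (\int[mu]_x (cut2 lam x)%:E <=
   (4 * b * kp * lam)%:E * \int[mu]_x (above (lam / (17 * kp)) x)%:E)%E.
Proof.
move=> l0 lI; have [c [kk ck]] := @dyadic_squares R.
pose good i := exists x, [/\ 0 < dl x, stopped lam x (kk i) & sq (c i) (2^-1 ^+ kk i) x].
pose A n := \bigcup_(i in [set i | i \in [seq i <- iota 0 n | `[< good i >]]]) csq (c i) (2^-1 ^+ kk i).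
pose B := \bigcup_(i in good) csq (c i) (2^-1 ^+ kk i).
have mw := measurable_wg.
have mA n : measurable (A n) by apply: bigcup_measurable => i _; exact: measurable_csq.
have mB : measurable B by apply: bigcup_measurable => i _; exact: measurable_csq.
have mwI (S : set (R * R)) : measurable S -> measurable_fun setT (fun x => wg x ^+ 2 * \1_S x).
  by move=> mS; apply: measurable_funM; [exact: measurable_funX|exact: measurable_indic].
apply: (@le_trans _ _ (\int[mu]_x (wg x ^+ 2 * \1_B x)%:E)%E).
  apply: ae_ge0_le_integral => //.
  - by move=> x _; rewrite lee_fin /cut2; case: ifP => // _; exact: sqr_ge0.
  - apply/measurable_EFinP; apply: measurable_fun_ifT => //; last exact: measurable_funX.
    exact: measurable_fun_ltr.
  - by move=> x _; rewrite lee_fin mulr_ge0// sqr_ge0.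
  - by apply/measurable_EFinP; exact: mwI.
  apply: (@filterS _ _ (ae_filter_ringOfSetsType mu) _ _ _ (ae_heavy lam)) => x /= H _.
  rewrite lee_fin /cut2; case: ifP => [lw|_]; last by rewrite mulr_ge0// sqr_ge0.
  have [k0 /stopped_exists[k sk]] := H lw l0.
  have [i [ki cx]] := ck x k; rewrite -ki in cx sk.
  have d0 : 0 < dl x.
    rewrite lt_neqAle dl_ge0 andbT eq_sym; apply/negP => /eqP d0.
    by move: lw; rewrite /wg d0 mul0r ltNge (ltW l0).
  rewrite indicE mem_set ?mulr1//; exists i; first by exists x.
  by case: cx => /= /ltW ? /ltW ?.
apply: (@integral_eventually_le _ _ _ mu setT (fun n x => wg x ^+ 2 * \1_(A n) x)) => //.
- by move=> n; exact: mwI.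
- by move=> n x _; rewrite mulr_ge0// sqr_ge0.
- move=> x _; have [Bx|nBx] := pselect (B x).
    have [i gi xi] := Bx; exists i.+1 => // n /= ni.
    rewrite !indicE !mem_set//; exists i => //=.
    by rewrite mem_filter mem_iota/= ni andbT; exact/asboolP.
  apply: nearW => n; rewrite !indicE !memNset// => -[i /=].
  by rewrite mem_filter => /andP[/asboolP gi _] xi; apply: nBx; exists i.
move=> n; rewrite integral_indicE//; apply: good_lambda_finite => //.
by move=> i; rewrite mem_filter => /andP[/asboolP].
Qed.

End good_lambda.

(** * From the good-lambda inequality to higher integrability *)

Section level_sets.
Context {R : realType}.

(** Put V_j = S_j - X_j/a and q = 1 - 1/a. The third hypothesis says V_{j+1} <= V_j - q X_j, the
    second gives X_j >= V_{j+1}/D, so V shrinks by the factor 1 + q/D at each step; V is comparable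
    to S because X lies between 0 and S. *)
Lemma level_decay (a D : R) (S X : nat -> R) : 1 < a -> 0 < D ->
  (forall j, 0 <= X j <= S j) -> (forall j, S j.+1 <= D * X j) ->
  (forall j, X j - X j.+1 / a <= S j - S j.+1) ->
  forall j, S j <= S 0%N / (1 - a^-1) / (1 + (1 - a^-1) / D) ^+ j.
Proof.
move=> a1 D0 XS SX dS j.
have a0 : 0 < a by lra.
have ai : 0 < a^-1 < 1 by rewrite invr_gt0 a0 invf_lt1.
pose q := 1 - a^-1; have q0 : 0 < q by rewrite /q; case/andP: ai; lra.
pose k := q / D; have k0 : 0 < k by rewrite divr_gt0.
pose V j := S j - X j / a.
have VS i : q * S i <= V i <= S i.
  have /andP[h1 h2] := XS i; case/andP: ai => i0 i1.
  have := ler_wpM2r (ltW i0) h2; have := mulr_ge0 h1 (ltW i0).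
  by rewrite /V /q => h3 h4; apply/andP; split; lra.
have step i : (1 + k) * V i.+1 <= V i.
  have /andP[_ h1] := VS i.+1; have h2 := SX i; have h3 := dS i.
  have : k * V i.+1 <= q * X i.
    have : k * V i.+1 <= k * (D * X i) by rewrite ler_pM2l// (le_trans h1).
    by rewrite mulrA /k divfK// gt_eqF.
  by move: h3; rewrite /V /q; lra.
have dec : (1 + k) ^+ j * V j <= V 0%N.
  elim: j => [|i IH]; first by rewrite expr0 mul1r.
  apply: le_trans IH; rewrite exprSr -mulrA ler_wpM2l//.
  by rewrite exprn_ge0// addr_ge0// ltW.
have kj : 0 < (1 + k) ^+ j by rewrite exprn_gt0// addr_gt0.
rewrite ler_pdivlMr// ler_pdivlMr//.
have /andP[h1 _] := VS j; have /andP[_ h2] := VS 0%N.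
have := ler_wpM2l (ltW kj) h1; rewrite -/k; move: dec h2; rewrite -/q.
move: ((1 + k) ^+ j) => z; move: (V j) (V 0%N) (S j) (S 0%N) => v v0 s s0; lra.
Qed.

Lemma geometric_partial (t : R) n : 0 <= t -> t < 1 -> \sum_(j < n) t ^+ j <= (1 - t)^-1.
Proof.
move=> t0 t1; rewrite -[leRHS]mul1r ler_pdivlMr ?subr_gt0//.
suff -> : (\sum_(j < n) t ^+ j) * (1 - t) = 1 - t ^+ n by rewrite lerBlDr lerDl exprn_ge0.
elim: n => [|n IH]; first by rewrite big_ord0 mul0r expr0 subrr.
by rewrite big_ord_recr/= mulrDl IH exprS; ring.
Qed.

(** The cap 2 keeps the final exponent at most 4, the integrability known for the solution
    itself. *)
Lemma powR_exponent (a c : R) : 1 < a -> 1 < c -> exists2 s : R, 0 < s <= 2 & a `^ s <= c.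
Proof.
move=> a1 c1; have la : 0 < ln a by rewrite ln_gt0. have lc : 0 < ln c by rewrite ln_gt0.
exists (Num.min 2 (ln c / ln a)).
  by rewrite lt_min ltr0n divr_gt0//= ge_min lexx.
apply: (@le_trans _ _ (a `^ (ln c / ln a))).
  by apply: ler_powR; [exact: ltW|rewrite ge_min lexx orbT].
rewrite /powR gt_eqF; last by lra.
by rewrite divfK ?gt_eqF// lnK// posrE; lra.
Qed.

(** A discrete layer-cake bound: raising the truncation by one level changes something only where F
    exceeds the previous level, and the new summand dominates there. *)
Lemma truncated_power (F s a l0 : R) n : 0 <= F -> 0 <= s -> 1 < a -> 0 < l0 ->
  F ^+ 2 * (Num.min F (l0 * a ^+ n)) `^ s <= l0 `^ s * F ^+ 2 +
   \sum_(j < n) (l0 * a ^+ j.+1) `^ s * (if l0 * a ^+ j < F then F ^+ 2 else 0).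
Proof.
move=> F0 s0 a1 l00; have a0 : 0 <= a by lra.
have L0 j : 0 <= l0 * a ^+ j by rewrite mulr_ge0 ?exprn_ge0// ltW.
have terms j : 0 <= (l0 * a ^+ j.+1) `^ s * (if l0 * a ^+ j < F then F ^+ 2 else 0).
  by apply: mulr_ge0; [exact: powR_ge0|case: ifP => // _; exact: sqr_ge0].
elim: n => [|n IH].
  rewrite big_ord0 addr0 mulrC ler_wpM2r ?sqr_ge0// ge0_ler_powR// ?nnegrE ?ge_min ?expr0 ?mulr1 ?lexx ?orbT//.
    by rewrite le_min F0 ltW.
  exact: ltW.
rewrite big_ord_recr/=; case: (ltP (l0 * a ^+ n) F) => hF.
  rewrite addrA [leRHS]addrC mulrC -[leLHS]addr0 lerD//.
    rewrite ler_wpM2r ?sqr_ge0// ge0_ler_powR// ?nnegrE ?ge_min ?lexx ?orbT//.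
    by rewrite le_min F0 L0.
  by rewrite addr_ge0 ?mulr_ge0 ?powR_ge0 ?sqr_ge0// sumr_ge0.
rewrite mulr0 addr0; apply: le_trans IH; rewrite ler_wpM2l ?sqr_ge0//.
rewrite ge0_ler_powR// ?nnegrE ?le_min ?F0 ?L0//.
by rewrite !ge_min lexx hF.
Qed.

(** Along the levels l0 a^j the integrals S_j decay geometrically by [level_decay]. A small [s]
    makes the weights a^(js) grow more slowly, so the sum from [truncated_power] is bounded
    independently of the truncation. *)
Lemma higher_integrability (a C : R) : 1 < a -> 0 < C -> exists2 s : R, 0 < s <= 2 &
  forall d (T : measurableType d) (m : {measure set T -> \bar R}) (F : T -> R) (l0 : R),
  measurable_fun setT F -> (forall x, 0 <= F x) -> m.-integrable setT (EFin \o (fun x => F x ^+ 2)) ->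
  0 < l0 ->
  (forall l, l0 <= l -> (\int[m]_x (if l < F x then F x ^+ 2 else 0)%:E <=
     (C * l)%:E * \int[m]_x (if l / a < F x then F x else 0)%:E)%E) ->
  (\int[m]_x (F x ^+ 2 * F x `^ s)%:E < +oo)%E.
Proof.
move=> a1 C0; have a0 : 0 < a by lra.
have ai : 0 < a^-1 < 1 by rewrite invr_gt0 a0 invf_lt1.
pose D := C * a; have D0 : 0 < D by rewrite mulr_gt0.
pose q := 1 - a^-1; have q0 : 0 < q by rewrite /q; case/andP: ai; lra.
pose k := q / D; have k0 : 0 < k by rewrite divr_gt0.
(* Halfway between 1 and the decay factor [1 + k]: the weights grow at most like [c ^+ j], which
   leaves the ratio [th = c / (1 + k) < 1]. *)
pose c := 1 + k / 2; have c1 : 1 < c by rewrite /c; lra.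
have [s s02 sc] := powR_exponent a1 c1; exists s => // d T m F l0 mF F0 iF2 l00 GL.
have /andP[s0 s2] := s02.
pose L j := l0 * a ^+ j.
have Lp j : 0 < L j by rewrite mulr_gt0// exprn_gt0.
have LS j : L j.+1 = a * L j by rewrite /L exprS; ring.
have Lmono j : L j <= L j.+1 by rewrite LS ler_peMl// ltW.
pose cu (t : R) x := if t < F x then F x ^+ 2 else 0.
pose ab (t : R) x := if t < F x then F x else 0.
have mcu t : measurable_fun setT (cu t).
  apply: measurable_fun_ifT => //; last exact: measurable_funX.
  exact: measurable_fun_ltr.
have mab t : measurable_fun setT (ab t).
  by apply: measurable_fun_ifT => //; exact: measurable_fun_ltr.
have cu0 t x : 0 <= cu t x by rewrite /cu; case: ifP => // _; exact: sqr_ge0.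
have ab0 t x : 0 <= ab t x by rewrite /ab; case: ifP.
have icu t : m.-integrable setT (EFin \o cu t).
  apply: (le_integrable _ _ _ iF2) => //; first exact/measurable_EFinP.
  move=> x _ /=; rewrite lee_fin !ger0_norm ?sqr_ge0//.
  by rewrite /cu; case: ifP => // _; exact: sqr_ge0.
have abcu t x : t * ab t x <= cu t x.
  by rewrite /ab /cu; case: ifP => [h|_]; rewrite ?mulr0// expr2 ler_wpM2r// ltW.
have iab t : 0 < t -> m.-integrable setT (EFin \o ab t).
  move=> t0; have i1 : m.-integrable setT (EFin \o (fun x => t^-1 * cu t x)) by exact: integrable_mulrl.
  apply: (le_integrable _ _ _ i1) => //; first exact/measurable_EFinP.
  move=> x _ /=; rewrite lee_fin !ger0_norm ?mulr_ge0 ?invr_ge0 ?(ltW t0)//.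
  by rewrite mulrC ler_pdivlMr// mulrC.
have EI (h : T -> R) : m.-integrable setT (EFin \o h) -> (\int[m]_x (h x)%:E = (\int[m]_x h x)%:E)%E.
  by move=> ih; rewrite /Rintegral fineK//; exact: (@integrable_fin_num _ _ _ m).
pose S j := \int[m]_x cu (L j) x; pose X j := L j * \int[m]_x ab (L j) x.
have XE j : X j = \int[m]_x (L j * ab (L j) x) by rewrite RintegralZl//; exact: iab.
have iX j : m.-integrable setT (EFin \o (fun x => L j * ab (L j) x)).
  by apply: integrable_mulrl => //; exact: iab.
have XS j : 0 <= X j <= S j.
  apply/andP; split; first by rewrite mulr_ge0 ?(ltW (Lp j))//; exact: Rintegral_ge0.
  by rewrite XE; apply: le_Rintegral => // x _.
have SX j : S j.+1 <= D * X j.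
  have GLc l : l0 <= l -> (\int[m]_x (cu l x)%:E <= (C * l)%:E * \int[m]_x (ab (l / a) x)%:E)%E := GL l.
  have := GLc (L j.+1) _; rewrite {1}/L ler_peMr ?exprn_ege1// ?(ltW a1)// ?(ltW l00)// => /(_ isT).
  have -> : L j.+1 / a = L j by rewrite LS mulrAC mulfV ?mul1r// gt_eqF.
  rewrite (EI _ (icu (L j.+1))) (EI _ (iab (L j) (Lp j))).
  by rewrite -EFinM lee_fin -/(S j.+1) => h; apply: (le_trans h); rewrite LS /D /X !mulrA.
(* Dividing by [a] turns the factor [L j.+1] of [X j.+1] into [L j]. Pointwise both sides then live
   on the layer L_j < F <= L_{j+1}, where the claim is L_j F <= F^2. *)
have dS j : X j - X j.+1 / a <= S j - S j.+1.
  have -> : X j.+1 / a = \int[m]_x (L j * ab (L j.+1) x).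
    rewrite RintegralZl//; last exact: iab.
    by rewrite /X LS [a * _]mulrC -mulrA [_ * a^-1]mulrC !mulrA -[L j * a / a]mulrA mulfV ?mulr1// gt_eqF.
  have i2 : m.-integrable setT (EFin \o (fun x => L j * ab (L j.+1) x)).
    by apply: integrable_mulrl => //; exact: iab.
  rewrite XE -RintegralB// -RintegralB//; apply: le_Rintegral => //.
  - exact: integrable_subr.
  - exact: integrable_subr.
  move=> x _; have := Lmono j; rewrite /ab /cu; case: (ltP (L j) (F x)) => h1; case: (ltP (L j.+1) (F x)) => h2 h3.
  + by rewrite !subrr.
  + by rewrite mulr0 !subr0 expr2 ler_wpM2r// ltW.
  + by move: (lt_le_trans h2 h1); rewrite ltNge h3.
  + by rewrite mulr0 !subr0.
have decay := level_decay a1 D0 XS SX dS.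
rewrite -/q -/k in decay.
pose th := c / (1 + k); have k1 : 0 < 1 + k by lra.
have th0 : 0 <= th by rewrite divr_ge0//; lra.
have th1 : th < 1 by rewrite ltr_pdivrMr// mul1r /c; lra.
pose M := l0 `^ s * \int[m]_x F x ^+ 2 + (l0 * a) `^ s * (S 0%N / q) * (1 - th)^-1.
suff : (\int[m]_x (F x ^+ 2 * F x `^ s)%:E <= M%:E)%E by move=> /le_lt_trans; apply; exact: ltry.
have mps (h : T -> R) : measurable_fun setT h -> measurable_fun setT (fun x => h x `^ s).
  by move=> mh; exact: (measurableT_comp (measurable_powR s) mh).
apply: (@integral_eventually_le _ _ _ m setT (fun n x => F x ^+ 2 * (Num.min (F x) (L n)) `^ s)) => //.
- move=> n; apply: measurable_funM; first exact: measurable_funX.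
  by apply: mps; apply: measurable_minr.
- by move=> n x _; rewrite mulr_ge0 ?sqr_ge0 ?powR_ge0.
- move=> x _.
  have e0 : 0 < l0 / (F x + 1) by rewrite divr_gt0// ltr_wpDl.
  have /cvgr0Pnorm_lt : (GRing.exp (a^-1) : R^nat) @ \oo --> (0:R).
    by apply: cvg_expr; case/andP: ai => i0 i1; rewrite ger0_norm// ltW.
  move=> /(_ _ e0); apply: filterS => n.
  rewrite ger0_norm; last by rewrite exprn_ge0// invr_ge0 ltW.
  rewrite exprVn ltr_pdivlMr ?ltr_wpDl// mulrC -ltr_pdivlMr ?invr_gt0 ?exprn_gt0// invrK => h.
  by congr (_ * _ `^ _); apply/min_idPl; move: h; rewrite -/(L n); lra.
move=> n.
have mcuj j : measurable_fun setT (fun x => (L j.+1) `^ s * cu (L j) x) by exact: measurable_funM.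
have icuj j : m.-integrable setT (EFin \o (fun x => (L j.+1) `^ s * cu (L j) x)) by exact: integrable_mulrl.
pose Bn x := l0 `^ s * F x ^+ 2 + \sum_(j < n) (L j.+1) `^ s * cu (L j) x.
have i0 : m.-integrable setT (EFin \o (fun x => l0 `^ s * F x ^+ 2)) by exact: integrable_mulrl.
have [isum Esum] : m.-integrable setT (EFin \o (fun x => \sum_(j < n) (L j.+1) `^ s * cu (L j) x)) /\
    \int[m]_x (\sum_(j < n) (L j.+1) `^ s * cu (L j) x) = \sum_(j < n) (L j.+1) `^ s * S j.
  elim: n {Bn} => [|n [I1 I2]].
    under eq_fun do rewrite big_ord0; rewrite big_ord0; split; first exact: integrable0.
    by rewrite /Rintegral integral0.
  under eq_fun do rewrite big_ord_recr/=; rewrite big_ord_recr/=; split; first exact: integrable_addr.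
  by rewrite RintegralD// I2 RintegralZl.
have iB : m.-integrable setT (EFin \o Bn) by exact: integrable_addr.
apply: (@le_trans _ _ (\int[m]_x (Bn x)%:E)%E).
  apply: ge0_le_integral => //.
  - by move=> x _; rewrite lee_fin mulr_ge0 ?sqr_ge0 ?powR_ge0.
  - apply/measurable_EFinP; apply: measurable_funM; first exact: measurable_funX.
    by apply: mps; apply: measurable_minr.
  - exact: (measurable_int _ iB).
  by move=> x _; rewrite lee_fin; exact: truncated_power (ltW s0) a1 l00.
rewrite (EI _ iB) lee_fin RintegralD// RintegralZl// Esum lerD2l.
have hq : 0 <= S 0%N / q by rewrite divr_ge0 ?(ltW q0)//; apply: Rintegral_ge0.
apply: (@le_trans _ _ (\sum_(j < n) (l0 * a) `^ s * (S 0%N / q) * th ^+ j)); last first.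
  by rewrite -mulr_sumr ler_wpM2l ?geometric_partial// mulr_ge0// powR_ge0.
apply: ler_sum => j _.
have la0 : 0 <= l0 * a by rewrite mulr_ge0// ltW.
have -> : (L j.+1) `^ s = (l0 * a) `^ s * (a `^ s) ^+ j.
  rewrite /L exprS mulrA powRM ?exprn_ge0 ?(ltW a0)//; congr (_ * _).
  by rewrite -powR_mulrn ?(ltW a0)// powRAC powR_mulrn// powR_ge0.
rewrite -!mulrA ler_wpM2l ?powR_ge0//.
have pj : (a `^ s) ^+ j <= c ^+ j by rewrite lerXn2r// ?nnegrE ?powR_ge0//; lra.
have Sj0 : 0 <= S j by apply: Rintegral_ge0.
apply: (le_trans (ler_wpM2r Sj0 pj)).
rewrite mulrA /th expr_div_n [leRHS]mulrCA ler_wpM2l ?exprn_ge0//; first lra.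
Qed.

End level_sets.

(** * Gehring's lemma on a square *)

Section gehring.
Context {R : realType}.
Local Notation mu := (@leb2 R).

Lemma gehring (K : R) : 0 < K -> exists2 s : R, 0 < s <= 2 &
  forall (g : R * R -> R) (x0 : R * R) (R0 : R),
  measurable_fun setT g -> (forall x, 0 <= g x) ->
  mu.-integrable setT (EFin \o (fun x => g x ^+ 2)) ->
  (forall x, ~ csq x0 R0 x -> g x = 0) -> 0 < R0 -> R0 <= 1 ->
  (forall c r, 0 < r -> csq c (3 * r) `<=` csq x0 R0 ->
    \int[mu]_(x in csq c r) g x ^+ 2 <=
      K / r ^+ 2 * (\int[mu]_(x in csq c (2 * r)) g x) ^+ 2) ->
  (\int[mu]_(x in csq x0 (R0 / 2)) (g x ^+ 2 * g x `^ s)%:E < +oo)%E.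
Proof.
(* A bound for the square root of [K] that is also at least 1, so that the ratio [17 * kp] of
   successive levels exceeds 1. *)
move=> K0; pose kp := 1 + K; have kp1 : 1 <= kp by rewrite /kp; lra.
have Kkp : K <= kp ^+ 2 by rewrite /kp; have := sqr_ge0 K; lra.
have [b bE] : exists b : R, b = 640 by exists 640.
have b0 : 0 < b by rewrite bE ltr0n.
have kp0 : 0 < kp by lra.
have a1 : 1 < 17 * kp by lra.
have C0 : 0 < 4 * b * kp by rewrite !mulr_gt0.
have [s s02 H] := higher_integrability a1 C0; exists s => // g x0 R0 mg g0 ig2 gout R00 R01 RH.
have s0 : 0 <= s by case/andP: s02 => /ltW.
pose I := \int[mu]_y g y ^+ 2.
have I0 : 0 <= I by apply: Rintegral_ge0 => y _; exact: sqr_ge0.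
have bI : 0 <= (b / 2) ^+ 2 * I by apply: mulr_ge0 => //; exact: sqr_ge0.
(* Since l0 >= 1, any l >= l0 satisfies l^2 >= l >= (b/2)^2 I, the condition of [good_lambda],
   without a square root. *)
pose l0 := 1 + (b / 2) ^+ 2 * I; have l01 : 1 <= l0 by rewrite lerDl.
have GL l : l0 <= l -> (\int[mu]_x (if l < wg g x0 R0 x then wg g x0 R0 x ^+ 2 else 0)%:E <=
    ((4 * b * kp) * l)%:E * \int[mu]_x (if (l / (17 * kp) < wg g x0 R0 x)%R then wg g x0 R0 x else 0)%:E)%E.
  move=> hl; have l1 : 1 <= l by exact: le_trans hl.
  have lI : (b / 2) ^+ 2 * I <= l ^+ 2.
    apply: (@le_trans _ _ l); first by apply: le_trans hl; rewrite lerDr.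
    by rewrite expr2 ler_peMr// (le_trans _ l1).
  exact: (good_lambda bE mg g0 ig2 gout R00 R01 kp1 Kkp RH (lt_le_trans ltr01 l1) lI).
have := H _ _ mu (wg g x0 R0) l0 (measurable_wg x0 R0 mg) (wg_ge0 x0 R0 g0)
  (iwg2 x0 mg g0 ig2 R00 R01) (lt_le_trans ltr01 l01) GL.
(* On the half square the weight is at least R0/2, so [g] is at most 2/R0 times [wg] there. *)
move=> fin; pose k := (2 / R0) ^+ 2 * (2 / R0) `^ s.
have k0 : 0 <= k by apply: mulr_ge0; [exact: sqr_ge0|exact: powR_ge0].
have mc : measurable (csq x0 (R0 / 2)) by exact: measurable_csq.
have mps (h : R * R -> R) : measurable_fun setT h -> measurable_fun setT (fun x => h x ^+ 2 * h x `^ s).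
  move=> mh; apply: measurable_funM; first exact: measurable_funX.
  exact: (measurableT_comp (measurable_powR s) mh).
have w0 := wg_ge0 x0 R0 g0.
have W0 x : 0 <= wg g x0 R0 x ^+ 2 * wg g x0 R0 x `^ s by apply: mulr_ge0; [exact: sqr_ge0|exact: powR_ge0].
apply: (@le_lt_trans _ _ (\int[mu]_x (k%:E * (wg g x0 R0 x ^+ 2 * wg g x0 R0 x `^ s)%:E))%E); last first.
  rewrite ge0_integralZl//; last 2 first.
  - by apply/measurable_EFinP; apply: mps; exact: measurable_wg.
  - by move=> x _; rewrite lee_fin.
  - by rewrite lte_mul_pinfty// lee_fin.
rewrite integral_mkcond; apply: ge0_le_integral => //.
- move=> x _; rewrite patchE; case: ifP => // _; rewrite lee_fin.
  by apply: mulr_ge0; [exact: sqr_ge0|exact: powR_ge0].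
- by apply/(measurable_restrictT _ mc); apply/measurable_EFinP; apply: measurable_funTS; exact: mps.
- by apply: measurable_funeM; apply/measurable_EFinP; apply: mps; exact: measurable_wg.
move=> x _; rewrite patchE; case: ifPn => [/set_mem cx|_]; last by rewrite mule_ge0// lee_fin.
rewrite -EFinM lee_fin /k.
have dx : R0 / 2 <= dl x0 R0 x.
  rewrite /dl le_max; apply/orP; right; case: cx => /= c1 c2.
  suff : cheb x0 x <= R0 / 2 by lra.
  by rewrite ge_max c1.
have gx : g x <= 2 / R0 * wg g x0 R0 x.
  rewrite /wg mulrA -{1}[g x]mul1r ler_wpM2r//.
  rewrite -[leLHS](@mulfV _ (R0 / 2)) ?gt_eqF ?divr_gt0// mulrC.
  by rewrite invf_div ler_wpM2l// divr_ge0// ltW.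
have p2 : 0 <= 2 / R0 by rewrite divr_ge0// ltW.
have wp : 0 <= 2 / R0 * wg g x0 R0 x by apply: mulr_ge0.
have gx0 := g0 x; have wx := w0 x.
have e1 : g x ^+ 2 <= (2 / R0 * wg g x0 R0 x) ^+ 2 by rewrite lerXn2r// nnegrE.
have e2 : g x `^ s <= (2 / R0 * wg g x0 R0 x) `^ s by rewrite ge0_ler_powR// nnegrE.
have := ler_pM (sqr_ge0 _) (powR_ge0 _ _) e1 e2 => /le_trans; apply.
by rewrite exprMn powRM// le_eqVlt; apply/orP; left; apply/eqP; ring.
Qed.

End gehring.

(** * Covering arguments, local L^4 bounds and comparison of exponents *)

Section local_integrability.
Context {R : realType}.
Local Notation mu := (@leb2 R).
Implicit Types (f g w : R * R -> R) (O S : set (R * R)).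

Lemma sq_open (c : R * R) (r : R) : open (sq c r).
Proof.
rewrite (_ : sq c r = ball c r); first exact: (@ball_open R (R * R)%type).
by apply/seteqP; split => x [/= h1 h2]; split; rewrite /= /ball/= distrC.
Qed.

(** Each point has a dyadic square on which the integral is finite; by compactness of the closure
    the squares with index below some [n] suffice. Intersecting with [O'] is required because [w] is
    measurable only there. *)
Lemma Lp_on_cover O O' w (p : R) : 0 < p -> measurable O' -> measurable_fun O' w ->
  compactly_contained O' O ->
  (forall x, O x -> exists2 r : R, 0 < r & (\int[mu]_(y in csq x r `&` O') (`|w y| `^ p)%:E < +oo)%E) ->
  Lp_on O' p%:E w.
Proof.
move=> p0 mO' mw [cO OO] H; rewrite /Lp_on inE; apply/andP; split; rewrite inE/=.
  exact/(measurable_restrictT _ mO').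
have [c [k ck]] := @dyadic_squares R; pose r i : R := 2^-1 ^+ k i.
pose good i := (\int[mu]_(y in csq (c i) (r i) `&` O') (`|w y| `^ p)%:E < +oo)%E.
have goodP x : O x -> exists2 i, good i & sq (c i) (r i) x.
  move=> /H[e e0 he]; have [n _ /(_ n (leqnn n)) /= nr] := @exp2_lt R (e / 2) ltac:(lra).
  have [i [ki xi]] := ck x n; exists i; last by rewrite /r ki.
  have me : measurable (csq x e `&` O') by apply: measurableI => //; exact: measurable_csq.
  apply: le_lt_trans he; apply: ge0_subset_integral => //.
  - by apply: measurableI => //; exact: measurable_csq.
  - apply/measurable_EFinP; apply: (measurableT_comp (measurable_powR p)).
    by apply: measurableT_comp => //; apply: measurable_funS mw => // y [].
  move=> y [[/= y1 y2] Oy]; split=> //; rewrite /r ki in y1 y2; case: xi => /= x1 x2.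
  split => /=.
    by have := ler_distD (c i).1 y.1 x.1; rewrite (distrC (c i).1); lra.
  by have := ler_distD (c i).2 y.2 x.2; rewrite (distrC (c i).2); lra.
have [n Dcov] : exists n, closure O' `<=` [set x | exists i, [/\ (i < n)%N, good i & sq (c i) (r i) x]].
  have /compact_near_coveringP cO' := cO.
  have := cO' nat \oo (fun n x => exists i, [/\ (i < n)%N, good i & sq (c i) (r i) x]) _.
  case.
    move=> x /OO /goodP[i gi xi].
    exists (sq (c i) (r i), [set n | (i < n)%N]) => /=.
      split; last by exists i.+1.
      by apply: (@open_nbhs_nbhs (R * R)%type); split; [exact: sq_open|exact: xi].
    by move=> [y n] /= [yi ni]; exists i.
  by move=> n _ /(_ n (leqnn n)) h; exists n.
have mp : measurable_fun setT (fun y => `|(w \_ O') y| `^ p).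
  apply: (measurableT_comp (measurable_powR p)); apply: measurableT_comp => //.
  exact/(measurable_restrictT _ mO').
rewrite /finite_norm unlock; apply: poweR_lty.
have E y : (`|(EFin \o w \_ O') y| `^ p = (`|(w \_ O') y| `^ p)%:E)%E by [].
under eq_integral do rewrite E.
have mc i : measurable (csq (c i) (r i)) by exact: measurable_csq.
pose D := [seq i <- iota 0 n | `[< good i >]].
have mF x : measurable_fun setT (fun y => (`|(w \_ O') y| `^ p * \1_(csq (c x) (r x)) y)%:E).
  by apply/measurable_EFinP; apply: measurable_funM => //; exact: measurable_indic.
apply: (@le_lt_trans _ _ (\int[mu]_y \sum_(x <- D) (`|(w \_ O') y| `^ p * \1_(csq (c x) (r x)) y)%:E)%E).
  apply: ge0_le_integral => //.
  - exact/measurable_EFinP.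
  - exact: emeasurable_sum.
  move=> y _; have [Oy|nOy] := pselect (O' y); last first.
    rewrite patchE memNset// normr0 powR0 ?gt_eqF//.
    by apply: sume_ge0 => x _; rewrite lee_fin mulr_ge0// powR_ge0.
  have [x [xn gx [/= sx1 sx2]]] := Dcov y (subset_closure Oy).
  have xD : x \in D by rewrite mem_filter mem_iota/= xn andbT; exact/asboolP.
  rewrite (bigD1_seq x)//=; last by rewrite filter_uniq ?iota_uniq.
  rewrite [X in (_ <= X + _)%E](_ : _ = (`|(w \_ O') y| `^ p)%:E).
    by apply: leeDl; apply: sume_ge0 => z _; rewrite lee_fin mulr_ge0// powR_ge0.
  by rewrite indicE mem_set ?mulr1//; split; exact: ltW.
rewrite ge0_integral_sum//.
rewrite big_seq; apply: lte_sum_pinfty => x xD.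
have h : good x by move: xD; rewrite mem_filter => /andP[/asboolP].
apply: le_lt_trans h; rewrite [leRHS]integral_mkcond le_eqVlt; apply/orP; left; apply/eqP.
apply: eq_integral => y _; rewrite !patchE indicE.
have [cy|ncy] := pselect (csq (c x) (r x) y); last first.
  by rewrite (memNset ncy) mulr0 memNset// => -[].
rewrite (mem_set cy) mulr1; have [Oy|nOy] := pselect (O' y).
  by rewrite !mem_set.
rewrite (memNset nOy) memNset; last by case.
by rewrite normr0 powR0 ?gt_eqF.
Qed.

Lemma norm_double_le (a b : R) : `|a * b + a * b| <= a ^+ 2 + b ^+ 2.
Proof.
have h1 := sqr_ge0 (a - b); have h2 := sqr_ge0 (a + b).
by rewrite ler_norml; apply/andP; split; nra.
Qed.

Lemma norm_shift_le (y k : R) : 0 <= y -> `|k| <= y + 1 + (y - k) ^+ 2.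
Proof.
move=> y0; have h1 := sqr_ge0 (y - k - 1); have h2 := sqr_ge0 (y - k + 1).
by rewrite ler_norml; apply/andP; split; nra.
Qed.

Lemma sqr_shift_le (y k : R) : y ^+ 2 <= 2 * (y - k) ^+ 2 + 2 * k ^+ 2.
Proof. by have := sqr_ge0 (y - 2 * k); nra. Qed.

(** Transfers a bound on h^4 to u when only (h - u)^2 is controlled: the truncation at [k] replaces
    the missing fourth power of h - u. *)
Lemma sqr_min_le (u h k : R) : 0 <= k ->
  u ^+ 2 * Num.min (u ^+ 2) k <= 4 * (h ^+ 2) ^+ 2 + 4 * k * (h - u) ^+ 2.
Proof.
move=> k0; set m := Num.min _ _.
have m0 : 0 <= m by rewrite le_min sqr_ge0.
have mk : m <= k by rewrite ge_min lexx orbT.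
have mu2 : m <= u ^+ 2 by rewrite ge_min lexx.
have e : u ^+ 2 <= 2 * h ^+ 2 + 2 * (h - u) ^+ 2 by have := sqr_ge0 (2 * h - u); nra.
have h1 := ler_wpM2r m0 e.
have h2 : (h - u) ^+ 2 * m <= (h - u) ^+ 2 * k by rewrite ler_wpM2l// sqr_ge0.
have h3 := sqr_ge0 (2 * h ^+ 2 - m).
have h4 := ler_wpM2r m0 mu2.
nra.
Qed.

(** For smooth h near the component, |D(h^2)| <= h^2 + |Dh|^2 entrywise in the integrals, so
    [poincare] applied to h^2 bounds h^2 - k in L^2 by H^1 data, hence h in L^4 by a constant
    independent of h. Truncation and [integral_eventually_le] then reach the component itself. *)
Lemma fourth_power_local O (u : R * R -> 'rV[R]_2) i c (r r' : R) : open O -> H1 O u ->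
  csq c r `<=` O -> 0 < r' -> r' < r ->
  (\int[mu]_(x in csq c r') (vcomp u i x ^+ 2 * vcomp u i x ^+ 2)%:E < +oo)%E.
Proof.
move=> oO hu cO r0 rr; have mO := open_measurable2 oO.
have [_ lu lG] := H1_wgrad oO hu.
pose S := csq c r'; have mS : measurable S by exact: measurable_csq.
have SO : S `<=` O by apply: subset_trans cO; apply: csqS; exact: ltW.
have lu' : L2on S (vcomp u i) by exact: L2onS (lu i).
have lG' j : L2on S (fun x => wgrad O u x i j) by exact: L2onS (lG i j).
pose L := 4 * r' ^+ 2; have SL : mu S = L%:E by apply: leb2_csq; exact: ltW.
have L0 : 0 < L by rewrite mulr_gt0// exprn_gt0.
have twoA (h w : R * R -> R) : L2on S h -> L2on S w -> \int[mu]_(x in S) (h x - w x) ^+ 2 <= 1 ->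
    \int[mu]_(x in S) h x ^+ 2 <= 2 * \int[mu]_(x in S) w x ^+ 2 + 2.
  move=> lh lw h1; have [_ ih] := lh; have [_ iw] := lw; have [_ ihw] := L2onB mS lh lw.
  have i1 : mu.-integrable S (EFin \o (fun x => 2 * w x ^+ 2)) by exact: integrable_mulrl.
  have i2 : mu.-integrable S (EFin \o (fun x => 2 * (h x - w x) ^+ 2)) by exact: integrable_mulrl.
  apply: (@le_trans _ _ (\int[mu]_(x in S) (2 * w x ^+ 2 + 2 * (h x - w x) ^+ 2))).
    apply: le_Rintegral => //; first exact: integrable_addr.
    by move=> x _; rewrite addrC; exact: sqr_shift_le.
  rewrite RintegralD// !RintegralZl//; lra.
pose A := 2 * \int[mu]_(x in S) (vcomp u i x) ^+ 2 + 2.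
pose B j := 2 * \int[mu]_(x in S) (wgrad O u x i j) ^+ 2 + 2.
pose E := (A + B 0 + (A + B 1) + 1) ^+ 2.
pose k0 := (A + L + E) / L.
pose Q := 2 * E + 2 * k0 ^+ 2 * L.
have unif h : smooth2 h -> \int[mu]_(x in S) (h x - vcomp u i x) ^+ 2 <= 1 ->
    (forall j, \int[mu]_(x in S) (partial j h x - wgrad O u x i j) ^+ 2 <= 1) ->
    \int[mu]_(x in S) (h x ^+ 2) ^+ 2 <= Q.
  move=> sh hh hp.
  have lh : L2on S h by apply: continuous_L2on; exact: smooth2_cts.
  have lp j : L2on S (partial j h).
    by apply: continuous_L2on; apply: smooth2_cts; exact: smooth2_partial.
  have hA := twoA _ _ lh lu' hh.
  have hB j := twoA _ _ (lp j) (lG' j) (hp j).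
  have sh2 : smooth2 (fun x => h x * h x) by exact: smooth2M.
  have [k hk] := poincare c sh2 r0 ltr01.
  have pj j : \int[mu]_(x in S) `|partial j (fun x => h x * h x) x| <= A + B j.
    apply: (@le_trans _ _ (\int[mu]_(x in S) (h x ^+ 2 + partial j h x ^+ 2))).
      apply: le_Rintegral => //.
      - apply: integrable_normr; apply: continuous_integrable_csq; apply: smooth2_cts.
        exact: smooth2_partial.
      - by apply: integrable_addr => //; [case: lh|case: (lp j)].
      move=> x _; rewrite partialM; [|exact: smooth2_diff..].
      exact: norm_double_le.
    by rewrite RintegralD//; [exact: lerD (hA) (hB j)|case: lh|case: (lp j)].
  pose z x := h x * h x - k.
  have sz : smooth2 z by apply: smooth2D => //; exact: smooth2_cst.
  have lz : L2on S z by apply: continuous_L2on; exact: smooth2_cts.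
  have hz : \int[mu]_(x in S) z x ^+ 2 <= E.
    apply: (le_trans hk); rewrite lerXn2r// ?nnegrE.
    - by rewrite !addr_ge0//; exact: Rintegral_ge0.
    - have A0 : 0 <= A by rewrite addr_ge0// mulr_ge0//; apply: Rintegral_ge0 => x _; exact: sqr_ge0.
      have B0 j : 0 <= B j by rewrite addr_ge0// mulr_ge0//; apply: Rintegral_ge0 => x _; exact: sqr_ge0.
      have b0 := B0 0; have b1 := B0 1.
      by rewrite (addr_ge0 _ ler01)// (addr_ge0 (addr_ge0 A0 b0) (addr_ge0 A0 b1)).
    by rewrite lerD2r lerD.
  have icst (t : R) : mu.-integrable S (EFin \o cst t) by exact: integrable_cst_csq.
  have Icst (t : R) : \int[mu]_(x in S) cst t x = t * L.
    by transitivity (t * fine (mu S)); [exact: Rintegral_cst|rewrite SL].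
  have [_ ih2] := lh; have [_ iz2] := lz.
  (* [poincare] gives no information on the constant [k]; it is recovered by integrating
     [norm_shift_le] over the square and dividing by the area [L]. *)
  have kk : `|k| <= k0.
    rewrite /k0 ler_pdivlMr// -Icst.
    have i1 : mu.-integrable S (EFin \o (fun x => h x ^+ 2 + cst 1 x)) by exact: integrable_addr.
    apply: (@le_trans _ _ (\int[mu]_(x in S) (h x ^+ 2 + cst 1 x + z x ^+ 2))).
      apply: le_Rintegral => //; first exact: integrable_addr.
      move=> x _ /=; rewrite /z -expr2.
      exact: norm_shift_le (sqr_ge0 _).
    rewrite RintegralD// RintegralD// Icst mul1r; exact: lerD (lerD hA _) hz.
  have i2 : mu.-integrable S (EFin \o (fun x => 2 * z x ^+ 2)) by exact: integrable_mulrl.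
  apply: (@le_trans _ _ (\int[mu]_(x in S) (2 * z x ^+ 2 + cst (2 * k ^+ 2) x))).
    apply: le_Rintegral => //.
    - apply: continuous_integrable_csq; apply: smooth2_cts.
      have := smooth2M sh2 sh2; congr (smooth2 _); apply/funext => x; rewrite !expr2.
    - by apply: integrable_addr.
    by move=> x _ /=; rewrite /z -expr2; exact: sqr_shift_le.
  rewrite RintegralD// RintegralZl// Icst /Q; apply: lerD; first by rewrite ler_wpM2l.
  rewrite ler_wpM2r ?(ltW L0)// ler_wpM2l//.
  by rewrite -(ger0_norm (sqr_ge0 k)) normrX lerXn2r// nnegrE (le_trans _ kk).
have bound (n : nat) : \int[mu]_(x in S) (vcomp u i x ^+ 2 * Num.min (vcomp u i x ^+ 2) n%:R) <= 4 * Q + 4.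
  (* The approximation improves with the truncation level so that the error [4 * n%:R * eta] of
     [sqr_min_le] stays at most 4. *)
  pose eta : R := n.+1%:R^-1; have eta0 : 0 < eta by rewrite invr_gt0.
  have eta1 : eta <= 1 by rewrite invf_le1// ler1n.
  have [h [sh hh hp]] := smooth_approx i oO hu cO rr eta0.
  have hQ := unif h sh (le_trans hh eta1) (fun j => le_trans (hp j) eta1).
  have lh : L2on S h by apply: continuous_L2on; exact: smooth2_cts.
  have [_ id] := L2onB mS lh lu'.
  have i4 : mu.-integrable S (EFin \o (fun x => (h x ^+ 2) ^+ 2)).
    apply: continuous_integrable_csq; apply: smooth2_cts.
    have sh2 : smooth2 (fun x => h x * h x) by exact: smooth2M.
    by have := smooth2M sh2 sh2; congr (smooth2 _); apply/funext => x; rewrite !expr2.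
  have j1 : mu.-integrable S (EFin \o (fun x => 4 * (h x ^+ 2) ^+ 2)) by exact: integrable_mulrl.
  have j2 : mu.-integrable S (EFin \o (fun x => 4 * n%:R * (h x - vcomp u i x) ^+ 2)) by exact: integrable_mulrl.
  have [mu_ iu2] := lu'.
  have mm : measurable_fun S (fun x => Num.min (vcomp u i x ^+ 2) n%:R).
    by apply: measurable_minr => //; exact: measurable_funX.
  apply: (@le_trans _ _ (\int[mu]_(x in S) (4 * (h x ^+ 2) ^+ 2 + 4 * n%:R * (h x - vcomp u i x) ^+ 2))).
    apply: le_Rintegral => //.
    - apply: (integrable_bounded_on (M := n%:R)) => // x _.
      by rewrite ger0_norm ?ge_min ?lexx ?orbT// le_min sqr_ge0 ler0n.
    - exact: integrable_addr.
    by move=> x _; apply: sqr_min_le; exact: ler0n.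
  rewrite RintegralD// !RintegralZl//; apply: lerD; first by rewrite ler_wpM2l.
  rewrite -mulrA -[leRHS]mulr1 ler_wpM2l//.
  apply: (@le_trans _ _ (n%:R * eta)); first by rewrite ler_wpM2l ?ler0n.
  by rewrite ler_pdivrMr// mul1r ler_nat.
suff : (\int[mu]_(x in S) (vcomp u i x ^+ 2 * vcomp u i x ^+ 2)%:E <= (4 * Q + 4)%:E)%E.
  by move=> /le_lt_trans; apply; exact: ltry.
have [mu_ iu2] := lu'.
have mm (n : nat) : measurable_fun S (fun x => Num.min (vcomp u i x ^+ 2) n%:R).
  by apply: measurable_minr => //; exact: measurable_funX.
apply: (@integral_eventually_le _ _ _ mu S
  (fun n x => vcomp u i x ^+ 2 * Num.min (vcomp u i x ^+ 2) n%:R)) => //.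
- by move=> n; apply: measurable_funM; [exact: measurable_funX|exact: mm].
- by move=> n x _; apply: mulr_ge0; [exact: sqr_ge0|rewrite le_min sqr_ge0 ler0n].
- move=> x _; exists (Num.truncn (vcomp u i x ^+ 2)).+1 => // n /= hn.
  congr (_ * _); apply/min_idPl; apply: (@le_trans _ _ (Num.truncn (vcomp u i x ^+ 2)).+1%:R).
    by rewrite ltW// truncnS_gt.
  by rewrite ler_nat.
move=> n; have := bound n; rewrite -lee_fin /Rintegral fineK//.
apply: (@integrable_fin_num _ _ _ mu) => //.
apply: (integrable_bounded_on (M := n%:R)) => // x _.
by rewrite ger0_norm ?ge_min ?lexx ?orbT// le_min sqr_ge0 ler0n.
Qed.

Lemma compactly_contained_sub O O' : compactly_contained O' O -> O' `<=` O.
Proof. by case=> _ h x Ox; apply: h; exact: subset_closure. Qed.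

Lemma is_wgrad_sub O O' (u : R * R -> 'rV[R]_2) G : open O -> open O' -> O' `<=` O ->
  is_wgrad O u G -> is_wgrad O' u G.
Proof.
move=> oO oO' OO W i j.
have mO := open_measurable2 oO; have mO' := open_measurable2 oO'.
have [lu lg E] := W i j.
have lsub (h : R * R -> R) : L1loc O h -> L1loc O' h.
  move=> [mh ih]; split; first exact: measurable_funS mh.
  by move=> K cK KO; apply: ih => //; exact: subset_trans OO.
split; [exact: lsub|exact: lsub|].
move=> phi tphi; have [K [cK KO g0 p0]] := test_fun_zero_out tphi; have [sp _] := tphi.
have tphi' : test_fun O phi by split => //; exists K; split => //; exact: subset_trans OO.
have loc (h k : R * R -> R) : (forall x, ~ K x -> k x = 0) ->
    \int[mu]_(x in O') (h x * k x) = \int[mu]_(x in O) (h x * k x).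
  move=> kz; rewrite Rintegral_zero_out; last by move=> x nx; rewrite kz ?mulr0// => /KO.
  rewrite [in RHS]Rintegral_zero_out// => x nx; rewrite kz ?mulr0// => /KO /OO //.
rewrite loc; last exact: p0.
by rewrite loc// E.
Qed.

(** For |t| <= 1 the square dominates, otherwise the fourth power; the latter is where [s <= 2]
    enters. *)
Lemma powR_le_sqr4 (t s : R) : 0 < s -> s <= 2 -> `|t| `^ (2 + s) <= t ^+ 2 + t ^+ 2 * t ^+ 2.
Proof.
move=> s0 s2; have n0 : 0 <= `|t| := normr_ge0 t.
have e2 : t ^+ 2 = `|t| `^ 2 by rewrite powR_mulrn// -normrX ger0_norm// sqr_ge0.
have s22 : 0 <= t ^+ 2 := sqr_ge0 t.
have [t1|t1] := leP `|t| 1.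
  rewrite -[leLHS]addr0; apply: lerD; last exact: mulr_ge0.
  rewrite e2 powRD; last by rewrite gt_eqF// ltr_wpDr// ltW.
  rewrite ler_piMr ?powR_ge0//; have := @ge0_ler_powR R s (ltW s0) `|t| 1.
  by rewrite !nnegrE powR1 => /(_ n0 ler01 t1).
rewrite -[leLHS]add0r; apply: lerD => //.
apply: (@le_trans _ _ (`|t| `^ (2 + 2))).
  by apply: ler_powR; [exact: ltW|rewrite lerD2l].
by rewrite powRD// -?e2// gt_eqF// addr_gt0.
Qed.

Lemma powR_le_gnorm (A : 'M[R]_2) i j (s : R) : 0 < s ->
  `|A i j| `^ (2 + s) <= gnorm A ^+ 2 * gnorm A `^ s.
Proof.
move=> s0; have g0 := gnorm_ge0 A.
rewrite -powR_mulrn// -powRD; last by rewrite gt_eqF// ltr_wpDr// ltW.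
apply: ge0_ler_powR; rewrite ?nnegrE//; first by rewrite addr_ge0// ltW.
have h (x y z w : R) : 0 <= x -> 0 <= y -> 0 <= z -> 0 <= w ->
   [/\ x <= x + y + z + w, y <= x + y + z + w, z <= x + y + z + w & w <= x + y + z + w].
  by move=> *; split; lra.
have [h1 h2 h3 h4] := h _ _ _ _ (normr_ge0 (A 0 0)) (normr_ge0 (A 0 1)) (normr_ge0 (A 1 0)) (normr_ge0 (A 1 1)).
by case: (ord2E i) => ->; case: (ord2E j) => ->.
Qed.

End local_integrability.

(** * Assembly of the estimates with the exponent 2 + s *)

Unset Implicit Arguments.
Set Strict Implicit.

Theorem proposition2p2 (R : realType) (Omega : set (R * R)) (f : R * R -> R)
    (U0 u : R * R -> 'rV[R]_2) :
  domain Omega ->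
  Lp_on Omega +oo%E f ->
  H1 Omega U0 ->
  H1_bc Omega U0 u ->
  weak_solution Omega f u ->
  mean_coercive Omega f ->
  exists2 p : R, 2 < p & W1p_loc Omega p%:E u.
Proof.
move=> [_ oO _] lf _ [hu _] W [gam gam0 C].
have mO := open_measurable2 oO.
have mf : measurable_fun Omega f.
  apply/(measurable_restrictT _ mO).
  by move: lf; rewrite /Lp_on inE => /andP[/[!inE]].
have [f0 [M M0 [mf0 f0M ff]]] := Linfty_bounded mO lf.
have EQ := weak_solution_classical oO mf mf0 f0M ff hu W.
have CO := coercive_classical oO mf mf0 f0M ff C.
have [K K0 RH] := reverse_hoelder M0 gam0.
have {EQ CO}RH := RH _ _ _ oO hu mf0 f0M EQ CO.
have [s /andP[s0 s2] higher] := gehring K0.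
have p0 : 0 < 2 + s by rewrite addr_gt0.
have [ww lu lG] := H1_wgrad oO hu.
exists (2 + s); first by rewrite ltrDl.
move=> O' oO' cc; have OO := compactly_contained_sub cc; have mO' := open_measurable2 oO'.
have mp (h : R * R -> R) : measurable_fun setT h -> measurable_fun setT (fun y => `|h y| `^ (2 + s)).
  by move=> mh; apply: (measurableT_comp (measurable_powR _)); exact: measurableT_comp.
have mpO (S : set (R * R)) (h : R * R -> R) : measurable_fun S h -> measurable_fun S (fun y => `|h y| `^ (2 + s)).
  by move=> mh; apply: (measurableT_comp (measurable_powR _)); exact: measurableT_comp.
split.
  move=> i; apply: (Lp_on_cover p0 mO' _ cc).
    by apply: measurable_funS OO _ => //; case: (lu i).
  move=> x Ox; have [r r0 rO] := open_csq oO Ox.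
  have r2 : 0 < r / 2 by rewrite divr_gt0.
  have rr : r / 2 < r by rewrite ltr_pdivrMr// ltr_pMr// ltr1n.
  exists (r / 2) => //; have fin := fourth_power_local i oO hu rO r2 rr.
  have mc : measurable (csq x (r / 2)) by exact: measurable_csq.
  have cO : csq x (r / 2) `<=` Omega by apply: subset_trans rO; apply: csqS; exact: ltW.
  have [mui iu2] := L2onS mO mc cO (lu i).
  apply: (@le_lt_trans _ _ (\int[leb2 (R:=R)]_(y in csq x (r / 2)) ((vcomp u i y ^+ 2)%:E +
     (vcomp u i y ^+ 2 * vcomp u i y ^+ 2)%:E))%E).
    apply: (@le_trans _ _ (\int[leb2 (R:=R)]_(y in csq x (r / 2)) (`|vcomp u i y| `^ (2 + s))%:E)%E).
      apply: ge0_subset_integral => //; first exact: measurableI.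
      by apply/measurable_EFinP; exact: mpO.
    apply: ge0_le_integral => //.
    - by apply/measurable_EFinP; exact: mpO.
    - apply: emeasurable_funD; apply/measurable_EFinP; first exact: measurable_funX.
      by apply: measurable_funM; exact: measurable_funX.
    by move=> y _; rewrite -EFinD lee_fin; exact: powR_le_sqr4.
  rewrite ge0_integralD//.
  - rewrite lte_add_pinfty//.
    by rewrite (Rintegral_EFin mc iu2) ltry.
  - by move=> y _; rewrite lee_fin sqr_ge0.
  - by apply/measurable_EFinP; exact: measurable_funX.
  - by move=> y _; rewrite lee_fin mulr_ge0 ?sqr_ge0.
  - by apply/measurable_EFinP; apply: measurable_funM; exact: measurable_funX.
(* The gradient chosen on [Omega] also serves on the subdomain, so that the reverse Hoelder
   inequality applies to the very function to be integrated. *)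
exists (wgrad Omega u); split; first exact: is_wgrad_sub ww.
move=> i j; apply: (Lp_on_cover p0 mO' _ cc).
  by apply: measurable_funS OO _ => //; case: (lG i j).
move=> x Ox; have [r r0 rO] := open_csq oO Ox.
(* Gehring's lemma wants radius at most 1, so that the distance weight does not exceed 1. *)
pose R0 := Num.min r 1; have R00 : 0 < R0 by rewrite lt_min r0 ltr01.
have R01 : R0 <= 1 by rewrite ge_min lexx orbT.
have RO : csq x R0 `<=` Omega by apply: subset_trans rO; apply: csqS; rewrite ge_min lexx.
have mc e : measurable (csq x e) by exact: measurable_csq.
(* Cut to the square, [g] is globally square integrable; squares inside [csq x R0] do not notice the
   cut, so the reverse Hoelder inequality is unaffected. *)
pose g := (fun y => gnorm (wgrad Omega u y)) \_ (csq x R0).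
have lgc : L2on (csq x R0) (fun y => gnorm (wgrad Omega u y)).
  have n2 a b : L2on (csq x R0) (fun y => `|wgrad Omega u y a b|).
    have [mG iG2] := L2onS mO (mc _) RO (lG a b); split; first exact: measurableT_comp.
    by under eq_fun do rewrite -normrX ger0_norm ?sqr_ge0//.
  by apply: L2onD => //; apply: L2onD => //; exact: L2onD.
have gE y : csq x R0 y -> g y = gnorm (wgrad Omega u y) by move=> cy; rewrite /g patchE mem_set.
have gout y : ~ csq x R0 y -> g y = 0 by move=> cy; rewrite /g patchE memNset.
have g0 y : 0 <= g y by rewrite /g patchE; case: ifP => // _; exact: gnorm_ge0.
have mg : measurable_fun setT g by apply/(measurable_restrictT _ (mc _)); case: lgc.
have ig2 : (leb2 (R:=R)).-integrable setT (EFin \o (fun y => g y ^+ 2)).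
  have := (@integrable_mkcond _ _ _ (leb2 (R:=R)) _ (EFin \o (fun y => gnorm (wgrad Omega u y) ^+ 2)) (mc R0)).1 lgc.2.
  congr (_.-integrable _ _); apply/funext => y /=; rewrite /g !patchE; case: ifP => //= _.
  by rewrite expr0n.
have gRH c e : 0 < e -> csq c (3 * e) `<=` csq x R0 ->
    \int[leb2 (R:=R)]_(y in csq c e) g y ^+ 2 <=
      K / e ^+ 2 * (\int[leb2 (R:=R)]_(y in csq c (2 * e)) g y) ^+ 2.
  move=> e0 ce; have := RH c e e0 (subset_trans ce RO).
  have sub t : t <= 3 * e -> csq c t `<=` csq x R0 by move=> te; apply: subset_trans ce; exact: csqS.
  have -> : \int[leb2 (R:=R)]_(y in csq c e) g y ^+ 2 = \int[leb2 (R:=R)]_(y in csq c e) gnorm (wgrad Omega u y) ^+ 2.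
    by apply: eq_Rintegral => y /set_mem cy; rewrite gE//; apply: sub cy; lra.
  have -> // : \int[leb2 (R:=R)]_(y in csq c (2 * e)) g y = \int[leb2 (R:=R)]_(y in csq c (2 * e)) gnorm (wgrad Omega u y).
  by apply: eq_Rintegral => y /set_mem cy; rewrite gE//; apply: sub cy; lra.
exists (R0 / 2); first by rewrite divr_gt0.
have := higher g x R0 mg g0 ig2 gout R00 R01 gRH; apply: le_lt_trans.
have mcR := mc (R0 / 2); have hR : R0 / 2 <= R0 by rewrite ler_pdivrMr// ler_pMr// ler1n.
have [mGij _] := L2onS mO (mc (R0 / 2)) (subset_trans (csqS hR) RO) (lG i j).
apply: (@le_trans _ _ (\int[leb2 (R:=R)]_(y in csq x (R0 / 2)) (`|wgrad Omega u y i j| `^ (2 + s))%:E)%E).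
  apply: ge0_subset_integral => //; first exact: measurableI.
  by apply/measurable_EFinP; exact: mpO.
apply: ge0_le_integral => //.
- by apply/measurable_EFinP; exact: mpO.
- apply/measurable_EFinP; apply: measurable_funTS; apply: measurable_funM; first exact: measurable_funX.
  exact: (measurableT_comp (measurable_powR s) mg).
by move=> y cy; rewrite lee_fin gE; [exact: powR_le_gnorm|exact: csqS hR _ cy].
Qed.
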